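(* There is a (randomized) padded-decomposition algorithm for $n$-point metrics in $\ell_\infty^d$ that achieves quality $O(\log n\cdot\log\log d)$ in running time $\tilde O(nd^2)$. That is: there is an algorithm that, given a set $X\subseteq\mathbb{R}^d$ of $n$ points equipped with the metric $d_X(x,y)=\|x-y\|_\infty$ and a diameter bound $\Delta>0$, runs in time $\tilde O(nd^2)$ and outputs a partition of $X$ sampled from a $(\beta,\delta,\Delta)$-padded decomposition of $(X,d_X)$, for some $\beta,\delta>0$ with $\max\{\beta,\delta^{-1}\}\le O(\log n\cdot\log\log d)$.
   Context: Let $(X,d_X)$ be a finite metric space. For a partition $\mathcal{P}$ of $X$, its elements are called clusters, and $\mathcal{P}(x)$ denotes the cluster containing $x\in X$. The partition $\mathcal{P}$ is $\Delta$-bounded if every cluster has diameter at most $\Delta$, i.e. $d_X(x,y)\le\Delta$ for every two points $x,y$ in the same cluster. A distribution $\mathcal{D}$ over $\Delta$-bounded partitions of $X$ is a $(\beta,\delta,\Delta)$-padded decomposition if for all $x\in X$ and all $\gamma\in[0,\delta]$, $$\Pr_{\mathcal{P}\sim\mathcal{D}}\big[B(x,\gamma\Delta)\subseteq\mathcal{P}(x)\big]\ge e^{-\beta\gamma},$$ where $B(x,r)=\{y\in X: d_X(x,y)\le r\}$ is the closed ball of radius $r$ in $X$. A padded-decomposition algorithm of quality $q\ge1$ is an algorithm that, given a metric space $(X,d_X)$ and $\Delta>0$, outputs a partition sampled from a $(\beta,\delta,\Delta)$-padded decomposition with $\max\{\beta,\delta^{-1}\}\le q$. $\ell_\infty^d$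 is $\mathbb{R}^d$ with the norm $\|x\|_\infty=\max_i|x_i|$; the input is given by the coordinates of the points. $\tilde O(f)$ hides factors polylogarithmic in $f$; constants in $O(\cdot)$ are universal. Running time counts unit-cost operations on real numbers. Logarithmic factors inside $O(\cdot)$ are read as at least $1$ (i.e. $n,d$ larger than a constant). *)

(* Defs.v *)
From mathcomp Require Import all_boot all_order all_algebra.
From mathcomp Require Import all_classical all_reals all_analysis.
Import Order.TTheory GRing.Theory Num.Theory.
Import numFieldNormedType.Exports.

Set Implicit Arguments.
Unset Strict Implicit.
Unset Printing Implicit Defensive.

Local Open Scope ring_scope.

(* Distributions on a finite type, given by their probability mass function. *)

Definition is_distribution (R : realType) (T : finType) (D : {ffun T -> R}) :=
  (forall t, 0 <= D t) /\ \sum_t D t = 1.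

Definition prob_of (R : realType) (T : finType) (D : {ffun T -> R})
    (E : pred T) : R :=
  \sum_(t | E t) D t.

(* Padded decompositions of a finite metric space (X, dX). A partition of X is
   the set of its clusters, and [finset.pblock Q x] is the cluster Q(x). *)

Definition cball (R : realType) (X : finType) (dX : X -> X -> R) (x : X)
    (r : R) : {set X} :=
  [set y | dX x y <= r].

Definition bounded_partition (R : realType) (X : finType) (dX : X -> X -> R)
    (Delta : R) (Q : {set {set X}}) :=
  finset.partition Q [set: X] /\
  forall C, C \in Q -> forall x y, x \in C -> y \in C -> dX x y <= Delta.

Definition padded_decomposition (R : realType) (X : finType)
    (dX : X -> X -> R) (beta delta Delta : R)
    (D : {ffun {set {set X}} -> R}) :=
  [/\ is_distribution D,
      forall Q, D Q != 0 -> bounded_partition dX Delta Q &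
      forall (x : X) (gamma : R), 0 <= gamma <= delta ->
        expR (- (beta * gamma)) <=
        prob_of D [pred Q | cball dX x (gamma * Delta) \subset finset.pblock Q x]].

(* The machine: a randomized real RAM, programmed in a structured language.
   The memory is made of integer arrays and of real arrays, both indexed by
   nat; an array name is a literal, so that a program uses finitely many
   arrays, and a scalar variable is a cell of an array.

   - The unit-cost operations on reals are + - * /, order comparison, and
     conversion of an integer. There is no rounding and no other way from reals
     to integers than a comparison. Division by 0 returns 0, which a program
     could emulate with a test.
   - Integers serve as addresses, counters and labels. As in the RAM of Cook
     and Reckhow they have + and - (truncated at 0) but no multiplication,
     which at unit cost on unbounded integers would make the machine
     unrealistically powerful.
   - [RUnif a i] stores the next number of the random tape in cell i of the
     real array a. *)

Inductive iexp : Type :=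
  | INum of nat
  | IGet of nat & iexp
  | IAdd of iexp & iexp
  | ISub of iexp & iexp.

Inductive rexp : Type :=
  | RInt of iexp
  | RGet of nat & iexp
  | RAdd of rexp & rexp
  | RSub of rexp & rexp
  | RMul of rexp & rexp
  | RDiv of rexp & rexp.

Inductive bexp : Type :=
  | ILe of iexp & iexp
  | RLe of rexp & rexp
  | BNot of bexp
  | BAnd of bexp & bexp.

Inductive program : Type :=
  | Skip
  | ISet of nat & iexp & iexp
  | RSet of nat & iexp & rexp
  | RUnif of nat & iexp
  | Seq of program & program
  | If of bexp & program & program
  | While of bexp & program.

Record state (R : realType) : Type := State {
  ints : nat -> nat -> nat;
  reals : nat -> nat -> R;
  tape_pos : nat
}.

Definition upd (T : Type) (f : nat -> nat -> T) (a i : nat) (v : T) :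
    nat -> nat -> T :=
  fun b j => if (b == a) && (j == i) then v else f b j.

Fixpoint ieval (R : realType) (s : state R) (e : iexp) : nat :=
  match e with
  | INum m => m
  | IGet a e1 => ints s a (ieval s e1)
  | IAdd e1 e2 => (ieval s e1 + ieval s e2)%N
  | ISub e1 e2 => (ieval s e1 - ieval s e2)%N
  end.

Fixpoint reval (R : realType) (s : state R) (e : rexp) : R :=
  match e with
  | RInt e1 => (ieval s e1)%:R
  | RGet a e1 => reals s a (ieval s e1)
  | RAdd e1 e2 => reval s e1 + reval s e2
  | RSub e1 e2 => reval s e1 - reval s e2
  | RMul e1 e2 => reval s e1 * reval s e2
  | RDiv e1 e2 => reval s e1 / reval s e2
  end.

Fixpoint beval (R : realType) (s : state R) (b : bexp) : bool :=
  match b with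
  | ILe e1 e2 => (ieval s e1 <= ieval s e2)%N
  | RLe e1 e2 => reval s e1 <= reval s e2
  | BNot b1 => ~~ beval s b1
  | BAnd b1 b2 => beval s b1 && beval s b2
  end.

(* Every node of an evaluated expression costs 1. *)

Fixpoint icost (e : iexp) : nat :=
  match e with
  | INum _ => 1
  | IGet _ e1 => (icost e1).+1
  | IAdd e1 e2 | ISub e1 e2 => (icost e1 + icost e2).+1
  end.

Fixpoint rcost (e : rexp) : nat :=
  match e with
  | RInt e1 | RGet _ e1 => (icost e1).+1
  | RAdd e1 e2 | RSub e1 e2 | RMul e1 e2 | RDiv e1 e2 =>
      (rcost e1 + rcost e2).+1
  end.

Fixpoint bcost (b : bexp) : nat :=
  match b with
  | ILe e1 e2 => (icost e1 + icost e2).+1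
  | RLe e1 e2 => (rcost e1 + rcost e2).+1
  | BNot b1 => (bcost b1).+1
  | BAnd b1 b2 => (bcost b1 + bcost b2).+1
  end.

(* [exec u p s t s']: with the numbers u 0, u 1, u 2, ... on the random tape,
   p started in s halts in s' after time t. *)

Inductive exec (R : realType) (u : nat -> R) :
    program -> state R -> nat -> state R -> Prop :=
  | exec_Skip s : exec u Skip s 1 s
  | exec_ISet a i e s :
      exec u (ISet a i e) s (icost i + icost e).+1
        (State (upd (ints s) a (ieval s i) (ieval s e)) (reals s) (tape_pos s))
  | exec_RSet a i e s :
      exec u (RSet a i e) s (icost i + rcost e).+1
        (State (ints s) (upd (reals s) a (ieval s i) (reval s e)) (tape_pos s))
  | exec_RUnif a i s :
      exec u (RUnif a i) s (icost i).+1
        (State (ints s) (upd (reals s) a (ieval s i) (u (tape_pos s)))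
               (tape_pos s).+1)
  | exec_Seq p1 p2 s t1 s1 t2 s2 :
      exec u p1 s t1 s1 -> exec u p2 s1 t2 s2 ->
      exec u (Seq p1 p2) s (t1 + t2).+1 s2
  | exec_IfT b p1 p2 s t s' :
      beval s b -> exec u p1 s t s' ->
      exec u (If b p1 p2) s (bcost b + t).+1 s'
  | exec_IfF b p1 p2 s t s' :
      ~~ beval s b -> exec u p2 s t s' ->
      exec u (If b p1 p2) s (bcost b + t).+1 s'
  | exec_WhileF b p s :
      ~~ beval s b -> exec u (While b p) s (bcost b).+1 s
  | exec_WhileT b p s t1 s1 t2 s2 :
      beval s b -> exec u p s t1 s1 -> exec u (While b p) s1 t2 s2 ->
      exec u (While b p) s (bcost b + t1 + t2).+1 s2.

(* Input: n and d are cells 0 and 1 of integer array 0, coordinate k of point i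
   is cell i * d + k of real array 0, Delta is cell 0 of real array 1, and all
   other cells are 0. *)

Definition input (R : realType) (n d : nat) (x : 'I_n -> 'rV[R]_d)
    (Delta : R) : state R :=
  State
    (fun a j => match a, j with 0, 0 => n | 0, 1 => d | _, _ => 0 end)%N
    (fun a j =>
       match a with
       | 0%N =>
           match (insub (j %/ d)%N : option 'I_n),
                 (insub (j %% d)%N : option 'I_d) with
           | Some i, Some k => x i 0 k
           | _, _ => 0
           end
       | 1%N => if j == 0%N then Delta else 0
       | _ => 0
       end)
    0%N.

(* Output: points i and j are in the same cluster if and only if cells i and j
   of integer array 1 are equal. *)

Definition output (R : realType) (n : nat) (s : state R) : {set {set 'I_n}} :=
  finset.preim_partition (fun i : 'I_n => ints s 1 i) [set: 'I_n].

Definition halts_within (R : realType) (A : program) (u : nat -> R)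
    (s : state R) (T : R) :=
  exists t s', exec u A s t s' /\ t%:R <= T.

Definition halts_with (R : realType) (n : nat) (A : program) (u : nat -> R)
    (s : state R) (Q : {set {set 'I_n}}) :=
  exists t s', exec u A s t s' /\ output n s' = Q.

Definition unit_tape (R : realType) (u : nat -> R) :=
  forall m, 0 <= u m <= 1.

Definition iid_uniform (R : realType) (disp : measure_display)
    (Omega : measurableType disp) (P : probability Omega R)
    (U : nat -> {RV P >-> R}) :=
  [/\ forall w, unit_tape (fun m => U m w),
      forall m (B : set R), measurable B ->
        distribution P (U m) B = uniform_prob (@ltr01 R) B &
      forall (s : seq nat) (B : nat -> set R), uniq s ->
        (forall m, m \in s -> measurable (B m)) ->
        P [set w | forall m, m \in s -> B m (U m w)]%classic =
        (\prod_(m <- s) P (U m @^-1` B m)%classic)%E].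

Definition output_distribution (R : realType) (disp : measure_display)
    (Omega : measurableType disp) (P : probability Omega R)
    (U : nat -> {RV P >-> R}) (n : nat) (A : program) (s : state R)
    (D : {ffun {set {set 'I_n}} -> R}) :=
  forall Q : {set {set 'I_n}},
    let E := [set w | halts_with A (fun m => U m w) s Q]%classic in
    measurable E /\ P E = (D Q)%:E.

(* On 'rV[R]_d the library norm is the maximum of the absolute values of the
   coordinates (mx_normrE). *)
Definition linf_dist (R : realType) (n d : nat) (x : 'I_n -> 'rV[R]_d)
    (i j : 'I_n) : R :=
  `|x i - x j|.

Definition log1 (R : realType) (t : R) : R := Num.max 1 (ln t).

Definition soft_O (R : realType) (C : R) (k : nat) (f : R) : R :=
  C * f * log1 f ^+ k.

(* Main.v *)
(* Give every point 2d signed coordinates ("directions"), so that being in a ball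
   or in a box is a one-sided condition in each direction.  A set of m points is
   split recursively, with one uniform number per split.  In each direction, move
   outwards from the median through J = O(log log d) windows of width
   Delta / (4J), and let f and f' be the numbers of points beyond the inner and
   the outer end of a window.

   If m <= 4d f' and (f / m)^2 <= f' / m in some window, cut at a random threshold
   in it.  The tail of the threshold is the power r = O(log (m / f')) of a linear
   ramp.  Where this power is not small, a ball that the light side reaches is cut
   with probability O(r J gamma) = O(J gamma ln (m / f)), which is paid for by the
   decrease from m to at most f points; where it is small, the probability is
   O(J gamma f' / m), which is paid for by the decrease to m - f' on the heavy
   side.  If no window is good, the fraction of points beyond is squared from one
   window to the next, and so drops below 1 / (4d): the box of radius Delta / 4
   around the medians contains half of the points, and a box with uniform radius
   in [Delta / 4, Delta / 2] becomes a cluster.  By induction a ball of radius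
   gamma Delta in a set of m points is not cut with probability at least
   exp (- O(J gamma) (1 + ln m)).

   A cut leaves at most the fraction 1 - 1 / (4d) of the points on either side, so
   a point takes part in O(d log n) splits, each of cost O(d polylog) per point. *)
Require Import Defs.
From mathcomp Require Import all_boot all_order all_algebra.
From mathcomp Require Import all_classical all_reals all_analysis.
From mathcomp Require Import zify ring lra.
Import Order.TTheory GRing.Theory Num.Theory.
Import numFieldNormedType.Exports.
Set Implicit Arguments.
Unset Strict Implicit.
Unset Printing Implicit Defensive.
Local Open Scope ring_scope.

(** * Executions of programs *)

(** A uniform threshold would cut a ball with probability of order J gamma whatever the sizes of the
    sides, and a light side of few points leaves the heavy side too little gain to pay for that. A
    power r of the ramp moves the loss to outcomes in which the ball falls on the light side, where
    ln (m / f) is gained. This needs r = O(ln (m / f)), whereas r is computed from f'; the condition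
    (f / m)^2 <= f' / m says ln (m / f') <= 2 ln (m / f) and bridges the two. Its failure squares
    the fraction, and 1 / 2 squared J times is at most 1 / (4 d) once 2 ^ (2 ^ J) >= 4 d: hence log
    log d windows. The restriction to gamma = O(1 / (J log n)) keeps r J gamma small, so that where
    the power is not small it varies by at most a factor 2 across the ball.

    Each split uses its random number only to select a subset of the points. So the output
    distribution is a finite tree, and the only events needed are cylinders of the tape. All
    comparisons of exp (- a (1 + ln m)) for different m are linearised by exp y >= 1 + y. *)

Ltac exec_inv e :=
  inversion e; subst;
  try match goal with
  | h : is_true ?b, h' : is_true (~~ ?b) |- _ => by rewrite h in h'
  end.

(** [halts_with] asks only for some execution; determinism turns it into an equation about the
    output of the one that is constructed. *)
Lemma exec_det (R : realType) (u : nat -> R) p s t1 s1 t2 s2 :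
  exec u p s t1 s1 -> exec u p s t2 s2 -> s1 = s2.
Proof.
move=> e1; elim: e1 t2 s2 => {p s t1 s1}.
- by move=> s t2 s2 e; exec_inv e.
- by move=> a i e s t2 s2 e'; exec_inv e'.
- by move=> a i e s t2 s2 e'; exec_inv e'.
- by move=> a i s t2 s2 e'; exec_inv e'.
- move=> p1 p2 s t1 s1 t2 s2 _ IH1 _ IH2 t3 s3 e; exec_inv e.
  by match goal with h : exec _ p1 _ _ _ |- _ => have := IH1 _ _ h end => ?; subst; eauto.
- by move=> b p1 p2 s t s' hb _ IH t2 s2 e; exec_inv e; eauto.
- by move=> b p1 p2 s t s' hb _ IH t2 s2 e; exec_inv e; eauto.
- by move=> b p s hb t2 s2 e; exec_inv e.
- move=> b p s t1 s1 t2 s2 hb _ IH1 _ IH2 t3 s3 e; exec_inv e.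
  by match goal with h : exec _ p _ _ _ |- _ => have := IH1 _ _ h end => ?; subst; eauto.
Qed.

Fixpoint int_writes (p : program) : seq nat :=
  match p with
  | ISet a _ _ => [:: a]
  | Seq p1 p2 | If _ p1 p2 => int_writes p1 ++ int_writes p2
  | While _ p => int_writes p
  | _ => [::]
  end.

Fixpoint real_writes (p : program) : seq nat :=
  match p with
  | RSet a _ _ | RUnif a _ => [:: a]
  | Seq p1 p2 | If _ p1 p2 => real_writes p1 ++ real_writes p2
  | While _ p => real_writes p
  | _ => [::]
  end.

Fixpoint deterministic (p : program) : bool :=
  match p with
  | RUnif _ _ => false
  | Seq p1 p2 | If _ p1 p2 => deterministic p1 && deterministic p2
  | While _ p => deterministic p
  | _ => true
  end.

(** A footprint read off the program text. Loop invariants then mention only what the loop changes,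
    and membership side conditions are settled by computation. *)
Definition frame (R : realType) (p : program) (s s' : state R) :=
  [/\ forall a, a \notin int_writes p -> ints s' a = ints s a,
      forall a, a \notin real_writes p -> reals s' a = reals s a &
      deterministic p -> tape_pos s' = tape_pos s].

Lemma upd_other (T : Type) (f : nat -> nat -> T) a i v b :
  (b == a) = false -> upd f a i v b = f b.
Proof. by move=> ba; apply: funext => j; rewrite /upd ba. Qed.

Lemma exec_frame (R : realType) (u : nat -> R) p s t s' :
  exec u p s t s' -> frame p s s'.
Proof.
elim=> {p s t s'} //=.
- move=> a i e s; split=> //= b; rewrite inE => /negbTE.
  exact: upd_other.
- move=> a i e s; split=> //= b; rewrite inE => /negbTE.
  exact: upd_other.
- move=> a i s; split=> //= b; rewrite inE => /negbTE.
  exact: upd_other.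
- move=> p1 p2 s t1 s1 t2 s2 _ [a1 b1 c1] _ [a2 b2 c2]; split=> /=.
  + by move=> a; rewrite mem_cat negb_or => /andP[? ?]; rewrite a2 ?a1.
  + by move=> a; rewrite mem_cat negb_or => /andP[? ?]; rewrite b2 ?b1.
  + by move=> /andP[? ?]; rewrite c2 ?c1.
- move=> b p1 p2 s t s' _ _ [a1 b1 c1]; split=> /=.
  + by move=> a; rewrite mem_cat negb_or => /andP[? ?]; rewrite a1.
  + by move=> a; rewrite mem_cat negb_or => /andP[? ?]; rewrite b1.
  + by move=> /andP[? ?]; rewrite c1.
- move=> b p1 p2 s t s' _ _ [a1 b1 c1]; split=> /=.
  + by move=> a; rewrite mem_cat negb_or => /andP[? ?]; rewrite a1.
  + by move=> a; rewrite mem_cat negb_or => /andP[? ?]; rewrite b1.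
  + by move=> /andP[? ?]; rewrite c1.
- move=> b p s t1 s1 t2 s2 _ _ [a1 b1 c1] _ [a2 b2 c2]; split=> /=.
  + by move=> a ha; rewrite a2 ?a1.
  + by move=> a ha; rewrite b2 ?b1.
  + by move=> h; rewrite c2 ?c1.
Qed.

Lemma frame_trans (R : realType) p (s1 s2 s3 : state R) :
  frame p s1 s2 -> frame p s2 s3 -> frame p s1 s3.
Proof.
move=> [a1 b1 c1] [a2 b2 c2]; split.
- by move=> a ha; rewrite a2 ?a1.
- by move=> a ha; rewrite b2 ?b1.
- by move=> h; rewrite c2 ?c1.
Qed.

(** Total correctness with the running time as an argument of the postcondition. The rules below are
    used backwards, so a proof follows the program text. *)
Definition ok (R : realType) (u : nat -> R) p s (Q : nat -> state R -> Prop) :=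
  exists t s', exec u p s t s' /\ Q t s'.

Section Rules.
Variables (R : realType) (u : nat -> R).
Implicit Types (p : program) (s : state R) (Q : nat -> state R -> Prop).

Lemma ok_weaken p s Q Q' :
  ok u p s Q -> (forall t s', frame p s s' -> Q t s' -> Q' t s') -> ok u p s Q'.
Proof.
by case=> t [s' [e q]] h; exists t, s'; split=> //; apply: h => //; apply: exec_frame e.
Qed.

Lemma ok_skip s Q : Q 1%N s -> ok u Skip s Q.
Proof. by move=> q; exists 1%N, s; split=> //; constructor. Qed.

Lemma ok_iset a i e s Q :
  Q (icost i + icost e).+1
    (State (upd (ints s) a (ieval s i) (ieval s e)) (reals s) (tape_pos s)) ->
  ok u (ISet a i e) s Q.
Proof. by move=> q; do 2 eexists; split; [constructor|exact: q]. Qed.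

Lemma ok_rset a i e s Q :
  Q (icost i + rcost e).+1
    (State (ints s) (upd (reals s) a (ieval s i) (reval s e)) (tape_pos s)) ->
  ok u (RSet a i e) s Q.
Proof. by move=> q; do 2 eexists; split; [constructor|exact: q]. Qed.

Lemma ok_runif a i s Q :
  Q (icost i).+1
    (State (ints s) (upd (reals s) a (ieval s i) (u (tape_pos s)))
       (tape_pos s).+1) ->
  ok u (RUnif a i) s Q.
Proof. by move=> q; do 2 eexists; split; [constructor|exact: q]. Qed.

Lemma ok_seq p1 p2 s Q :
  ok u p1 s (fun t1 s1 => ok u p2 s1 (fun t2 s2 => Q (t1 + t2).+1 s2)) ->
  ok u (Seq p1 p2) s Q.
Proof.
case=> t1 [s1 [e1 [t2 [s2 [e2 q]]]]].
by exists (t1 + t2).+1, s2; split=> //; apply: exec_Seq e2.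
Qed.

Lemma ok_if b p1 p2 s Q :
  (beval s b -> ok u p1 s (fun t s' => Q (bcost b + t).+1 s')) ->
  (~~ beval s b -> ok u p2 s (fun t s' => Q (bcost b + t).+1 s')) ->
  ok u (If b p1 p2) s Q.
Proof.
move=> h1 h2; have [hb|hb] := boolP (beval s b).
  by case: (h1 hb) => t [s' [e q]]; do 2 eexists; split; [apply: exec_IfT e|].
by case: (h2 hb) => t [s' [e q]]; do 2 eexists; split; [apply: exec_IfF e|].
Qed.

(** [V] is a budget of time rather than a count of rounds: every round must lower it by its own
    cost, so one inequality gives both termination and the running time. *)
Lemma ok_while (Inv : state R -> Prop) (V : state R -> nat) b p s Q :
  (forall s1, frame p s s1 -> Inv s1 -> beval s1 b ->
     ok u p s1 (fun t s2 => Inv s2 /\ ((bcost b + t).+1 + V s2 <= V s1)%N)) ->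
  Inv s ->
  (forall t s', frame p s s' -> Inv s' -> ~~ beval s' b ->
     (t + V s' <= V s + (bcost b).+1)%N -> Q t s') ->
  ok u (While b p) s Q.
Proof.
move=> body0 Is0 HQ0; pose Inv' s1 := frame p s s1 /\ Inv s1.
have body s1 : Inv' s1 -> beval s1 b -> ok u p s1 (fun t s2 =>
    Inv' s2 /\ ((bcost b + t).+1 + V s2 <= V s1)%N).
  case=> F1 I1 hb; apply: ok_weaken (body0 s1 F1 I1 hb) _ => t s2 F2 [I2 le2].
  by do !split=> //; have [] := frame_trans F1 F2.
have HQ t s' (I' : Inv' s') := HQ0 t s' (proj1 I') (proj2 I').
have Is : Inv' s by [].
move: Inv' body HQ Is {body0 Is0 HQ0} => {}Inv body HQ Is.
have [k leVk] := ubnP (V s).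
elim: k s leVk Q Is HQ => // k IH s leVk Q Is HQ.
have [hb|hb] := boolP (beval s b); last first.
  exists (bcost b).+1, s; split; first by constructor.
  by apply: HQ => //; rewrite addnC.
have [t1 [s1 [e1 [Is1 le1]]]] := body s Is hb.
have ltV : (V s1 < k)%N by move: le1 leVk; clear; lia.
have [t2 [s2 [e2 [Is2 hb2 le2]]]] :=
  IH s1 ltV (fun t s' => [/\ Inv s', ~~ beval s' b & (t + V s' <= V s1 + (bcost b).+1)%N])
    Is1 (fun t s' h1 h2 h3 => And3 h1 h2 h3).
exists (bcost b + t1 + t2).+1, s2; split; first exact: exec_WhileT e1 e2.
by apply: HQ => //; move: le1 le2; clear; lia.
Qed.

End Rules.

Definition cell a := IGet a (INum 0).
Definition iset a e := ISet a (INum 0) e.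
Definition rcell a := RGet a (INum 0).
Definition rset a e := RSet a (INum 0) e.
Definition ilt e1 e2 := ILe (IAdd e1 (INum 1)) e2.
Definition rlt e1 e2 := BNot (RLe e2 e1).

Definition for_loop v e body :=
  Seq (iset v (INum 0))
    (While (ilt (cell v) e) (Seq body (iset v (IAdd (cell v) (INum 1))))).

Definition set_cell (R : realType) (s : state R) v i :=
  State (upd (ints s) v 0%N i) (reals s) (tape_pos s).

Lemma updE (T : Type) (f : nat -> nat -> T) a i v b j :
  upd f a i v b j = if (b == a) && (j == i) then v else f b j.
Proof. by []. Qed.

Lemma upd_same (T : Type) (f : nat -> nat -> T) a i v : upd f a i v a i = v.
Proof. by rewrite /upd !eqxx. Qed.

(** The bound [e] is evaluated again in every round, so it must keep its value along the invariant.
    The counter is itself a memory cell, which is why [I] is asked of the state in which it has been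
    set. *)
Lemma ok_for (R : realType) (u : nat -> R) (I : nat -> state R -> Prop)
    v e body N c (s : state R) Q :
  let p := for_loop v e body in
  (forall i s1, frame p s s1 -> (i < N)%N -> I i s1 -> ints s1 v 0%N = i ->
     ok u body s1 (fun t s2 =>
       [/\ (t <= c)%N, ints s2 v 0%N = i & I i.+1 (set_cell s2 v i.+1)])) ->
  (forall i s1, frame p s s1 -> (i <= N)%N -> I i s1 -> ieval s1 e = N) ->
  I 0%N (set_cell s v 0) ->
  (forall t s', frame p s s' -> (t <= N * (c + icost e + 15) + icost e + 15)%N ->
     I N s' -> ints s' v 0%N = N -> Q t s') ->
  ok u p s Q.
Proof.
move=> p Hbody He I0 HQ; apply: ok_seq; apply: ok_iset => /=.
rewrite -/(set_cell s v 0).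
pose Inv s1 := I (ints s1 v 0%N) s1 /\ (ints s1 v 0 <= N)%N.
have Fp s1 : frame (Seq body (iset v (IAdd (cell v) (INum 1)))) (set_cell s v 0) s1 ->
    frame p s s1.
  case=> a b c0; split=> [x|x hx|hx].
  - by rewrite /= inE negb_or => /andP[/negbTE nx hx]; rewrite a //= upd_other.
  - by rewrite b.
  - by apply: c0; apply: hx.
apply: (@ok_while _ _ Inv (fun s1 => (N - ints s1 v 0) * (c + icost e + 15))%N).
- move=> s1 /Fp F1 [I1 le1] /=; rewrite (He _ _ F1 le1 I1) addn1 => lt1.
  apply: ok_seq; apply: ok_weaken (Hbody _ _ F1 lt1 I1 erefl) _ => t s2 _ [le2 e2 I2].
  apply: ok_iset => /=; rewrite e2 addn1.
  rewrite /Inv /= !upd_same; split; first by split.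
  by rewrite -(subnSK lt1) mulSn /=; move: le2; clear; lia.
- by rewrite /Inv /= upd_same; split.
- move=> t s' /Fp F' [I1 le1]; rewrite /= (He _ _ F' le1 I1) addn1 -leqNgt => ge1.
  have e1 : ints s' v 0%N = N by apply/eqP; rewrite eqn_leq le1.
  rewrite e1 in I1 *; rewrite upd_same subnn subn0 => le2.
  by apply: HQ => //; move: le2; clear; rewrite /=; lia.
Qed.

Definition slice (T : Type) (f : nat -> T) b len := [seq f j | j <- iota b len].

Lemma size_slice (T : Type) (f : nat -> T) b len : size (slice f b len) = len.
Proof. by rewrite size_map size_iota. Qed.

Lemma slice_cat (T : Type) (f : nat -> T) b l1 l2 :
  slice f b (l1 + l2) = slice f b l1 ++ slice f (b + l1) l2.
Proof. by rewrite /slice iotaD map_cat. Qed.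

Lemma slice_cons (T : Type) (f : nat -> T) b l :
  slice f b l.+1 = f b :: slice f b.+1 l.
Proof. by []. Qed.

Lemma slice_rcons (T : Type) (f : nat -> T) b l :
  slice f b l.+1 = rcons (slice f b l) (f (b + l)%N).
Proof. by rewrite -addn1 slice_cat cats1. Qed.

Lemma eq_slice (T : Type) (f g : nat -> T) b l :
  (forall j, (b <= j < b + l)%N -> f j = g j) -> slice f b l = slice g b l.
Proof. by move=> fg; apply/eq_in_map => j; rewrite mem_iota => /fg. Qed.

Lemma nth_slice (T : Type) (x0 : T) (f : nat -> T) b l j :
  (j < l)%N -> nth x0 (slice f b l) j = f (b + j)%N.
Proof. by move=> jl; rewrite (nth_map 0%N) ?size_iota ?nth_iota. Qed.

Lemma slice_upd_out (T : Type) (f : nat -> nat -> T) a i v b l :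
  (i < b)%N || (b + l <= i)%N -> slice (upd f a i v a) b l = slice (f a) b l.
Proof.
move=> h; apply: eq_slice => j hj; rewrite /upd eqxx /=.
by case: eqP => // ej; move: h hj; rewrite ej; lia.
Qed.

(** * Merge sort *)

(* Arrays of the program are called a_*; v_* and r_* are integer and real
   variables, that is, cell 0 of an array of their own. *)
Notation a_V := 3%N (only parsing).
Notation a_W := 4%N (only parsing).
Notation v_m := 14%N (only parsing).
Notation v_h := 30%N (only parsing).
Notation v_i := 31%N (only parsing).
Notation v_j := 32%N (only parsing).
Notation v_p := 33%N (only parsing).
Notation v_mid := 34%N (only parsing).
Notation v_be := 35%N (only parsing).
Notation v_x := 36%N (only parsing).

Infix ";;" := Seq (at level 60, right associativity).

(* This is the minimum because subtraction is truncated at 0. *)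
Definition imin e1 e2 := ISub e1 (ISub e1 e2).
Definition incr v := iset v (IAdd (cell v) (INum 1)).

Definition merge_step : program :=
  Seq (If (BAnd (ilt (cell v_i) (cell v_mid))
            (BNot (BAnd (ilt (cell v_j) (cell v_be))
                        (BNot (RLe (RGet a_V (cell v_i)) (RGet a_V (cell v_j)))))))
         (Seq (RSet a_W (cell v_p) (RGet a_V (cell v_i))) (incr v_i))
         (Seq (RSet a_W (cell v_p) (RGet a_V (cell v_j))) (incr v_j)))
      (incr v_p).

Definition merge_loop : program := While (ilt (cell v_p) (cell v_be)) merge_step.

Lemma merge_nil (T : Type) (r : rel T) l : merge r l [::] = l.
Proof. by case: l. Qed.

Lemma merge_loopP (R : realType) (u : nat -> R) (s : state R) p0 mid be Q :
  ints s v_p 0%N = p0 -> ints s v_i 0%N = p0 -> ints s v_j 0%N = mid ->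
  ints s v_mid 0%N = mid -> ints s v_be 0%N = be -> (p0 <= mid <= be)%N ->
  (forall t s', frame merge_loop s s' -> (t <= 60 * (be - p0) + 60)%N ->
     ints s' v_p 0%N = be ->
     slice (reals s' a_W) p0 (be - p0) =
       merge <=%R (slice (reals s a_V) p0 (mid - p0)) (slice (reals s a_V) mid (be - mid)) ->
     slice (reals s' a_W) 0 p0 = slice (reals s a_W) 0 p0 -> Q t s') ->
  ok u merge_loop s Q.
Proof.
move=> ep ei ej emid ebe /andP[le1 le2] HQ.
set goal := merge _ _ _ in HQ.
(* What has been written followed by the merge of what remains is always the final result, so
   sortedness of the two runs is not involved. *)
pose Inv (s1 : state R) := let: p := ints s1 v_p 0%N in let: i := ints s1 v_i 0%N in
  let: j := ints s1 v_j 0%N in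
  [/\ (p0 <= i <= mid)%N, (mid <= j <= be)%N, (p + mid = i + j)%N,
    slice (reals s1 a_W) 0 p0 = slice (reals s a_W) 0 p0 &
    slice (reals s1 a_W) p0 (p - p0) ++
    merge <=%R (slice (reals s a_V) i (mid - i)) (slice (reals s a_V) j (be - j)) = goal].
apply: (@ok_while _ _ Inv (fun s1 => 60 * (be - ints s1 v_p 0))%N).
- move=> s1 [Fi Fr _] [/andP[h0 hi] /andP[hj1 hj2] hp hW hgoal] /=.
  have e1 : ints s1 v_be 0%N = be by rewrite Fi.
  have e2 : ints s1 v_mid 0%N = mid by rewrite Fi.
  have e3 : reals s1 a_V = reals s a_V by rewrite Fr.
  rewrite e1 addn1 => hlt.
  move: hi hj1 hj2 h0 hp hgoal hlt.
  set p := ints s1 v_p 0%N; set i := ints s1 v_i 0%N; set j := ints s1 v_j 0%N.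
  move=> hi hj1 hj2 h0 hp hgoal hlt.
  have hp0 : (p0 <= p)%N by lia.
  apply: ok_seq; apply: ok_if => /=; rewrite e1 e2 e3 -/i -/j -/p !addn1.
  + rewrite negb_and !negbK => /andP[iltm hc]; apply: ok_seq; apply: ok_rset; do 2 apply: ok_iset.
    rewrite /= /Inv /= !updE /= !addn1 -/p -/i -/j e3; split; last lia.
    split=> //; try lia.
      by rewrite slice_upd_out //; apply/orP; right.
    rewrite subSn // slice_rcons slice_upd_out; last by apply/orP; right; lia.
    rewrite /upd eqxx /= subnKC // eqxx -hgoal cat_rcons; congr cat.
    have -> : (mid - i = (mid - i.+1).+1)%N by lia.
    rewrite slice_cons.
    case: (posnP (be - j)) => [->|bj]; first by rewrite !merge_nil.
    have -> : (be - j = (be - j.+1).+1)%N by lia.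
    rewrite (slice_cons _ j) [RHS]/=.
    by move: hc; rewrite -leqNgt leqNgt -subn_gt0 bj /= => ->.
  + rewrite !negb_and !negb_or !negbK => hc; apply: ok_seq; apply: ok_rset; do 2 apply: ok_iset.
    have jlt : (j < be)%N.
      by case/orP: hc => [|/andP[]//]; lia.
    rewrite /= /Inv /= !updE /= !addn1 -/p -/i -/j e3; split; last lia.
    split=> //; try lia.
      by rewrite slice_upd_out //; apply/orP; right.
    rewrite subSn // slice_rcons slice_upd_out; last by apply/orP; right; lia.
    rewrite /upd eqxx /= subnKC // eqxx -hgoal cat_rcons; congr cat.
    have -> : (be - j = (be - j.+1).+1)%N by lia.
    rewrite slice_cons.
    case: (posnP (mid - i)) => [->//|bj].
    have -> : (mid - i = (mid - i.+1).+1)%N by lia.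
    rewrite (slice_cons _ i) [RHS]/=.
    move: hc; rewrite -leqNgt leqNgt -subn_gt0 bj /= jlt /=.
    by move=> /negbTE ->.
- by rewrite /Inv ep ei ej leqnn le1 leqnn le2 subnn; split.
- move=> t s' F' [/andP[h0 hi] /andP[hj1 hj2] hp hW hgoal] /=.
  have -> : ints s' v_be 0%N = be by have [Fi _ _] := F'; rewrite Fi.
  rewrite addn1 -leqNgt ep => hge hc.
  have ei' : ints s' v_i 0%N = mid by lia.
  have ej' : ints s' v_j 0%N = be by lia.
  have ep' : ints s' v_p 0%N = be by lia.
  apply: HQ => //; first by move: hc; rewrite /=; lia.
  by rewrite -hgoal ei' ej' ep' !subnn /= cats0.
Qed.

Fixpoint merge_pairs (T : Type) (r : rel T) (ls : seq (seq T)) :=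
  match ls with
  | a :: b :: ls' => merge r a b :: merge_pairs r ls'
  | _ => ls
  end.

(** All runs except possibly the last have the full length [h]; this lets the program locate them by
    arithmetic on positions alone. *)
Fixpoint chunks (T : Type) h (ls : seq (seq T)) : Prop :=
  match ls with
  | [::] => True
  | a :: ls' => [/\ (0 < size a <= h)%N, (0 < size ls' -> size a = h)%N & chunks h ls']
  end.

Lemma pair_ind (T : Type) (P : seq T -> Prop) :
  P [::] -> (forall a, P [:: a]) -> (forall a b l, P l -> P [:: a, b & l]) ->
  forall l, P l.
Proof.
move=> P0 P1 P2 l; suff [] : P l /\ (forall a, P (a :: l)) by [].
by elim: l => [|b l [IH1 IH2]]; split=> // a; apply: P2.
Qed.

Lemma chunks_merge_pairs (T : Type) (r : rel T) h (ls : seq (seq T)) :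
  chunks h ls -> chunks (h + h) (merge_pairs r ls).
Proof.
elim/pair_ind: ls => [|a|a b ls IH] //= [].
  by move=> /andP[a0 ah] _ _; split=> //; rewrite a0; lia.
move=> ha /(_ isT) ea [hb eb /IH c]; rewrite size_merge size_cat ea; split=> //; first lia.
move=> hs; rewrite eb //; by case: (ls) hs => // - [].
Qed.

Lemma sorted_merge_pairs (T : eqType) (r : rel T) (ls : seq (seq T)) :
  total r -> all (sorted r) ls -> all (sorted r) (merge_pairs r ls).
Proof.
move=> tr; elim/pair_ind: ls => [|a|a b ls IH] //= /and3P[sa sb /IH ->].
by rewrite merge_sorted.
Qed.

Lemma perm_merge_pairs (T : eqType) (r : rel T) (ls : seq (seq T)) :
  perm_eq (flatten (merge_pairs r ls)) (flatten ls).
Proof.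
elim/pair_ind: ls => [|a|a b ls IH] //=.
by rewrite catA perm_cat // perm_merge.
Qed.

Definition merge_pass : program :=
  iset v_p (INum 0) ;;
  While (ilt (cell v_p) (cell v_m))
    (iset v_mid (imin (IAdd (cell v_p) (cell v_h)) (cell v_m)) ;;
     iset v_be (imin (IAdd (cell v_mid) (cell v_h)) (cell v_m)) ;;
     iset v_i (cell v_p) ;;
     iset v_j (cell v_mid) ;;
     merge_loop).

Lemma merge_passP (R : realType) (u : nat -> R) (s : state R) m h ls Q :
  ints s v_m 0%N = m -> ints s v_h 0%N = h ->
  slice (reals s a_V) 0 m = flatten ls -> chunks h ls ->
  (forall t s', frame merge_pass s s' -> (t <= 200 * m + 200)%N ->
     slice (reals s' a_W) 0 m = flatten (merge_pairs <=%R ls) -> Q t s') ->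
  ok u merge_pass s Q.
Proof.
move=> em eh eV ch HQ; apply: ok_seq; apply: ok_iset => /=.
set goal := flatten _ in HQ.
set s0 := State _ _ _.
pose Inv (s1 : state R) := let: p := ints s1 v_p 0%N in (p <= m)%N /\
  exists ls1, [/\ slice (reals s a_V) p (m - p) = flatten ls1, chunks h ls1 &
    slice (reals s1 a_W) 0 p ++ flatten (merge_pairs <=%R ls1) = goal].
apply: (@ok_while _ _ Inv (fun s1 => 200 * (m - ints s1 v_p 0))%N).
- move=> s1 [Fi Fr _] [hp [ls1 [h1 c1 hg]]] /=.
  have e1 : ints s1 v_m 0%N = m by rewrite Fi //= /upd /= em.
  have e2 : ints s1 v_h 0%N = h by rewrite Fi //= /upd /= eh.
  have e3 : reals s1 a_V = reals s a_V by rewrite Fr.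
  rewrite e1 addn1 => hlt.
  move: hp h1 hg hlt; set p := ints s1 v_p 0%N => hp h1 hg hlt.
  do 4 (apply: ok_seq; apply: ok_iset).
  pose mid := (p + h - (p + h - m))%N.
  pose be := (mid + h - (mid + h - m))%N.
  apply: (@merge_loopP _ _ _ p mid be);
    rewrite /= /mid /be ?updE /= ?updE /= ?updE /= ?updE /= ?e1 ?e2 -/p //; first lia.
  rewrite -/mid -/be => t s2 [Fi2 Fr2 _] ht ep eW eW0.
  have hmid : (p <= mid <= m)%N by rewrite /mid; lia.
  have hbe : (mid <= be <= m)%N by rewrite /be; lia.
  have hpbe : (p < be)%N.
    case: ls1 h1 c1 hg => [|a ls1] /= h1 c1 hg.
      by move/(congr1 size): h1; rewrite size_slice /=; lia.
    by case: c1; rewrite /be /mid; lia.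
  split; last by rewrite ep; move: ht; rewrite /=; lia.
  split; rewrite ep; first by lia.
  rewrite /= e3 in eW eW0.
  have eWbe : slice (reals s2 4) 0 be = slice (reals s1 4) 0 p ++
      merge <=%R (slice (reals s 3) p (mid - p)) (slice (reals s 3) mid (be - mid)).
    by rewrite -eW -eW0 -[in LHS](subnKC (ltnW hpbe)) slice_cat.
  rewrite eWbe.
  have hS b c : (b <= c <= m)%N ->
      slice (reals s 3) b (m - b) = slice (reals s 3) b (c - b) ++ slice (reals s 3) c (m - c).
    move=> /andP[bc cm]; have -> : (m - b = (c - b) + (m - c))%N by lia.
    by rewrite slice_cat subnKC.
  case: ls1 h1 c1 hg => [|a [|b ls1]] /= h1 c1 hg.
  + by move/(congr1 size): h1; rewrite size_slice /=; lia.
  + case: c1 => ha _ _; have := congr1 size h1; rewrite size_slice cats0 => sa.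
    have em' : mid = m by rewrite /mid; lia.
    have eb' : be = m by rewrite /be; lia.
    exists [::]; rewrite /= eb' em' subnn /=; split=> //.
    by rewrite h1 !merge_nil cats0.
  + case: c1 => ha /(_ isT) ea [hb eb c1].
    have := congr1 size h1; rewrite size_slice !size_cat => sa.
    have em' : mid = (p + h)%N by rewrite /mid; lia.
    have eb' : be = (mid + size b)%N.
      rewrite /be; case: (posnP (size ls1)) => [l0|/eb]; last by lia.
      by move: sa; rewrite (size0nil l0) /=; lia.
    move: h1; rewrite (hS _ mid) // (hS _ be) // => /eqP.
    rewrite eqseq_cat ?size_slice; last by rewrite ea; lia.
    move=> /andP[/eqP e4]; rewrite eqseq_cat; last by rewrite size_slice eb' addKn.
    move=> /andP[/eqP e5 /eqP e6].
    by exists ls1; split=> //; rewrite e4 e5 -catA.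
- split=> //; exists ls; split=> //; by rewrite subn0.
- move=> t s' F' [hp [ls1 [h1 c1 hg]]] /=.
  have F2 := F'; case: F2 => Fi _ _; rewrite (Fi v_m) // /s0 /= !updE /= em addn1 -leqNgt => hge hc.
  have ep : ints s' v_p 0%N = m by lia.
  apply: HQ => //.
  + split=> [a ha|a ha|hd]; [|by have [_ -> ] := F'|by have [_ _ ->] := F'].
    rewrite Fi; last by move: ha; rewrite /= inE negb_or => /andP[].
    by rewrite /= upd_other //; move: ha; rewrite /= inE negb_or => /andP[/negbTE].
  + by move: hc; rewrite /=; lia.
  + rewrite -hg ep; case: ls1 h1 c1 {hg} => [|a ls1] /= h1 c1; first by rewrite cats0.
    by move/(congr1 size): h1; case: c1; rewrite size_slice size_cat ep; lia.
Qed.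

Lemma chunks_singletons (T : Type) (l : seq T) : chunks 1 [seq [:: z] | z <- l].
Proof. by elim: l => //= a l IH; split. Qed.

Lemma slice_take (T : Type) (f : nat -> T) b k l :
  (k <= l)%N -> take k (slice f b l) = slice f b k.
Proof.
by move=> kl; rewrite -(subnKC kl) slice_cat take_size_cat // size_slice.
Qed.

Definition sort_pass : program :=
  merge_pass ;;
  for_loop v_x (cell v_m) (RSet a_V (cell v_x) (RGet a_W (cell v_x))) ;;
  iset v_h (IAdd (cell v_h) (cell v_h)).

Definition sort_prog : program :=
  iset v_h (INum 1) ;; While (ilt (cell v_h) (cell v_m)) sort_pass.

Lemma sort_progP (R : realType) (u : nat -> R) (s : state R) m lg Q :
  ints s v_m 0%N = m -> (m <= 2 ^ lg)%N ->
  (forall t s', frame sort_prog s s' -> (t <= lg * (300 * m + 300) + 300)%N ->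
     slice (reals s' a_V) 0 m = sort <=%R (slice (reals s a_V) 0 m) -> Q t s') ->
  ok u sort_prog s Q.
Proof.
move=> em mlg HQ; apply: ok_seq; apply: ok_iset => /=.
set s0 := State _ _ _.
set l0 := slice _ _ _ in HQ.
pose Inv (s1 : state R) := exists2 i, ints s1 v_h 0%N = (2 ^ i)%N &
  exists ls, [/\ slice (reals s1 a_V) 0 m = flatten ls, chunks (2 ^ i) ls,
    all (sorted <=%R) ls & perm_eq (flatten ls) l0].
(* After i passes the cell [v_h] holds 2 ^ i, so [trunc_log] recovers the number of passes from the
   state. *)
apply: (@ok_while _ _ Inv
  (fun s1 => (lg - trunc_log 2 (ints s1 v_h 0)) * (300 * m + 300))%N).
- move=> s1 [Fi Fr _] [i eh [ls [h1 c1 s1' p1]]] /=.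
  have e1 : ints s1 v_m 0%N = m by rewrite Fi //= /upd /= em.
  rewrite e1 eh trunc_expnK // addn1 => hlt.
  have ilg : (i < lg)%N by rewrite -(@ltn_exp2l 2) //; apply: leq_trans mlg.
  apply: ok_seq; apply: (@merge_passP _ _ _ m (2 ^ i)%N ls) => // t s2 F2 ht hW.
  apply: ok_seq.
  have [Fi2 Fr2 _] := F2.
  apply: (@ok_for _ _ (fun x s3 => slice (reals s3 a_V) 0 x = slice (reals s2 a_W) 0 x)
    v_x (cell v_m) _ m 10).
  + move=> x s3 [Fi3 Fr3 _] xm ex ev; apply: ok_rset => /=; split=> //.
    rewrite !slice_rcons ev slice_upd_out; last by apply/orP; right.
    by rewrite ex /upd /= eqxx Fr3.
  + by move=> x s3 [Fi3 _ _] _ _; rewrite /= Fi3 // Fi2.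
  + by [].
  + move=> t3 s3 [Fi3 Fr3 _] ht3 eV _; apply: ok_iset => /=.
    have eh3 : ints s3 v_h 0%N = (2 ^ i)%N by rewrite Fi3 // Fi2.
    rewrite /Inv /= /upd /= eh3 addnn -mul2n -expnS trunc_expnK //; split.
      exists i.+1 => //; exists (merge_pairs <=%R ls); split.
      * by rewrite eV hW.
      * by rewrite expnS mul2n -addnn; apply: chunks_merge_pairs.
      * by apply: sorted_merge_pairs => //; apply: le_total.
      * by apply: perm_trans p1; apply: perm_merge_pairs.
    by rewrite -(subnSK ilg) mulSn; move: ht ht3; rewrite /=; clear; lia.
- exists 0%N => //; exists [seq [:: z] | z <- l0].
  have fl : flatten [seq [:: z] | z <- l0] = l0 by elim: (l0) => //= a l ->.
  by split; rewrite ?fl //; [exact: chunks_singletons | elim: (l0)].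
- move=> t s' F' [i eh [ls [h1 c1 s1' p1]]] /=.
  have [Fi _ _] := F'; rewrite (Fi v_m) // /s0 /= !updE /= em eh addn1 -leqNgt => hge ht.
  apply: HQ.
  + split=> [a ha|a ha|hd]; [|by have [_ -> ] := F'|by have [_ _ ->] := F'].
    rewrite Fi; last by move: ha; rewrite /= inE negb_or => /andP[].
    by rewrite /= upd_other //; move: ha; rewrite /= inE negb_or => /andP[/negbTE].
  + by move: ht; rewrite (_ : trunc_log 2 1 = 0%N) // subn0; lia.
  + have ss : sorted <=%R (flatten ls).
      case: ls h1 c1 s1' {p1} => [|a [|b ls]] //= h1 c1.
        by rewrite cats0 andbT.
      case: c1 => ha /(_ isT) ea [hb _ _].
      by move/(congr1 size): h1; rewrite size_slice !size_cat; lia.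
    rewrite h1 -(sorted_sort le_trans ss).
    by apply/perm_sortP => //; [exact: le_total|exact: le_trans|exact: le_anti].
Qed.

(** * The decomposition procedure *)

Section Model.
Variables (R : realType) (n D J : nat) (val : 'I_n -> nat -> R) (Delta : R).

Definition window : R := Delta / (J + J + J + J)%:R.
Definition quarter : R := Delta / 4%:R.

Implicit Type p : seq 'I_n.

Definition coords p k : seq R := [seq val i k | i <- p].
(** The lower median: at most half of the points lie strictly above it, and more than half are at or
    above it. Both facts are needed, the second one strictly. *)
Definition median p k : R := nth 0 (sort <=%R (coords p k)) (size p).-1./2.
Definition above p k (z : R) : nat := count (fun y => z < y) (coords p k).
Definition threshold p k j : R := median p k + window *+ j.
Definition f_above p k j := above p k (threshold p k j).
(** Over the reals and without division because the program tests it in this form, having no product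
    of integers; [goodE] is the version over nat. The first condition bounds the number of splits,
    the second the exponent of the ramp. *)
Definition good p k j : bool :=
  ((size p)%:R <= (D + D)%:R * (f_above p k j.+1)%:R :> R) &&
  ((f_above p k j)%:R * (f_above p k j)%:R <= (size p)%:R * (f_above p k j.+1)%:R :> R).

(** Recursion from the last index down makes the last good window win, as in a program loop that
    overwrites its find and never exits early. *)
Fixpoint scan_windows p k j (o : option (nat * nat)) :=
  if j is j'.+1 then
    if good p k j' then Some (k, j') else scan_windows p k j' o
  else o.

Fixpoint scan_directions p k :=
  if k is k'.+1 then scan_windows p k' J (scan_directions p k') else None.

Definition scan p := scan_directions p D.

(* Half of the exponent of the ramp.  The program finds it by doubling f until it
   reaches m, having no logarithm. *)
Definition log_ratio (m f : nat) : nat := find (fun i => (m <= 2 ^ i * f)%N) (iota 0 m).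

Definition ramp p k j i : R :=
  Num.min 1 ((val i k - threshold p k j) / window).

(** One [u] serves all points, so this is a cut at one random threshold, whose tail is an even power
    of the ramp. The sign test is essential: [ramp] is not clipped from below, and an even power
    forgets the sign. *)
Definition in_light p k j (u : R) i : bool :=
  (0 < val i k - threshold p k j) &&
  (u <= (ramp p k j i * ramp p k j i) ^+ log_ratio (size p) (f_above p k j.+1)).

Definition in_box p (u : R) i : bool :=
  all (fun k => val i k - median p k <= quarter * (1 + u)) (iota 0 D).

Definition selected p (u : R) i : bool :=
  if scan p is Some (k, j) then in_light p k j u i else in_box p u i.

(* Labels of points that still occur in a pending segment are junk. *)
Record config := Config { pending : seq (seq 'I_n); label : nat -> nat }.

(* The start of the first pending segment in the array of points; it serves as the
   label of the next cluster. *)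
Definition low (c : config) : nat := (n - size (flatten (pending c)))%N.

(** Pending segments have to be nonempty, hence the test on [B] when a box has taken all points.
    After a cut both sides are nonempty anyway. *)
Definition next_config (c : config) (S : pred 'I_n) : config :=
  if pending c is p :: ps then
    let A := [seq i <- p | S i] in let B := [seq i <- p | ~~ S i] in
    if scan p is Some _ then Config (A :: B :: ps) (label c)
    else Config (if B is [::] then ps else B :: ps)
           (fun i => if i \in [seq nat_of_ord a | a <- A] then low c else label c i)
  else c.

End Model.

(** * The program of the decomposition *)

Notation a_perm := 2%N (only parsing).
Notation a_end := 3%N (only parsing).
Notation a_off := 4%N (only parsing).
Notation a_A := 5%N (only parsing).
Notation a_B := 6%N (only parsing).
Notation v_D := 10%N (only parsing).
Notation v_J := 11%N (only parsing).
Notation v_lo := 12%N (only parsing).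
Notation v_hi := 13%N (only parsing).
Notation v_k := 15%N (only parsing).
Notation v_w := 16%N (only parsing).
Notation v_found := 17%N (only parsing).
Notation v_bk := 18%N (only parsing).
Notation v_bf := 19%N (only parsing).
Notation v_fcur := 20%N (only parsing).
Notation v_cnt := 21%N (only parsing).
Notation v_nA := 22%N (only parsing).
Notation v_nB := 23%N (only parsing).
Notation v_q := 24%N (only parsing).
Notation v_flag := 25%N (only parsing).
Notation v_c := 26%N (only parsing).
Notation v_pt := 27%N (only parsing).
Notation v_y := 28%N (only parsing).
Notation a_X := 2%N (only parsing).
Notation a_med := 5%N (only parsing).
Notation r_w := 10%N (only parsing).
Notation r_th := 11%N (only parsing).
Notation r_th2 := 12%N (only parsing).
Notation r_blo := 13%N (only parsing).
Notation r_u := 14%N (only parsing).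
Notation r_t := 15%N (only parsing).
Notation r_pw := 16%N (only parsing).
Notation r_N := 17%N (only parsing).
Notation r_q4 := 18%N (only parsing).

Definition load_prog : program :=
  for_loop v_x (cell v_m)
    (RSet a_V (cell v_x)
       (RGet a_X (IAdd (IGet a_off (IGet a_perm (IAdd (cell v_lo) (cell v_x)))) (cell v_k)))).

(** Integers cannot be divided, so the index (m - 1) / 2 of the median is found by counting; linear
    time is dominated by the sort. *)
Definition mid_prog : program :=
  iset v_c (INum 0) ;;
  While (ILe (IAdd (IAdd (cell v_c) (cell v_c)) (INum 3)) (cell v_m)) (incr v_c).

Definition count_prog : program :=
  iset v_cnt (INum 0) ;;
  for_loop v_x (cell v_m)
    (If (rlt (rcell r_th2) (RGet a_V (cell v_x))) (incr v_cnt) Skip).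

Definition window_step : program :=
  rset r_th2 (RAdd (rcell r_th) (rcell r_w)) ;;
  count_prog ;;
  If (BAnd (RLe (RInt (cell v_m)) (RMul (rcell r_N) (RInt (cell v_cnt))))
           (RLe (RMul (RInt (cell v_fcur)) (RInt (cell v_fcur)))
                (RMul (RInt (cell v_m)) (RInt (cell v_cnt)))))
     (iset v_found (INum 1) ;;
      iset v_bk (cell v_k) ;;
      rset r_blo (rcell r_th) ;;
      iset v_bf (cell v_cnt))
     Skip ;;
  rset r_th (rcell r_th2) ;;
  iset v_fcur (cell v_cnt).

Definition direction_step : program :=
  load_prog ;;
  sort_prog ;;
  mid_prog ;;
  RSet a_med (cell v_k) (RGet a_V (cell v_c)) ;;
  rset r_th2 (RGet a_V (cell v_c)) ;;
  rset r_th (rcell r_th2) ;;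
  count_prog ;;
  iset v_fcur (cell v_cnt) ;;
  for_loop v_w (cell v_J) window_step.

Definition scan_prog : program :=
  iset v_found (INum 0) ;; for_loop v_k (cell v_D) direction_step.

Definition light_test : program :=
  rset r_t (RSub (RGet a_X (IAdd (cell v_q) (cell v_bk))) (rcell r_blo)) ;;
  If (rlt (RInt (INum 0)) (rcell r_t))
    (rset r_t (RDiv (rcell r_t) (rcell r_w)) ;;
     If (RLe (RInt (INum 1)) (rcell r_t)) (rset r_t (RInt (INum 1))) Skip ;;
     rset r_pw (RInt (INum 1)) ;;
     iset v_c (cell v_bf) ;;
     While (ilt (cell v_c) (cell v_m))
       (iset v_c (IAdd (cell v_c) (cell v_c)) ;;
        rset r_pw (RMul (rcell r_pw) (RMul (rcell r_t) (rcell r_t)))) ;;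
     If (RLe (rcell r_u) (rcell r_pw)) (iset v_flag (INum 1)) Skip)
    Skip.

Definition box_test : program :=
  iset v_flag (INum 1) ;;
  for_loop v_k (cell v_D)
    (If (RLe (RSub (RGet a_X (IAdd (cell v_q) (cell v_k))) (RGet a_med (cell v_k)))
             (RMul (rcell r_q4) (RAdd (RInt (INum 1)) (rcell r_u))))
        Skip (iset v_flag (INum 0))).

Definition select_step : program :=
  iset v_pt (IGet a_perm (IAdd (cell v_lo) (cell v_y))) ;;
  iset v_q (IGet a_off (cell v_pt)) ;;
  iset v_flag (INum 0) ;;
  If (ILe (INum 1) (cell v_found)) light_test box_test ;;
  If (ILe (INum 1) (cell v_flag))
    (ISet a_A (cell v_nA) (cell v_pt) ;; incr v_nA)
    (ISet a_B (cell v_nB) (cell v_pt) ;; incr v_nB).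

Definition select_prog : program :=
  iset v_nA (INum 0) ;;
  iset v_nB (INum 0) ;;
  for_loop v_y (cell v_m) select_step.

Definition split_prog : program :=
  for_loop v_x (cell v_nA)
    (ISet a_perm (IAdd (cell v_lo) (cell v_x)) (IGet a_A (cell v_x))) ;;
  for_loop v_x (cell v_nB)
    (ISet a_perm (IAdd (IAdd (cell v_lo) (cell v_nA)) (cell v_x)) (IGet a_B (cell v_x))) ;;
  iset v_c (IAdd (cell v_lo) (cell v_nA)) ;;
  If (ILe (INum 1) (cell v_found))
    (ISet a_end (cell v_lo) (cell v_c) ;;
     ISet a_end (cell v_c) (cell v_hi))
    (for_loop v_x (cell v_nA) (ISet 1 (IGet a_A (cell v_x)) (cell v_lo)) ;;
     If (ilt (cell v_c) (cell v_hi)) (ISet a_end (cell v_c) (cell v_hi)) Skip ;;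
     iset v_lo (cell v_c)).

(** One number is drawn per split whichever kind of split it is, so the position on the tape counts
    the splits. *)
Definition main_step : program :=
  iset v_hi (IGet a_end (cell v_lo)) ;;
  iset v_m (ISub (cell v_hi) (cell v_lo)) ;;
  scan_prog ;;
  RUnif r_u (INum 0) ;;
  select_prog ;;
  split_prog.

Definition main_loop : program := While (ilt (cell v_lo) (cell 0)) main_step.

(* The array a_off holds the address of the 2 d directions of each point, because
   the machine cannot multiply integers.  Pending segments lie consecutively in
   a_perm from v_lo on, and a_end maps the start of each of them to its end. *)
Definition init_prog : program :=
  iset v_D (IAdd (IGet 0 (INum 1)) (IGet 0 (INum 1))) ;;
  iset v_p (INum 0) ;;
  iset v_q (INum 0) ;;
  for_loop v_i (cell 0)
    (ISet a_off (cell v_i) (cell v_q) ;;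
     ISet a_perm (cell v_i) (cell v_i) ;;
     for_loop v_k (IGet 0 (INum 1))
       (RSet a_X (cell v_q) (RGet 0 (cell v_p)) ;;
        RSet a_X (IAdd (cell v_q) (INum 1)) (RSub (RInt (INum 0)) (RGet 0 (cell v_p))) ;;
        incr v_p ;;
        iset v_q (IAdd (cell v_q) (INum 2)))) ;;
  ISet a_end (INum 0) (cell 0) ;;
  rset r_N (RInt (IAdd (cell v_D) (cell v_D))) ;;
  rset r_t (RInt (INum 2)) ;;
  While (rlt (rcell r_t) (rcell r_N))
    (rset r_t (RMul (rcell r_t) (rcell r_t)) ;; incr v_J) ;;
  rset r_w (RDiv (rcell 1) (RInt (IAdd (IAdd (IAdd (cell v_J) (cell v_J)) (cell v_J)) (cell v_J)))) ;;
  rset r_q4 (RDiv (rcell 1) (RInt (INum 4))).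

Definition decomposition_prog : program := init_prog ;; main_loop.

(** * Specifications of the subprograms *)

Section ProgramSpec.
Variables (R : realType) (u : nat -> R) (n D J lg : nat) (val : 'I_n -> nat -> R) (Delta : R).

Definition env (s : state R) :=
  [/\ [/\ ints s 0 0%N = n, ints s v_D 0%N = D & ints s v_J 0%N = J],
     (forall i : 'I_n, ints s a_off i = D * i)%N,
     (forall (i : 'I_n) k, (k < D)%N -> reals s a_X (D * i + k)%N = val i k) &
     [/\ reals s r_w 0%N = window J Delta, reals s r_q4 0%N = quarter Delta &
        reals s r_N 0%N = (D + D)%:R]].

Lemma env_frame p s s' : frame p s s' ->
  all (fun a => a \notin int_writes p) [:: 0; v_D; v_J; a_off]%N ->
  all (fun a => a \notin real_writes p) [:: a_X; r_w; r_q4; r_N]%N ->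
  env s -> env s'.
Proof.
move=> [Fi Fr _] /and5P[h1 h2 h3 h4 _] /and5P[g1 g2 g3 g4 _].
by rewrite /env !Fi ?Fr.
Qed.

Lemma mid_progP s m Q : (0 < m)%N -> ints s v_m 0%N = m ->
  (forall t s', frame mid_prog s s' -> (t <= 20 * m + 20)%N ->
     ints s' v_c 0%N = m.-1./2 -> Q t s') -> ok u mid_prog s Q.
Proof.
move=> m0 em HQ; apply: ok_seq; apply: ok_iset => /=; set s0 := State _ _ _.
pose Inv (s1 : state R) := (ints s1 v_c 0 + ints s1 v_c 0 < m)%N.
apply: (@ok_while _ _ Inv (fun s1 => 20 * (m - ints s1 v_c 0))%N) => //.
- move=> s1 [Fi _ _] I1; rewrite /= (Fi v_m) // /s0 /= !updE /= em => hle.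
  by apply: ok_iset; rewrite /Inv /= !updE /=; split; lia.
- move=> t s' F' I1; have [Fi _ _] := F'.
  rewrite /= (Fi v_m) // /s0 /= !updE /= em -ltnNge => hle ht.
  apply: HQ; [|lia|by move: I1; rewrite /Inv; lia].
  split=> [a ha|a ha|hd]; [|by have [_ -> ] := F'|by have [_ _ ->] := F'].
  rewrite Fi; last by move: ha; rewrite /= inE negb_or => /andP[].
  by rewrite /= upd_other //; move: ha; rewrite /= inE negb_or => /andP[/negbTE].
Qed.

Lemma count_progP s m l Q : ints s v_m 0%N = m -> slice (reals s a_V) 0 m = l ->
  (forall t s', frame count_prog s s' -> (t <= 60 * m + 60)%N ->
     ints s' v_cnt 0%N = count (fun z => reals s r_th2 0%N < z) l -> Q t s') ->
  ok u count_prog s Q.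
Proof.
move=> em eV HQ; have : ok u count_prog s (fun t s' => (t <= 60 * m + 60)%N /\
     ints s' v_cnt 0%N = count (fun z => reals s r_th2 0%N < z) l); last first.
  by move=> h; apply: ok_weaken h _ => t s' F [h1 h2]; apply: HQ.
apply: ok_seq; apply: ok_iset => /=; set s0 := State _ _ _.
apply: (@ok_for _ _ (fun x s1 => ints s1 v_cnt 0%N =
   count (fun z => reals s r_th2 0%N < z) (slice (reals s a_V) 0 x)) _ _ _ m 22).
- move=> x s1 [Fi Fr _] xm ex ev.
  have er : reals s1 = reals s by apply: funext => a; rewrite Fr.
  rewrite slice_rcons -cats1 count_cat -ex add0n /= addn0.
  apply: ok_if => /=; rewrite er ev -ltNge => h.
    by apply: ok_iset; rewrite /= !updE /= h; split.
  by apply: ok_skip; rewrite (negbTE h) addn0; split.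
- by move=> x s1 [Fi _ _] _ _; rewrite /= Fi.
- by [].
- move=> t s' [Fi Fr _] ht ex _; rewrite ex eV; split=> //.
  by move: ht => /=; lia.
Qed.


Definition loaded (s : state R) (p : seq 'I_n) :=
  slice (ints s a_perm) (ints s v_lo 0) (size p) = [seq nat_of_ord i | i <- p] /\
  ints s v_m 0%N = size p.

Lemma loaded_frame q s s' p : frame q s s' ->
  all (fun a => a \notin int_writes q) [:: a_perm; v_lo; v_m]%N ->
  loaded s p -> loaded s' p.
Proof.
by move=> [Fi _ _] /and4P[h1 h2 h3 _]; rewrite /loaded !Fi.
Qed.

Lemma loaded_nth s p (i0 : 'I_n) x : loaded s p -> (x < size p)%N ->
  ints s a_perm (ints s v_lo 0 + x)%N = nth i0 p x.
Proof.
move=> [h _] xp; have := congr1 (fun l => nth 0%N l x) h.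
by rewrite nth_slice // (nth_map i0).
Qed.

Lemma load_progP s p k Q : env s -> loaded s p -> ints s v_k 0%N = k -> (k < D)%N ->
  (forall t s', frame load_prog s s' -> (t <= 60 * size p + 60)%N ->
     slice (reals s' a_V) 0 (size p) = coords val p k -> Q t s') ->
  ok u load_prog s Q.
Proof.
move=> es ls ek kD HQ; have : ok u load_prog s (fun t s' => (t <= 60 * size p + 60)%N /\
     slice (reals s' a_V) 0 (size p) = coords val p k); last first.
  by move=> h; apply: ok_weaken h _ => t s' F [h1 h2]; apply: HQ.
apply: (@ok_for _ _ (fun x s1 => slice (reals s1 a_V) 0 x = coords val (take x p) k)
   _ _ _ (size p) 20).
- move=> x s1 F xm ex ev; apply: ok_rset => /=; split=> //.
  have i0 : 'I_n by case: (p) xm.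
  rewrite (take_nth i0) // /coords map_rcons -/(coords _ _ _) -ex slice_rcons ev.
  rewrite slice_upd_out; last by apply/orP; right.
  congr rcons; rewrite updE !eqxx /=.
  have [Fi Fr _] := F; rewrite (Fi v_k) // ek.
  have [_ h1 h2 _] := env_frame F isT isT es.
  rewrite (loaded_nth i0 (loaded_frame F isT ls)) //.
  by rewrite h1 h2 //.
- by move=> x s1 [Fi _ _] _ _; rewrite /= Fi //; case: ls.
- by rewrite take0.
- move=> t s' F ht -> _; rewrite take_size; split=> //.
  by move: ht => /=; lia.
Qed.

Definition scanned (s : state R) p o :=
  match o with
  | Some (k, j) => [/\ ints s v_found 0%N = 1%N, ints s v_bk 0%N = k,
      reals s r_blo 0%N = threshold J val Delta p k j &
      ints s v_bf 0%N = f_above J val Delta p k j.+1]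
  | None => ints s v_found 0%N = 0%N
  end.

Lemma scanned_frame q s s' p o : frame q s s' ->
  all (fun a => a \notin int_writes q) [:: v_found; v_bk; v_bf]%N ->
  r_blo \notin real_writes q ->
  scanned s p o -> scanned s' p o.
Proof.
by move=> [Fi Fr _] /and4P[h1 h2 h3 _] h4; rewrite /scanned !Fi ?Fr.
Qed.

(** The coordinates have been sorted by now, but [f_above] only counts them, so the array matters up
    to permutation. *)
Lemma window_stepP s p k j o Q : env s -> ints s v_m 0%N = size p ->
  ints s v_k 0%N = k ->
  perm_eq (slice (reals s a_V) 0 (size p)) (coords val p k) ->
  reals s r_th 0%N = threshold J val Delta p k j ->
  ints s v_fcur 0%N = f_above J val Delta p k j ->
  scanned s p o ->
  (forall t s', frame window_step s s' -> (t <= 60 * size p + 200)%N ->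
     reals s' r_th 0%N = threshold J val Delta p k j.+1 ->
     ints s' v_fcur 0%N = f_above J val Delta p k j.+1 ->
     scanned s' p (if good D J val Delta p k j then Some (k, j) else o) -> Q t s') ->
  ok u window_step s Q.
Proof.
move=> es em ek pV eth ef sc HQ; have : ok u window_step s (fun t s' =>
    [/\ (t <= 60 * size p + 200)%N,
     reals s' r_th 0%N = threshold J val Delta p k j.+1,
     ints s' v_fcur 0%N = f_above J val Delta p k j.+1 &
     scanned s' p (if good D J val Delta p k j then Some (k, j) else o)]); last first.
  by move=> h; apply: ok_weaken h _ => t s' F [h1 h2 h3 h4]; apply: HQ.
have [_ _ _ [ew _ eN]] := es.
apply: ok_seq; apply: ok_rset; apply: ok_seq.
apply: (count_progP (m := size p) (l := slice (reals s a_V) 0 (size p))) => //.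
move=> t s1 F1 ht ec.
have eth2 : reals s1 r_th2 0%N = threshold J val Delta p k j.+1.
  by have [_ Fr _] := F1; rewrite Fr // /= updE /= eth ew /threshold mulrSr addrA.
have {}ec : ints s1 v_cnt 0%N = f_above J val Delta p k j.+1.
  rewrite ec /f_above /above; have [_ Fr _] := F1.
  by rewrite -Fr // eth2; apply/permP.
have Em : ints s1 v_m 0%N = size p by have [Fi _ _] := F1; rewrite Fi.
have Ek : ints s1 v_k 0%N = k by have [Fi _ _] := F1; rewrite Fi.
have Ef : ints s1 v_fcur 0%N = f_above J val Delta p k j by have [Fi _ _] := F1; rewrite Fi.
have Eth : reals s1 r_th 0%N = threshold J val Delta p k j by have [_ Fr _] := F1; rewrite Fr.
have EN : reals s1 r_N 0%N = (D + D)%:R by have [_ Fr _] := F1; rewrite Fr.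
have {}sc : scanned s1 p o.
  have : scanned s1 p o; last by [].
  have [Fi Fr _] := F1; rewrite /scanned !Fi ?Fr //=; exact: sc.
apply: ok_seq; apply: ok_if => /=; rewrite Em EN ec Ef -/(good D J val Delta p k j) => hg.
  do 3 (apply: ok_seq; (apply: ok_iset || apply: ok_rset)); apply: ok_iset.
  apply: ok_seq; apply: ok_rset; apply: ok_iset.
  by rewrite hg /= !updE /=; split=> //; lia.
apply: ok_skip; apply: ok_seq; apply: ok_rset; apply: ok_iset.
rewrite (negbTE hg) /= !updE /=; split=> //; lia.
Qed.

Definition medians (s : state R) p k :=
  forall k', (k' < k)%N -> reals s a_med k' = median val p k'.

Lemma direction_stepP s p k o Q : env s -> loaded s p -> (0 < size p <= 2 ^ lg)%N ->
  ints s v_k 0%N = k -> (k < D)%N -> medians s p k -> scanned s p o ->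
  (forall t s', frame direction_step s s' -> (t <= 1200 * (size p * (lg + J + 1)))%N ->
     medians s' p k.+1 ->
     scanned s' p (scan_windows D J val Delta p k J o) -> Q t s') ->
  ok u direction_step s Q.
Proof.
move=> es ls /andP[p0 plg] ek kD ms sc HQ; have : ok u direction_step s (fun t s' =>
    [/\ (t <= 1200 * (size p * (lg + J + 1)))%N, medians s' p k.+1 &
     scanned s' p (scan_windows D J val Delta p k J o)]); last first.
  by move=> h; apply: ok_weaken h _ => t s' F [h1 h2 h3]; apply: HQ.
apply: ok_seq; apply: (load_progP es ls ek kD) => t1 s1 F1 ht1 eV1.
have {}es := env_frame F1 isT isT es; have {}ls := loaded_frame F1 isT ls.
have {}sc := scanned_frame F1 isT isT sc.
have {}ek : ints s1 v_k 0%N = k by have [Fi _ _] := F1; rewrite Fi.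
have {}ms : medians s1 p k by move=> k' hk; have [_ Fr _] := F1; rewrite Fr // ms.
apply: ok_seq; apply: (@sort_progP _ _ _ (size p) lg) => //; first by case: ls.
move=> t2 s2 F2 ht2 eV2; rewrite eV1 in eV2.
have {}es := env_frame F2 isT isT es; have {}ls := loaded_frame F2 isT ls.
have {}sc := scanned_frame F2 isT isT sc.
have {}ek : ints s2 v_k 0%N = k by have [Fi _ _] := F2; rewrite Fi.
have {}ms : medians s2 p k by move=> k' hk; have [_ Fr _] := F2; rewrite Fr // ms.
apply: ok_seq; apply: (@mid_progP _ (size p)) => //; first by case: ls.
move=> t3 s3 F3 ht3 ec.
have {}es := env_frame F3 isT isT es; have {}ls := loaded_frame F3 isT ls.
have {}sc := scanned_frame F3 isT isT sc.
have {}ek : ints s3 v_k 0%N = k by have [Fi _ _] := F3; rewrite Fi.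
have {}ms : medians s3 p k by move=> k' hk; have [_ Fr _] := F3; rewrite Fr // ms.
have eV3 : slice (reals s3 a_V) 0 (size p) = sort <=%R (coords val p k).
  by have [_ Fr _] := F3; rewrite Fr.
have eVc : reals s3 a_V (size p).-1./2 = median val p k.
  by rewrite /median -eV3 nth_slice //; lia.
apply: ok_seq; apply: ok_rset; apply: ok_seq; apply: ok_rset; apply: ok_seq; apply: ok_rset.
rewrite /= !updE /= ec ek eVc.
set s4 := State _ _ _.
have eV4 : slice (reals s4 a_V) 0 (size p) = sort <=%R (coords val p k) by [].
have {}ms : medians s4 p k.+1.
  move=> k'; rewrite ltnS leq_eqVlt /= !updE /= => /orP[/eqP ->|hk].
    by rewrite eqxx.
  by rewrite ltn_eqF // ms.
apply: ok_seq; apply: (count_progP (m := size p) (l := sort <=%R (coords val p k))) => //.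
  by case: ls.
move=> t5 s5 F5 ht5 ecnt; apply: ok_seq; apply: ok_iset => /=.
have {}ecnt : ints s5 v_cnt 0%N = f_above J val Delta p k 0.
  rewrite ecnt /= !updE /= /f_above /above /threshold mulr0n addr0.
  by apply/permP; rewrite perm_sort.
rewrite ecnt; set s6 := State _ _ _.
have {}es : env s6 by have := env_frame F5 isT isT (es : env s4).
have {}sc : scanned s6 p o.
  by have := scanned_frame F5 isT isT (sc : scanned s4 p o); case: (o) => [[? ?]|].
have [Fi5 Fr5 _] := F5.
have {}ms : medians s6 p k.+1 by move=> k' hk; rewrite /= Fr5 // ms.
have {}ek : ints s6 v_k 0%N = k by rewrite /= !updE /= Fi5.
have em : ints s6 v_m 0%N = size p by rewrite /= !updE /= Fi5 //; case: ls.
have pV : perm_eq (slice (reals s6 a_V) 0 (size p)) (coords val p k).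
  by rewrite /= Fr5 // eV4 perm_sort.
have eth : reals s6 r_th 0%N = threshold J val Delta p k 0.
  by rewrite /= Fr5 // /= !updE /= /threshold mulr0n addr0.
pose I j (s7 : state R) := [/\ reals s7 r_th 0%N = threshold J val Delta p k j,
  ints s7 v_fcur 0%N = f_above J val Delta p k j &
  scanned s7 p (scan_windows D J val Delta p k j o)].
apply: (@ok_for _ _ I _ _ _ J (60 * size p + 200)).
- move=> j s7 F7 jJ [h1 h2 h3] ev.
  have [Fi7 Fr7 _] := F7.
  apply: (@window_stepP s7 p k j (scan_windows D J val Delta p k j o)) => //.
  + exact: env_frame F7 isT isT es.
  + by rewrite Fi7.
  + by rewrite Fi7.
  + by rewrite Fr7.
  + move=> t8 s8 [Fi8 _ _] ht8 g1 g2 g3; split=> //; by rewrite Fi8.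
- move=> j s7 F7 _ _; have [[_ _ eJ] _ _ _] := env_frame F7 isT isT es.
  exact: eJ.
- by split=> //; move: sc; case: (o) => [[? ?]|].
- move=> t9 s9 F9 ht9 [_ _ h3] _; have [_ Fr9 _] := F9; split=> //.
  + move: ht1 ht2 ht3 ht5 ht9 p0; clear; rewrite /=.
    have : (0 <= J)%N by []. move: (size p) => m; nia.
  + by move=> k' hk; rewrite Fr9 // ms.
Qed.

Lemma scan_progP s p Q : env s -> loaded s p -> (0 < size p <= 2 ^ lg)%N ->
  (forall t s', frame scan_prog s s' ->
     (t <= 1300 * (D.+1 * (size p * (lg + J + 1))))%N ->
     medians s' p D -> scanned s' p (scan D J val Delta p) -> Q t s') ->
  ok u scan_prog s Q.
Proof.
move=> es ls hp HQ; have : ok u scan_prog s (fun t s' =>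
    [/\ (t <= 1300 * (D.+1 * (size p * (lg + J + 1))))%N, medians s' p D &
     scanned s' p (scan D J val Delta p)]); last first.
  by move=> h; apply: ok_weaken h _ => t s' F [h1 h2 h3]; apply: HQ.
apply: ok_seq; apply: ok_iset => /=; set s0 := State _ _ _.
have {}es : env s0 by [].
have {}ls : loaded s0 p by [].
apply: (@ok_for _ _ (fun k s1 => medians s1 p k /\
    scanned s1 p (scan_directions D J val Delta p k)) _ _ _ D
    (1200 * (size p * (lg + J + 1)))).
- move=> k s1 F1 kD [h1 h2] ev.
  apply: (direction_stepP _ _ _ _ _ h1 h2) => //.
  + exact: env_frame F1 isT isT es.
  + exact: loaded_frame F1 isT ls.
  + move=> t s2 [Fi2 _ _] ht g1 g2; split=> //; by rewrite Fi2.
- move=> k s1 F1 _ _; have [[_ eD _] _ _ _] := env_frame F1 isT isT es.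
  exact: eD.
- by split.
- move=> t s1 F1 ht [h1 h2] _; split=> //.
  move: ht hp; clear; rewrite /=; set z := (size p * _)%N => ht /andP[h1 _].
  have : (0 < z)%N by rewrite /z; move: h1; clear; nia.
  by move: ht; clear; nia.
Qed.

End ProgramSpec.

Lemma log_ratioE m f b : (0 < f)%N -> (forall i, (i < b)%N -> (2 ^ i * f < m)%N) ->
  (m <= 2 ^ b * f)%N -> log_ratio m f = b.
Proof.
move=> f0 hlt hle.
(* [log_ratio] searches below m only. The case b = m is covered because an unsuccessful [find]
   returns the length of the list. *)
have bm : (b <= m)%N.
  rewrite leqNgt; apply/negP => /hlt.
  by have := ltn_expl m (isT : 1 < 2)%N; nia.
rewrite /log_ratio -(subnKC bm) iotaD find_cat.
rewrite subnKC // (_ : has _ _ = false) ?size_iota; last first.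
  apply/hasPn => i; rewrite mem_iota add0n /= => /hlt; by rewrite ltnNge.
by case: (m - b)%N => [|r] //=; rewrite ?add0n ?hle addn0.
Qed.

Section ScanFacts.
Variables (R : realType) (n D J : nat) (val : 'I_n -> nat -> R) (Delta : R).
Implicit Type p : seq 'I_n.
Notation good := (good D J val Delta).
Notation scan := (scan D J val Delta).

Lemma scan_some p k j : scan p = Some (k, j) -> [/\ (k < D)%N, (j < J)%N & good p k j].
Proof.
have hw K r o : (r <= J)%N -> scan_windows D J val Delta p K r o = Some (k, j) ->
    o = Some (k, j) \/ [/\ k = K, (j < J)%N & good p k j].
  elim: r => [|r IH] rJ /=; first by left.
  by case: ifP => [hg [<- <-]|_]; [right|apply: IH; apply: ltnW].
have hd d : (d <= D)%N -> scan_directions D J val Delta p d = Some (k, j) ->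
    [/\ (k < D)%N, (j < J)%N & good p k j].
  elim: d => // d IH dD /= /(hw _ _ _ (leqnn J)) [/IH|[-> ? ?]]; last by split.
  by apply; apply: ltnW.
exact: hd.
Qed.

Lemma scan_none p : scan p = None ->
  forall k j, (k < D)%N -> (j < J)%N -> good p k j = false.
Proof.
move=> h k j kD jJ.
have hw K r o : scan_windows D J val Delta p K r o = None ->
    o = None /\ forall i, (i < r)%N -> good p K i = false.
  elim: r => [|r IH] //=; case: ifP => // hg /IH[-> hr]; split=> // i.
  by rewrite ltnS leq_eqVlt => /orP[/eqP ->|/hr].
have hd d : scan_directions D J val Delta p d = None ->
    forall K, (K < d)%N -> good p K j = false.
  elim: d => // d IH /= /hw[/IH h1 h2] K.
  by rewrite ltnS leq_eqVlt => /orP[/eqP ->|/h1 //]; apply: h2.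
exact: hd h k kD.
Qed.

Lemma good_above p k j : good p k j -> (0 < size p)%N -> (0 < f_above J val Delta p k j.+1)%N.
Proof.
move=> /andP[h _] p0; rewrite lt0n; apply/eqP => e; move: h.
by rewrite e mulr0 lern0 -leqn0 leqNgt p0.
Qed.

End ScanFacts.

Section SelectSpec.
Variables (R : realType) (u : nat -> R) (n D J lg : nat) (val : 'I_n -> nat -> R) (Delta : R).
Notation env := (env D J val Delta).
Notation scan := (scan D J val Delta).

(** The loop that doubles f' reaches m only because f' > 0, which the first half of [good]
    guarantees. *)
Lemma light_testP (s : state R) p k j uu (i : 'I_n) Q : env s -> loaded s p ->
  (0 < size p <= 2 ^ lg)%N ->
  scanned J val Delta s p (Some (k, j)) -> scan p = Some (k, j) ->
  ints s v_q 0%N = (D * i)%N -> ints s v_flag 0%N = 0%N -> reals s r_u 0%N = uu ->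
  (forall t s', frame light_test s s' -> (t <= 60 * lg + 200)%N ->
     ints s' v_flag 0%N = in_light J val Delta p k j uu i -> Q t s') ->
  ok u light_test s Q.
Proof.
move=> es [_ em] /andP[p0 plg] [_ ek eblo ebf] sk eq ef eu HQ.
have [kD jJ hg] := scan_some sk; have f0 := good_above hg p0.
have : ok u light_test s (fun t s' => (t <= 60 * lg + 200)%N /\
     ints s' v_flag 0%N = in_light J val Delta p k j uu i); last first.
  by move=> h; apply: ok_weaken h _ => t s' F [h1 h2]; apply: HQ.
have [_ _ eX [ew _ _]] := es.
have er : reals s a_X (ints s v_q 0 + ints s v_bk 0)%N - reals s r_blo 0%N =
    val i k - threshold J val Delta p k j by rewrite eq ek eX // eblo.
apply: ok_seq; apply: ok_rset; rewrite /= er; apply: ok_if; rewrite /= !updE /= -ltNge => h0;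
  last by apply: ok_skip; rewrite /in_light (negbTE h0); split=> //=; lia.
apply: ok_seq; apply: ok_rset => /=; rewrite !updE /= ew.
set z := _ / _.
have er1 : ok u (If (RLe (RInt (INum 1)) (rcell 15)) (rset 15 (RInt (INum 1))) Skip)
  (State (ints s) (upd (upd (reals s) 15 0 (val i k - threshold J val Delta p k j)) 15 0 z)
     (tape_pos s)) (fun t s1 => (t <= 20)%N /\ reals s1 r_t 0%N = ramp J val Delta p k j i).
  apply: ok_if => /=; rewrite !updE /= => hz.
    by apply: ok_rset; rewrite /= !updE /=; split=> //; rewrite /ramp; apply/esym/min_idPl.
  by apply: ok_skip; rewrite /= !updE /=; split=> //; rewrite /ramp minC; apply/esym/min_idPl; rewrite ltW // ltNge.
apply: ok_seq; apply: ok_weaken er1 _ => t1 s1 [Fi1 Fr1 _] [ht1 et].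
apply: ok_seq; apply: ok_rset; apply: ok_seq; apply: ok_iset => /=; set s2 := State _ _ _.
set f := f_above _ _ _ _ _ _ in ebf f0.
set r := ramp _ _ _ _ _ _ _ in et.
pose Inv (s3 : state R) := exists b, [/\ ints s3 v_c 0 = (2 ^ b * f)%N,
  (forall i, (i < b)%N -> (2 ^ i * f < size p)%N) & reals s3 r_pw 0%N = (r * r) ^+ b].
apply: ok_seq; apply: (@ok_while _ _ Inv (fun s3 => (lg - trunc_log 2 (ints s3 v_c 0)) * 40)%N).
- move=> s3 [Fi3 Fr3 _] [b [e1 e2 e3]] /=.
  rewrite e1 (Fi3 v_m) // /s2 /= !updE /= Fi1 //= em addn1 => hlt.
  have bf0 : (0 < 2 ^ b * f)%N by rewrite muln_gt0 expn_gt0 f0.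
  (* The loop runs only while 2 ^ b * f < m <= 2 ^ lg, so the logarithm of the doubled cell can pay
     for the rounds. *)
  have hlog : (trunc_log 2 (2 ^ b * f) < lg)%N.
    rewrite -(@ltn_exp2l 2) //; apply: leq_ltn_trans (trunc_logP _ bf0) _ => //.
    exact: leq_trans hlt plg.
  apply: ok_seq; apply: ok_iset; apply: ok_rset; rewrite /= /Inv /= !updE /= e1.
  have -> : (2 ^ b * f + 2 ^ b * f = 2 * (2 ^ b * f))%N by lia.
  rewrite trunc_logMp //; split; last by move: hlog; clear; lia.
  exists b.+1; split; first by rewrite expnS mulnA.
    by move=> i'; rewrite ltnS leq_eqVlt => /orP[/eqP ->|/e2].
  rewrite e3 (Fr3 r_t) // /s2 /= !updE /= et exprSr //.
- by exists 0%N; rewrite /s2 /= !updE /= Fi1 //= ebf mul1n expr0; split.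
- move=> t3 s3 [Fi3 Fr3 _] [b [e1 e2 e3]] /=.
  rewrite e1 (Fi3 v_m) // /s2 /= !updE /= Fi1 //= em addn1 -leqNgt => hle ht3.
  have eb := log_ratioE f0 e2 hle.
  have ht : (t3 <= 40 * lg + 60)%N by move: ht3; rewrite Fi1 //= ebf; clear; nia.
  have eu3 : reals s3 r_u 0%N = uu by rewrite Fr3 // /s2 /= updE /= Fr1.
  have ef3 : ints s3 v_flag 0%N = 0%N by rewrite Fi3 // /s2 /= updE /= Fi1.
  apply: ok_if => /=; rewrite eu3 e3 => hu.
    apply: ok_iset; rewrite /= !updE /= /in_light h0 -/f -/r eb hu; split=> //.
    by move: ht ht1; clear; lia.
  apply: ok_skip; rewrite ef3 /in_light h0 -/f -/r eb (negbTE hu); split=> //.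
  by move: ht ht1; clear; lia.
Qed.

Lemma box_testP (s : state R) p uu (i : 'I_n) Q : env s -> medians val s p D ->
  ints s v_q 0%N = (D * i)%N -> reals s r_u 0%N = uu ->
  (forall t s', frame box_test s s' -> (t <= 60 * D + 60)%N ->
     ints s' v_flag 0%N = in_box D val Delta p uu i -> Q t s') ->
  ok u box_test s Q.
Proof.
move=> es ms eq eu HQ.
have : ok u box_test s (fun t s' => (t <= 60 * D + 60)%N /\
     ints s' v_flag 0%N = in_box D val Delta p uu i); last first.
  by move=> h; apply: ok_weaken h _ => t s' F [h1 h2]; apply: HQ.
apply: ok_seq; apply: ok_iset => /=; set s0 := State _ _ _.
have [[_ eD _] _ eX [_ eq4 _]] := es.
pose B k := all (fun k => val i k - median val p k <= quarter Delta * (1 + uu)) (iota 0 k).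
have BS k : B k.+1 = B k && (val i k - median val p k <= quarter Delta * (1 + uu)).
  by rewrite /B -addn1 iotaD all_cat /= andbT.
have [B0 BD] : B 0%N = true /\ in_box D val Delta p uu i = B D by [].
rewrite BD; move: B BS B0 {BD} => B BS B0.
apply: (@ok_for _ _ (fun k s1 => ints s1 v_flag 0%N = B k) _ _ _ D 30).
- move=> k s1 [Fi Fr _] kD ef ev.
  have er : reals s1 = reals s by apply: funext => a; rewrite Fr.
  have em : reals s a_X (ints s1 v_q 0 + k)%N - reals s a_med k = val i k - median val p k.
    by rewrite Fi // /s0 /= updE /= eq eX // ms.
  apply: ok_if; rewrite /= er ev em eq4 eu => hk.
    by apply: ok_skip; rewrite /= !updE /= BS hk andbT; split.
  by apply: ok_iset; rewrite /= !updE /= BS (negbTE hk) andbF; split.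
- by move=> k s1 [Fi _ _] _ _; rewrite /= Fi.
- by rewrite B0.
- by move=> t s1 _ ht ef _; split=> //; move: ht => /=; lia.
Qed.

Lemma select_progP (s : state R) p uu Q : env s -> loaded s p ->
  (0 < size p <= 2 ^ lg)%N ->
  scanned J val Delta s p (scan p) -> medians val s p D -> reals s r_u 0%N = uu ->
  let A := [seq i <- p | selected D J val Delta p uu i] in
  let B := [seq i <- p | ~~ selected D J val Delta p uu i] in
  (forall t s', frame select_prog s s' ->
     (t <= size p * (60 * D + 60 * lg + 400) + 100)%N ->
     ints s' v_nA 0%N = size A -> slice (ints s' a_A) 0 (size A) = [seq nat_of_ord i | i <- A] ->
     ints s' v_nB 0%N = size B -> slice (ints s' a_B) 0 (size B) = [seq nat_of_ord i | i <- B] ->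
     Q t s') ->
  ok u select_prog s Q.
Proof.
move=> es ls hp sc ms eu A B HQ.
have : ok u select_prog s (fun t s' => [/\ (t <= size p * (60 * D + 60 * lg + 400) + 100)%N,
     ints s' v_nA 0%N = size A /\ slice (ints s' a_A) 0 (size A) = [seq nat_of_ord i | i <- A] &
     ints s' v_nB 0%N = size B /\ slice (ints s' a_B) 0 (size B) = [seq nat_of_ord i | i <- B]]);
  last first.
  by move=> h; apply: ok_weaken h _ => t s' F [h1 [h2 h3] [h4 h5]]; apply: HQ.
apply: ok_seq; apply: ok_iset; apply: ok_seq; apply: ok_iset => /=; set s0 := State _ _ _.
have {}es : env s0 by [].
have {}ls : loaded s0 p by [].
have {}sc : scanned J val Delta s0 p (scan p) by move: sc; case: (scan p) => [[? ?]|].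
have {}ms : medians val s0 p D by [].
have {}eu : reals s0 r_u 0%N = uu by [].
pose sel := selected D J val Delta p uu.
pose IA (S : pred 'I_n) v a y (s1 : state R) := let l := [seq i <- take y p | S i] in
  ints s1 v 0%N = size l /\ slice (ints s1 a) 0 (size l) = [seq nat_of_ord i | i <- l].
apply: (@ok_for _ _ (fun y s1 => IA sel v_nA a_A y s1 /\ IA (predC sel) v_nB a_B y s1)
   _ _ _ (size p) (60 * D + 60 * lg + 360)).
- move=> y s1 F1 yp [[nA eA] [nB eB]] ev.
  have i0 : 'I_n by case: (p) yp.
  pose i := nth i0 p y.
  have ls1 := loaded_frame F1 isT ls.
  have es1 := env_frame F1 isT isT es.
  have [_ eoff _ _] := es1.
  apply: ok_seq; apply: ok_iset; apply: ok_seq; apply: ok_iset; apply: ok_seq; apply: ok_iset.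
  rewrite /= !updE /= ev (loaded_nth i0 ls1) // -/i.
  set s2 := State _ _ _.
  have Hflag : ok u (If (ILe (INum 1) (cell v_found)) light_test box_test) s2
     (fun t s3 => (t <= 60 * D + 60 * lg + 250)%N /\ ints s3 v_flag 0%N = sel i).
    have [Fi1 Fr1 _] := F1.
    have es2 : env s2 by have [? ? ? ?] := es1; split.
    have ls2 : loaded s2 p by [].
    have eq2 : ints s2 v_q 0%N = (D * i)%N by rewrite /= !updE /= eoff.
    have eu2 : reals s2 r_u 0%N = uu by rewrite /= Fr1.
    have ms2 : medians val s2 p D by move=> k kD; rewrite /= Fr1 // ms.
    have sc2 : scanned J val Delta s2 p (scan p).
      have := scanned_frame F1 isT isT sc; by case: (scan p) => [[? ?]|].
    rewrite /sel /selected; case esc: (scan p) sc2 => [[k j]|] sc2.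
      apply: ok_if => hb; last by case/negP: hb; have [h _ _ _] := sc2; rewrite -[beval _ _]/(1 <= ints s2 v_found 0)%N h.
      apply: (light_testP es2 ls2 hp sc2 esc eq2 _ eu2) => // t s3 _ ht ->.
      by split=> //; move: ht => /=; lia.
    apply: ok_if => hb; first by move: hb; rewrite -[beval _ _]/(1 <= ints s2 v_found 0)%N (sc2 : ints s2 v_found 0%N = 0%N).
    apply: (box_testP es2 ms2 eq2 eu2) => // t s3 _ ht ->.
    by split=> //; move: ht => /=; lia.
  apply: ok_seq; apply: ok_weaken Hflag _ => t3 s3 [Fi3 _ _] [ht3 eflag].
  have nA3 : ints s3 v_nA 0%N = size [seq i <- take y p | sel i] by rewrite Fi3.
  have nB3 : ints s3 v_nB 0%N = size [seq i <- take y p | predC sel i] by rewrite Fi3.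
  have eA3 : ints s3 a_A = ints s1 a_A by rewrite Fi3.
  have eB3 : ints s3 a_B = ints s1 a_B by rewrite Fi3.
  have ept : ints s3 v_pt 0%N = i by rewrite Fi3 //.
  have ey : ints s3 v_y 0%N = y by rewrite Fi3.
  rewrite /IA (take_nth i0) // -/i !filter_rcons /=.
  apply: ok_if; rewrite /= eflag => hs.
    have {}hs : sel i by case: (sel i) hs.
    apply: ok_seq; apply: ok_iset; apply: ok_iset; rewrite /= !updE /= hs /=.
    rewrite ![upd _ 28 _ _ _]upd_other // ![upd _ 22 _ _ _]upd_other //.
    split; [by move: ht3; clear; lia | by [] | split];
      last by rewrite nB3 upd_other // eB3.
    rewrite size_rcons nA3 addn1 map_rcons slice_rcons ept; split=> //.
    rewrite slice_upd_out; last by apply/orP; right.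
    by rewrite updE !eqxx /= eA3 eA.
  have {}hs : sel i = false by case: (sel i) hs.
  apply: ok_seq; apply: ok_iset; apply: ok_iset; rewrite /= !updE /= hs /=.
  rewrite ![upd _ 28 _ _ _]upd_other // ![upd _ 23 _ _ _]upd_other //.
  split; [by move: ht3; clear; lia | by [] | split];
    first by rewrite nA3 upd_other // eA3.
  rewrite size_rcons nB3 addn1 map_rcons slice_rcons ept; split=> //.
  rewrite slice_upd_out; last by apply/orP; right.
  by rewrite updE !eqxx /= eB3 eB.
- by move=> y s1 F1 _ _; have [_ h] := loaded_frame F1 isT ls; exact: h.
- by rewrite /IA take0.
- move=> t s1 F1 ht; rewrite /IA take_size => -[h1 h2] _; split=> //.
  by move: ht => /=; nia.
Qed.

End SelectSpec.

Fixpoint segments (T : Type) (E : nat -> nat) lo (ps : seq (seq T)) : Prop :=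
  if ps is p :: ps' then
    [/\ (0 < size p)%N, E lo = (lo + size p)%N & segments E (lo + size p)%N ps']
  else True.

(** Entries of the table of ends to the left of [lo] are stale and may be anything. *)
Lemma segments_ext (T : Type) (E E' : nat -> nat) lo (ps : seq (seq T)) :
  (forall j, (lo <= j)%N -> E' j = E j) -> segments E lo ps -> segments E' lo ps.
Proof.
elim: ps lo => //= p ps IH lo h [h1 h2 h3]; split=> //; first by rewrite h.
by apply: IH h3 => j hj; apply: h; lia.
Qed.

(** * Correctness of the program *)

Section StepSpec.
Variables (R : realType) (u : nat -> R) (n D J lg : nat) (val : 'I_n -> nat -> R) (Delta : R).
Notation env := (env D J val Delta).
Notation scan := (scan D J val Delta).
Notation selected := (selected D J val Delta).
Notation next := (next_config D J val Delta).
Notation config := (config n).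

Definition represents (s : state R) (c : config) :=
  let flat := flatten (pending c) in
  [/\ env s /\ (size flat <= n)%N, ints s v_lo 0%N = low c,
      slice (ints s a_perm) (low c) (size flat) = [seq nat_of_ord i | i <- flat],
      segments (ints s a_end) (low c) (pending c) &
      ints s 1 = label c].

Lemma copy_progP (s : state R) e b a v l Q :
  let p := for_loop v_x (cell v) (ISet a_perm (IAdd e (cell v_x)) (IGet a (cell v_x))) in
  (a == a_perm) = false -> (a == v_x) = false -> (v == a_perm) = false -> (v == v_x) = false ->
  ints s v 0%N = size l -> slice (ints s a) 0 (size l) = l ->
  (forall s1, frame p s s1 -> ieval s1 e = b) ->
  (forall t s', frame p s s' -> (t <= size l * (icost e + 40) + 40)%N ->
     slice (ints s' a_perm) b (size l) = l ->
     (forall j, (j < b)%N || (b + size l <= j)%N -> ints s' a_perm j = ints s a_perm j) ->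
     Q t s') -> ok u p s Q.
Proof.
move=> p ha hx hv hvx ev el eb HQ.
have : ok u p s (fun t s' => [/\ (t <= size l * (icost e + 40) + 40)%N,
     slice (ints s' a_perm) b (size l) = l &
     forall j, (j < b)%N || (b + size l <= j)%N -> ints s' a_perm j = ints s a_perm j]).
  pose I x (s1 : state R) := slice (ints s1 a_perm) b x = take x l /\
    forall j, (j < b)%N || (b + x <= j)%N -> ints s1 a_perm j = ints s a_perm j.
  apply: (@ok_for _ _ I _ _ _ (size l) (icost e + 12)).
  - move=> x s1 F1 xl [h1 h2] ex; apply: ok_iset; split; first by rewrite /=; lia.
      by rewrite /= updE.
    have ee : ieval s1 e = b by apply: eb.
    have [Fi _ _] := F1.
    have ea : ints s1 a x = nth 0%N l x.
      rewrite Fi; last by rewrite /= !inE hx ha orbF.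
      by rewrite -[in RHS]el nth_slice.
    rewrite /I /= ![upd _ 36 _ _ _]upd_other // ee ex ea; split.
      rewrite slice_rcons updE !eqxx /= slice_upd_out; last by apply/orP; right.
      by rewrite h1 (take_nth 0%N).
    move=> j hj; rewrite updE eqxx /= (_ : (j == b + x)%N = false); last by lia.
    by apply: h2; lia.
  - move=> x s1 [Fi _ _] _ _; rewrite /= Fi //.
    by rewrite /= !inE hvx hv.
  - by split=> [|j _]; rewrite ?take0.
  - move=> t s' F ht [h1 h2] _; rewrite take_size in h1; split=> //.
    by move: ht => /=; clear; nia.
by move=> h; apply: ok_weaken h _ => t s' F [h1 h2 h3]; apply: HQ.
Qed.

Lemma split_progP (s : state R) c p ps S Q : represents s c -> pending c = p :: ps ->
  loaded s p -> ints s v_hi 0%N = (low c + size p)%N ->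
  scanned J val Delta s p (scan p) ->
  let A := [seq i <- p | S i] in let B := [seq i <- p | ~~ S i] in
  (0 < size A)%N -> (scan p -> (0 < size B)%N) ->
  ints s v_nA 0%N = size A -> slice (ints s a_A) 0 (size A) = [seq nat_of_ord i | i <- A] ->
  ints s v_nB 0%N = size B -> slice (ints s a_B) 0 (size B) = [seq nat_of_ord i | i <- B] ->
  (forall t s', frame split_prog s s' -> (t <= 200 * size p + 300)%N ->
     represents s' (next c S) -> Q t s') ->
  ok u split_prog s Q.
Proof.
move=> rs ec ls ehi sc A B A0 B0 enA eA enB eB HQ.
have : ok u split_prog s (fun t s' => (t <= 200 * size p + 300)%N /\ represents s' (next c S)).
  have [[es fn] elo eperm eseg elab] := rs.
  have szAB : (size A + size B = size p)%N by rewrite !size_filter count_predC.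
  rewrite ec /= in fn eperm eseg.
  have elow : (low c + (size p + size (flatten ps)) = n)%N.
    by rewrite /low ec /= size_cat; move: fn; rewrite size_cat; clear; lia.
  have [p0 eend eseg'] := eseg.
  apply: ok_seq; apply: (@copy_progP _ _ (low c) _ _ [seq nat_of_ord i | i <- A]) => //;
    rewrite ?size_map //.
    by move=> s1 [Fi _ _]; rewrite /= Fi.
  move=> t1 s1 F1 ht1 eP1 eQ1; have [Fi1 Fr1 _] := F1.
  apply: ok_seq; apply: (@copy_progP _ _ (low c + size A) _ _ [seq nat_of_ord i | i <- B]) => //;
    rewrite ?size_map //; try by rewrite Fi1.
    by move=> s2 [Fi _ _]; rewrite /= !Fi //= !Fi1 // elo enA.
  move=> t2 s2 F2 ht2 eP2 eQ2; have [Fi2 Fr2 _] := F2.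
  apply: ok_seq; apply: ok_iset => /=.
  have e3 a : a \notin [:: 2; 36]%N -> ints s2 a = ints s a.
    by rewrite !inE !negb_or => /andP[h1 h2]; rewrite Fi2 ?Fi1 //= !inE !negb_or h1 h2.
  rewrite !e3 // elo enA.
  set s3 := State _ _ _.
  have es3 : env s3.
    have := env_frame F2 isT isT (env_frame F1 isT isT es).
    by [].
  have eflat : slice (ints s3 a_perm) (low c) (size p + size (flatten ps)) =
      [seq nat_of_ord i | i <- A ++ B ++ flatten ps].
    rewrite -szAB -addnA slice_cat slice_cat !map_cat; congr (_ ++ (_ ++ _)).
    - rewrite -[RHS]eP1; apply: eq_slice => j hj /=; rewrite upd_other // eQ2 //.
      by apply/orP; left; case/andP: hj.
    - by rewrite -[RHS]eP2; apply: eq_slice => j hj /=; rewrite upd_other.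
    - have := congr1 (drop (size p)) eperm.
      rewrite size_cat slice_cat drop_size_cat ?size_slice // map_cat drop_size_cat ?size_map //.
      move=> <-; rewrite -szAB addnA.
      apply: eq_slice => j /andP[hj _] /=; rewrite upd_other // eQ2 ?eQ1 //.
        by apply/orP; right; apply: leq_trans hj; rewrite leq_addr.
      by apply/orP; right.
  have sc3 : scanned J val Delta s3 p (scan p).
    move: sc; case: (scan p) => [[k j]|] /=; rewrite !upd_other // !e3 // Fr2 // Fr1 //.
  have elo3 : ints s3 v_lo 0%N = low c by rewrite /= updE /= e3.
  have ehi3 : ints s3 v_hi 0%N = (low c + size p)%N by rewrite /= updE /= e3.
  have ec3 : ints s3 v_c 0%N = (low c + size A)%N by rewrite /= updE.
  have eend3 : ints s3 a_end = ints s a_end by rewrite /= upd_other // e3.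
  have elab3 : ints s3 1 = label c by rewrite /= upd_other // e3 //.
  have enA3 : ints s3 v_nA 0%N = size A by rewrite /= updE /= e3.
  have eA3 : slice (ints s3 a_A) 0 (size A) = [seq nat_of_ord i | i <- A].
    by rewrite /= upd_other // e3.
  move: es3 eflat sc3 elo3 ehi3 ec3 eend3 elab3 enA3 eA3; move: {e3} s3.
  move=> s3 es3 eflat sc3 elo3 ehi3 ec3 eend3 elab3 enA3 eA3.
  case esc: (scan p) sc3 B0 => [[k j]|] sc3.
    move=> /(_ isT) B0; apply: ok_if; rewrite /= (_ : ints s3 v_found 0%N = 1%N) //;
      try by case: sc3.
    move=> _; apply: ok_seq; apply: ok_iset; apply: ok_iset => /=.
    rewrite !updE /= elo3 ec3 ehi3; split; first by move: ht1 ht2 szAB; clear => /=; lia.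
    have en : next c S = Config (A :: B :: ps) (label c) by rewrite /next_config ec esc.
    have el : low (next c S) = low c.
      by rewrite en /low ec /= !size_cat; move: szAB; clear; lia.
    have fl : size (flatten (pending (next c S))) = (size p + size (flatten ps))%N.
      by rewrite en /= !size_cat addnA szAB.
    split; rewrite ?el ?fl.
    - by split; [case: es3 => ? ? ? ?; split|rewrite -size_cat].
    - by rewrite /= !upd_other.
    - by rewrite /= !upd_other // eflat en.
    - rewrite en /=; split=> //; rewrite !updE /= ?eqxx; first by rewrite ltn_eqF //; lia.
      split=> //; first by move: szAB; clear; lia.
      rewrite -addnA szAB; apply: segments_ext eseg' => j' hj; rewrite !updE /=.
      by rewrite !gtn_eqF ?eend3 //; lia.
    - by rewrite /= !upd_other // en.
  move=> _; apply: ok_if; rewrite /= (_ : ints s3 v_found 0%N = 0%N) //.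
  move=> _; apply: ok_seq.
  pose lab x i := if i \in [seq nat_of_ord a | a <- take x A] then low c else label c i.
  apply: (@ok_for _ _ (fun x s4 => ints s4 1 = lab x) _ _ _ (size A) 10).
  - move=> x s4 [Fi4 _ _] xA el ev; apply: ok_iset; rewrite /= !updE /= ev; split=> //.
    have i0 : 'I_n by case: (A) xA.
    have -> : ints s4 5 x = nth i0 A x.
      rewrite Fi4 //; have := congr1 (fun l => nth 0%N l x) eA3.
      by rewrite nth_slice // (nth_map i0).
    rewrite upd_other //; apply: funext => i; rewrite /upd eqxx /= Fi4 // elo3 el /lab.
    rewrite (take_nth i0) // map_rcons mem_rcons inE.
    by case: eqP.
  - by move=> x s4 [Fi4 _ _] _ _; rewrite /= Fi4.
  - by rewrite /= upd_other // elab3; apply: funext => i; rewrite /lab take0.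
  - move=> t4 s4 F4 ht4 el _; rewrite /lab take_size in el.
    have es4 := env_frame F4 isT isT es3.
    have [Fi4 _ _] := F4.
    pose B' := if B is [::] then ps else B :: ps.
    have fB : flatten B' = B ++ flatten ps by rewrite /B'; case: (B).
    have en : next c S = Config B' (fun i => if i \in [seq nat_of_ord a | a <- A] then low c else label c i).
      by rewrite /next_config ec esc.
    have elw : low (next c S) = (low c + size A)%N.
      by rewrite en /low ec /= fB !size_cat; move: szAB elow; clear; lia.
    have eflat' : slice (ints s4 a_perm) (low c + size A) (size (flatten B')) =
        [seq nat_of_ord i | i <- flatten B'].
      rewrite Fi4 // fB size_cat.
      have := congr1 (drop (size A)) eflat.
      rewrite -szAB -addnA slice_cat drop_size_cat ?size_slice // => ->.
      by rewrite map_cat drop_size_cat // size_map.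
    have szB : (size (flatten B') <= n)%N by rewrite fB size_cat; move: szAB elow; clear; lia.
    (* One table covers both branches of the last test of the program: a new end is stored exactly
       when B is nonempty. *)
    have eE : segments (fun i => if (i == low c + size A)%N && (low c + size A < low c + size p)%N
        then (low c + size p)%N else ints s4 a_end i) (low c + size A) B'.
      rewrite /B' Fi4 // eend3; case eBs: (B) => [|b0 B1].
        have eAp : size A = size p by rewrite -szAB eBs addn0.
        by rewrite eAp; apply: segments_ext eseg' => j hj; rewrite ltnn andbF.
      have sB : size (b0 :: B1) = size B by rewrite eBs.
      rewrite /= -/(size (b0 :: B1)) sB -szAB; split=> //.
        by rewrite -sB.
        by rewrite eqxx ltn_add2l -[X in (X < _)%N]addn0 ltn_add2l -sB /= addnA.
      rewrite -addnA szAB; apply: segments_ext eseg' => j hj.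
      by rewrite gtn_eqF //; move: szAB hj sB => /=; clear; lia.
    apply: ok_seq; apply: ok_if => /=; rewrite !Fi4 // ec3 ehi3 addn1 => hlt.
      apply: ok_iset; apply: ok_iset; rewrite /= !updE /= !Fi4 // ec3 ehi3.
      split; first by move: ht1 ht2 ht4 szAB; clear => /=; lia.
      rewrite /represents elw; split.
      + by split; [case: es4 => ? ? ? ?; split|rewrite en].
      + by rewrite /= !updE.
      + by rewrite /= !upd_other // en.
      + rewrite en /= upd_other //; apply: segments_ext eE => j hj.
        by rewrite updE eqxx /= hlt andbT.
      + by rewrite /= !upd_other // en.
    apply: ok_skip; apply: ok_iset; rewrite /= !Fi4 // ec3.
    split; first by move: ht1 ht2 ht4 szAB; clear => /=; lia.
    rewrite /represents elw; split.
    + by split; [case: es4 => ? ? ? ?; split|rewrite en].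
    + by rewrite /= !updE.
    + by rewrite /= !upd_other // en.
    + rewrite en /= upd_other //; apply: segments_ext eE => j hj.
      by rewrite (negbTE hlt) andbF.
    + by rewrite /= !upd_other // en.
by move=> h; apply: ok_weaken h _ => t s' F [h1 h2]; apply: HQ.
Qed.

End StepSpec.

Section LoopSpec.
Variables (R : realType) (u : nat -> R) (n D J lg : nat) (val : 'I_n -> nat -> R) (Delta : R).
Notation env := (env D J val Delta).
Notation scan := (scan D J val Delta).
Notation selected := (selected D J val Delta).
Notation next := (next_config D J val Delta).
Notation represents := (represents D J val Delta).
Definition splits p uu :=
  (0 < size [seq i <- p | selected p uu i])%N /\
  (scan p -> (0 < size [seq i <- p | ~~ selected p uu i])%N).

Definition step (c : config n) (uu : R) : config n :=
  next c (selected (head [::] (pending c)) uu).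

Definition step_cost m := (3000 * (D.+1 * (m * (lg + J + 1))))%N.

(** An upper bound for the number of remaining splits: a cut adds a segment and keeps the points,
    while a box removes at least one point and at most one segment. The subtraction is not truncated
    as long as segments are nonempty. *)
Definition potential (c : config n) := (size (flatten (pending c)) * 2 - size (pending c))%N.

Lemma segments_size (E : nat -> nat) lo (ps : seq (seq 'I_n)) :
  segments E lo ps -> (size ps <= size (flatten ps))%N.
Proof. by elim: ps lo => //= p ps IH lo [p0 _ /IH]; rewrite size_cat; lia. Qed.

Lemma potential_step c p ps uu : pending c = p :: ps -> splits p uu ->
  (size ps <= size (flatten ps))%N -> (potential (step c uu) < potential c)%N.
Proof.
move=> ec [A0 B0] hps; rewrite /potential /step ec /= /next_config ec.
set A := [seq _ <- _ | _] in A0 *; set B := [seq _ <- _ | _] in B0 *.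
have szAB : (size A + size B = size p)%N by rewrite !size_filter count_predC.
case: (scan p) B0 => [_ /(_ isT) B0|_] /=; rewrite !size_cat; first by lia.
by case: (B) szAB => [|b B1] /=; rewrite ?size_cat /=; lia.
Qed.

Hypothesis n_lg : (n <= 2 ^ lg)%N.

Lemma main_stepP (s : state R) c p ps Q : represents s c -> pending c = p :: ps ->
  splits p (u (tape_pos s)) ->
  (forall t s', (t <= step_cost (size p))%N ->
     tape_pos s' = (tape_pos s).+1 ->
     ints s' 0 0%N = n ->
     represents s' (step c (u (tape_pos s))) -> Q t s') ->
  ok u main_step s Q.
Proof.
move=> rs ec [A0 B0] HQ.
have [[es fn] elo eperm eseg elab] := rs.
have := fn; rewrite ec /= size_cat => fn'.
have [p0 eend _] : segments (ints s a_end) (low c) (p :: ps) by rewrite -ec.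
have hp : (0 < size p <= 2 ^ lg)%N by rewrite p0; lia.
apply: ok_seq; apply: ok_iset; apply: ok_seq; apply: ok_iset.
rewrite /= !updE /= elo eend (_ : (low c + size p - low c = size p)%N); last by lia.
set s0 := State _ _ _.
have es0 : env s0 by have [? ? ? ?] := es; split.
have rs0 : represents s0 c by split.
have ls0 : loaded s0 p.
  split; rewrite /= !updE //= elo !upd_other //.
  have := congr1 (take (size p)) eperm.
  by rewrite ec /= map_cat take_size_cat ?size_map // slice_take // size_cat leq_addr.
have ehi0 : ints s0 v_hi 0%N = (low c + size p)%N by [].
apply: ok_seq; apply: (scan_progP u es0 ls0 hp) => t1 s1 F1 ht1 ms1 sc1.
have [Fi1 Fr1 Ft1] := F1.
apply: ok_seq; apply: ok_runif => /=; rewrite Ft1 // [tape_pos s0]/=.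
set uu := u _ in A0 B0 *.
set s2 := State _ _ _.
have es1 := env_frame F1 isT isT es0.
have es2 : env s2 by have [? ? ? ?] := es1; split.
have ls1 := loaded_frame F1 isT ls0.
have ls2 : loaded s2 p by [].
have sc2 : scanned J val Delta s2 p (scan p) by move: sc1; case: (scan p) => [[? ?]|].
have ms2 : medians val s2 p D by [].
have eu2 : reals s2 r_u 0%N = uu by [].
apply: ok_seq; apply: (select_progP u es2 ls2 hp sc2 ms2 eu2) => t3 s3 F3 ht3 enA eA enB eB.
have es3 := env_frame F3 isT isT es2.
have ls3 := loaded_frame F3 isT ls2.
have sc3 := scanned_frame F3 isT isT sc2.
have [Fi3 Fr3 Ft3] := F3.
have rs3 : represents s3 c by split; rewrite ?Fi3 //= ?Fi1.
have ehi3 : ints s3 v_hi 0%N = (low c + size p)%N by rewrite Fi3 //= Fi1.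
apply: (split_progP u rs3 ec ls3 ehi3 sc3 A0 B0 enA eA enB eB) => t4 s4 F4 ht4 rs4.
have [Fi4 _ Ft4] := F4.
apply: HQ.
- rewrite /step_cost; move: ht1 ht3 ht4 p0; clear.
  set m := size p; set P := (lg + J + 1)%N => /= ht1 ht3 ht4 p0.
  have h1 : (m <= D.+1 * (m * P))%N by rewrite /P; nia.
  have h2 : (m * (60 * D + 60 * lg + 400) <= 400 * (D.+1 * (m * P)))%N.
    have : (60 * D + 60 * lg + 400 <= 400 * (D.+1 * P))%N by rewrite /P; nia.
    by move=> h; nia.
  move: h1 h2 ht1 ht3 ht4; move: (D.+1 * _)%N (m * (_ + _))%N => X Y; lia.
- by rewrite Ft4 // Ft3 //= Ft1.
- by rewrite Fi4 //; case: es3 => -[].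
- by rewrite /step ec.
Qed.

Fixpoint run fuel c (us : nat -> R) pos : config n :=
  if fuel is fuel'.+1 then
    if pending c is [::] then c else run fuel' (step c (us pos)) us pos.+1
  else c.

Fixpoint run_cost fuel c (us : nat -> R) pos : nat :=
  if fuel is fuel'.+1 then
    if pending c is p :: _ then
      (step_cost (size p) + 20 + run_cost fuel' (step c (us pos)) us pos.+1)%N
    else 20
  else 20.

Variable Inv : config n -> Prop.
Hypothesis Inv_splits : forall c p ps uu, Inv c -> pending c = p :: ps -> 0 <= uu <= 1 ->
  splits p uu.
Hypothesis Inv_step : forall c p ps uu, Inv c -> pending c = p :: ps -> 0 <= uu <= 1 ->
  Inv (step c uu).

(** The invariant [Inv] stays abstract so that correctness of the program does not involve geometry;
    it is instantiated with [valid]. The fuel only makes [run] structural, and [potential] says how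
    much suffices. *)
Lemma main_loopP fuel (s : state R) c Q : unit_tape u ->
  represents s c -> Inv c -> (potential c <= fuel)%N ->
  (forall t s', (t <= run_cost fuel c u (tape_pos s))%N ->
     pending (run fuel c u (tape_pos s)) = [::] ->
     ints s' 1 = label (run fuel c u (tape_pos s)) -> Q t s') ->
  ok u main_loop s Q.
Proof.
move=> hu; elim: fuel s c Q => [|fuel IH] s c Q rs Ic hpot HQ.
all: have [[es fn] elo eperm eseg elab] := rs.
all: have [[en _ _] _ _ _] := es.
all: case ec: (pending c) => [|p ps].
- exists 8%N, s; split; last by apply: HQ => //=.
  by apply: exec_WhileF; rewrite /= elo en /low ec /= subn0 addn1 ltnn.
- by have := segments_size eseg; move: hpot; rewrite /potential ec /=; move: eseg; rewrite ec /= size_cat => -[p0 _ _]; lia.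
- exists 8%N, s; split; last by apply: HQ; rewrite /= ec.
  by apply: exec_WhileF; rewrite /= elo en /low ec /= subn0 addn1 ltnn.
- have sp := Inv_splits Ic ec (hu (tape_pos s)).
  have Is := Inv_step Ic ec (hu (tape_pos s)).
  have hb : beval s (ilt (cell v_lo) (cell 0)).
    rewrite /= elo en /low addn1; move: fn eseg; rewrite ec /= size_cat => fn' [p0 _ _]; lia.
  have h1 := @main_stepP s c p ps (fun t s' => [/\ (t <= step_cost (size p))%N,
     tape_pos s' = (tape_pos s).+1 & represents s' (step c (u (tape_pos s)))]) rs ec sp.
  have [t1 [s1 [e1 [ht1 ep1 rs1]]]] := h1 (fun t s' a b c d => And3 a b d).
  have hp : (potential (step c (u (tape_pos s))) <= fuel)%N.
    have : (size ps <= size (flatten ps))%N.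
      by move: eseg; rewrite ec /= => -[_ _ /segments_size].
    by move/(potential_step ec sp) => h; rewrite -ltnS; apply: leq_trans h hpot.
  have [t2 [s2 [e2 [ht2 er2 el2]]]] := IH s1 _ (fun t s' =>
     [/\ (t <= run_cost fuel (step c (u (tape_pos s))) u (tape_pos s1))%N,
       pending (run fuel (step c (u (tape_pos s))) u (tape_pos s1)) = [::] &
       ints s' 1 = label (run fuel (step c (u (tape_pos s))) u (tape_pos s1))])
     rs1 Is hp (fun t s' a b c => And3 a b c).
  rewrite ep1 in ht2 er2 el2.
  exists (bcost (ilt (cell v_lo) (cell 0)) + t1 + t2).+1, s2; split.
    exact: exec_WhileT e1 e2.
  by apply: HQ; rewrite /= ec //; move: ht1 ht2; clear; lia.
Qed.

End LoopSpec.

Section InitSpec.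
Variables (R : realType) (u : nat -> R) (n d J : nat).
Variables (x : 'I_n -> 'rV[R]_d) (Delta : R).
Let s0 := input x Delta.

(** Each input coordinate is followed by its negative, so that direction 2 c is coordinate c and
    direction 2 c + 1 is its opposite. Reading the flat input array directly matches the copying
    loop of the program. *)
Definition signed_coord (j : nat) : R :=
  let v := reals s0 0 j./2 in if odd j then - v else v.

Definition direction (i : 'I_n) (k : nat) : R := signed_coord ((d + d) * i + k).

Definition initial_config : config n := Config [:: enum 'I_n] (fun=> 0%N).

Hypothesis n_gt0 : (0 < n)%N.
Hypothesis J_ge : (4 * d <= 2 ^ (2 ^ J))%N.
Hypothesis J_min : forall j, (j < J)%N -> (2 ^ (2 ^ j) < 4 * d)%N.

Definition filled i j (s : state R) :=
  [/\ ints s v_q 0%N = j, ints s v_p 0%N = j./2,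
      forall i', (i' < i)%N -> ints s a_off i' = ((d + d) * i')%N,
      forall i', (i' < i)%N -> ints s a_perm i' = i' &
      forall j', (j' < j)%N -> reals s a_X j' = signed_coord j'].

(** The hypotheses on [J] say that it is the number of squarings that bring 2 up to at least 4 d,
    which is how the program counts it without a logarithm. *)
Lemma init_progP Q :
  (forall t s', (t <= 100 * (n * d.+1) + 100 * J + 200)%N ->
     represents (d + d) J direction Delta s' initial_config ->
     tape_pos s' = 0%N -> Q t s') ->
  ok u init_prog s0 Q.
Proof.
move=> HQ.
have : ok u init_prog s0 (fun t s' => (t <= 100 * (n * d.+1) + 100 * J + 200)%N /\
     represents (d + d) J direction Delta s' initial_config).
  do 3 (apply: ok_seq; apply: ok_iset) => /=.
  set s1 := State _ _ _.
  apply: ok_seq; apply: (@ok_for _ _ (fun i s => filled i ((d + d) * i) s) _ _ _ n (60 * d + 60)).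
  - move=> i s2 F2 iltn [eq ep eoff eperm eX] ev; have [Fi2 Fr2 _] := F2.
    apply: ok_seq; apply: ok_iset; apply: ok_seq; apply: ok_iset => /=.
    rewrite !updE /= ev eq; set s3 := State _ _ _.
    apply: (@ok_for _ _ (fun k s => filled i.+1 ((d + d) * i + k + k) s) _ _ _ d 40).
    + move=> k s4 F4 kd [eq4 ep4 eoff4 eperm4 eX4] ev4; have [Fi4 Fr4 _] := F4.
      have eh : ((d + d) * i + k + k)./2 = (d * i + k)%N.
        by rewrite (_ : _ + k = (d * i + k).*2)%N ?doubleK // -addnn; nia.
      have eo : odd ((d + d) * i + k + k) = false.
        by rewrite (_ : _ + k = (d * i + k).*2)%N ?odd_double // -addnn; nia.
      apply: ok_seq; apply: ok_rset; apply: ok_seq; apply: ok_rset.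
      apply: ok_seq; apply: ok_iset; apply: ok_iset => /=; rewrite !updE /=.
      have e0 : reals s4 0%N = reals s0 0%N by rewrite Fr4 //= Fr2.
      rewrite e0 eq4 ep4 ev4; split=> //.
      have e2 : ((d + d) * i + k.+1 + k.+1 = ((d + d) * i + k + k).+2)%N by lia.
      rewrite e2; split; rewrite /= ?updE /=.
      * by rewrite addn2.
      * by rewrite addn1.
      * by move=> i' hi; rewrite !updE /= eoff4.
      * by move=> i' hi; rewrite !updE /= eperm4.
      * move=> j'; rewrite !updE /= ltnS addn1 leq_eqVlt => /orP[/eqP ->|].
          by rewrite eqxx /signed_coord /= eo /= sub0r uphalfE /= ?addn1 -?uphalfE uphalf_half eo.
        rewrite ltnS leq_eqVlt => /orP[/eqP ->|hj].
          by rewrite eqn_leq ltnn andbF eqxx /signed_coord eo.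
        by rewrite ltn_eqF ?ltn_eqF ?eX4 // ltnS ltnW.
    + by move=> k s4 [Fi4 _ _] _ _; rewrite /= Fi4 // /s3 /= !updE /= Fi2.
    + split; rewrite /= ?updE /= ?addn0 //.
      * move=> i'; rewrite !updE ltnS leq_eqVlt /= => /orP[/eqP ->|h]; first by rewrite eqxx.
        by rewrite ltn_eqF // eoff.
      * move=> i'; rewrite !updE ltnS leq_eqVlt /= => /orP[/eqP ->|h]; first by rewrite eqxx.
        by rewrite ltn_eqF // eperm.
    + move=> t4 s4 F4 ht4 [eq4 ep4 eoff4 eperm4 eX4] _; have [Fi4 Fr4 _] := F4.
      have ed : ((d + d) * i + d + d = (d + d) * i.+1)%N by rewrite mulnS; lia.
      rewrite ed in eq4 ep4 eX4.
      split; [by move: ht4; clear => /=; nia | by rewrite Fi4 //= !updE /= |].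
      by split=> //=; rewrite !updE.
  - by move=> i s2 [Fi2 _ _] _ _; rewrite /= Fi2.
  - by split; rewrite /= ?muln0.
  move=> t2 s2 [Fi2 Fr2 _] ht2 [_ _ eoff eperm eX] _.
  apply: ok_seq; apply: ok_iset; apply: ok_seq; apply: ok_rset; apply: ok_seq; apply: ok_rset.
  rewrite /= !updE /= !Fi2 //= !updE /=; set s3 := State _ _ _.
  pose Inv (s : state R) := (ints s v_J 0 <= J)%N /\
    reals s r_t 0%N = (2 ^ (2 ^ ints s v_J 0))%:R.
  have e17 : reals s3 r_N 0%N = (4 * d)%:R.
    by rewrite /s3 /= !updE /=; congr (_%:R); lia.
  apply: ok_seq; apply: (@ok_while _ _ Inv (fun s => 40 * (J - ints s v_J 0))%N).
  - move=> s4 [Fi4 Fr4 _] [hJ et] /=; rewrite (Fr4 r_N) // e17 et -ltNge ltr_nat => hlt.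
    have hJ' : (ints s4 v_J 0 < J)%N.
      by rewrite ltn_neqAle hJ andbT; apply/eqP => e; move: hlt; rewrite e ltnNge J_ge.
    apply: ok_seq; apply: ok_rset; apply: ok_iset; rewrite /Inv /= !updE /= addn1.
    split; last by move: hJ'; clear; lia.
    by split=> //; rewrite et -natrM -expnD addnn -mul2n -expnS.
  - by rewrite /Inv /s3 /= !updE /= Fi2.
  - move=> t4 s4 [Fi4 Fr4 _] [hJ et] /=; rewrite (Fr4 r_N) // e17 et -ltNge ltr_nat => hlt.
    have eJ : ints s4 v_J 0%N = J.
      by apply/eqP; rewrite eqn_leq hJ leqNgt; apply: contra hlt => /J_min.
    have e0 : ints s3 v_J 0%N = 0%N by rewrite /s3 /= !updE /= Fi2.
    have -> : (40 * (J - ints s3 v_J 0) = 40 * J)%N by rewrite e0 subn0.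
    move=> ht4.
    apply: ok_seq; apply: ok_rset; apply: ok_rset.
    split; first by move: ht2 ht4; clear; rewrite /=; nia.
    have fl : flatten (pending initial_config) = enum 'I_n by rewrite /= cats0.
    have lw : low initial_config = 0%N by rewrite /low fl size_enum_ord subnn.
    have e1 : reals s4 1 0%N = Delta by rewrite Fr4 // /s3 /= !updE /= Fr2.
    split; rewrite ?fl ?lw ?size_enum_ord //=.
    + split=> //; split=> /=.
      * by rewrite eJ !Fi4 // /s3 /= !updE /= !Fi2.
      * by move=> i; rewrite Fi4 // /s3 /= !updE /= eoff.
      * move=> i k kD; rewrite upd_other // upd_other // Fr4 // /s3 /= !upd_other // eX //.
        by have := ltn_ord i; nia.
      * by rewrite !updE /= eJ e1 (Fr4 r_N) // e17; split=> //; congr (_%:R); lia.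
    + by rewrite Fi4 // /s3 /= !updE /= Fi2.
    + rewrite val_enum_ord /slice -[RHS]map_id; apply/eq_in_map => i; rewrite mem_iota => /andP[_ hi].
      by rewrite Fi4 // /s3 /= upd_other // eperm.
    + by rewrite Fi4 // /s3 /= !updE /= size_enum_ord.
    + by rewrite Fi4 // /s3 /= upd_other // Fi2 // /s1 /= !upd_other //; apply: funext => -[].
by move=> h; apply: ok_weaken h _ => t s' [_ _ Ft] [h1 h2]; apply: HQ => //; apply: Ft.
Qed.

End InitSpec.

(** * Sizes of the two sides of a split *)

Lemma count_has_le (T U : eqType) (Q : T -> U -> bool) (ks : seq U) (p : seq T) N m :
  (forall k, k \in ks -> count (Q^~ k) p * N <= m)%N ->
  (count (fun i => has (Q i) ks) p * N <= size ks * m)%N.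
Proof.
elim: ks => [|k ks IH] h /=; first by rewrite count_pred0.
have h1 : (count (fun i => Q i k || has (Q i) ks) p <=
    count (Q^~ k) p + count (fun i => has (Q i) ks) p)%N.
  by rewrite -count_predUI leq_addr.
have h2 := h k (mem_head _ _).
have h3 : (count (fun i => has (Q i) ks) p * N <= size ks * m)%N.
  by apply: IH => k' hk; apply: h; rewrite inE hk orbT.
by move: h1 h2 h3; clear; nia.
Qed.

Section ModelFacts.
Variables (R : realType) (n D J : nat) (val : 'I_n -> nat -> R) (Delta : R).
Notation scan := (scan D J val Delta).
Notation selected := (selected D J val Delta).
Notation good := (good D J val Delta).
Notation f_above := (f_above J val Delta).
Notation threshold := (threshold J val Delta).
Notation median := (median val).
Implicit Type p : seq 'I_n.
Lemma median_above p k : (0 < size p)%N ->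
  (above val p k (median p k) * 2 <= size p)%N.
Proof.
move=> p0; rewrite /above /median; set l := coords val p k.
have sl : size (sort <=%R l) = size p by rewrite size_sort size_map.
have -> : count (fun y => nth 0 (sort <=%R l) (size p).-1./2 < y) l =
  count (fun y => nth 0 (sort <=%R l) (size p).-1./2 < y) (sort <=%R l).
  by apply/permP; rewrite perm_sym perm_sort.
set s := sort _ _ in sl *; set h := _./2.
have hh : (h < size p)%N by rewrite /h; lia.
have ss : sorted <=%R s by apply: sort_sorted; exact: le_total.
rewrite -(cat_take_drop h.+1 s) count_cat cat_take_drop.
rewrite (_ : count _ (take _ _) = 0%N); last first.
  apply/eqP; rewrite -leqn0 leqNgt -has_count; apply/hasPn => y /(nthP 0) [i].
  rewrite size_takel ?sl // => hi <-; rewrite nth_take // -leNgt.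
  by apply: (sorted_leq_nth le_trans lexx) => //; rewrite inE sl; lia.
have := count_size (fun y => s`_h < y) (drop h.+1 s).
by rewrite size_drop sl add0n /h; lia.
Qed.

Lemma median_below p k : (0 < size p)%N ->
  (size p < count (fun i => (median p k <= val i k)%R) p * 2)%N.
Proof.
move=> p0; rewrite /median; set l := coords val p k.
have sl : size (sort <=%R l) = size p by rewrite size_sort size_map.
set v := nth _ _ _.
have -> : count (fun i => v <= val i k) p = count (fun y => v <= y) (sort <=%R l).
  rewrite (_ : count _ (sort _ _) = count (fun y => v <= y) l).
    by rewrite /l /coords count_map.
  by apply/permP; rewrite perm_sort.
rewrite /v; set s := sort _ _ in sl *; set h := _./2.
have hh : (h < size p)%N by rewrite /h; lia.
have ss : sorted <=%R s by apply: sort_sorted; exact: le_total.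
rewrite -[X in count _ X](cat_take_drop h s) count_cat.
have -> : count (fun y => s`_h <= y) (drop h s) = (size p - h)%N.
  rewrite -sl -size_drop; apply/eqP; rewrite -all_count; apply/allP => y /(nthP 0) [i].
  rewrite size_drop sl => hi <-; rewrite nth_drop.
  by apply: (sorted_leq_nth le_trans lexx) => //; rewrite ?inE ?sl; lia.
by rewrite /h; lia.
Qed.

(** In each of two opposite directions more than half of the points are at or above the median, so
    some point is so in both, and its two values add up to 0. This is what bounds the extent of the
    box although it is described by one-sided conditions. *)
Lemma median_opp p k k' : (0 < size p)%N -> (forall i, val i k' = - val i k) ->
  median p k + median p k' <= 0.
Proof.
move=> p0 hk; rewrite leNgt; apply/negP => h.
have h1 := median_below k p0; have h2 := median_below k' p0.
have := count_predUI (fun i => median p k <= val i k) (fun i => median p k' <= val i k') p.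
rewrite [count (predI _ _) _](_ : _ = 0%N); last first.
  apply/eqP; rewrite -leqn0 leqNgt -has_count; apply/hasPn => i _ /=.
  by rewrite hk; apply/negP => /andP[a b]; lra.
have := count_size (predU (fun i => median p k <= val i k) (fun i => median p k' <= val i k')) p.
by move: h1 h2; clear; lia.
Qed.

Hypothesis Delta_gt0 : 0 < Delta.
Hypothesis D_gt0 : (0 < D)%N.
Hypothesis J_gt0 : (0 < J)%N.
Hypothesis J_ge : (D + D <= 2 ^ (2 ^ J))%N.

Lemma window_gt0 : 0 < window J Delta.
Proof. by rewrite divr_gt0 // ltr0n; lia. Qed.

Lemma window_quarter : window J Delta *+ J = quarter Delta.
Proof.
rewrite -mulr_natr /window /quarter (_ : (J + J + J + J)%N = (4 * J)%N); last lia.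
have h : J%:R != 0 :> R by rewrite pnatr_eq0; lia.
by rewrite natrM; field.
Qed.

Lemma f_aboveE p k j : f_above p k j = count (fun i => threshold p k j < val i k) p.
Proof. by rewrite /f_above /above /coords count_map. Qed.

Lemma f_above_anti p k j : (f_above p k j.+1 <= f_above p k j)%N.
Proof.
rewrite !f_aboveE; apply: sub_count => i /=; apply: le_lt_trans.
by rewrite /threshold mulrSr addrA lerDl ltW // window_gt0.
Qed.

Lemma f_above_half p k j : (0 < size p)%N -> (f_above p k j * 2 <= size p)%N.
Proof.
move=> p0; elim: j => [|j IH].
  by apply: leq_trans (median_above k p0); rewrite /f_above /threshold mulr0n addr0.
by apply: leq_trans IH; rewrite leq_mul2r f_above_anti.
Qed.

Lemma goodE p k j : good p k j =
  (size p <= (D + D) * f_above p k j.+1)%N &&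
  (f_above p k j * f_above p k j <= size p * f_above p k j.+1)%N.
Proof. by rewrite /good -!natrM !ler_nat. Qed.

(* As long as no window is good the fraction above the threshold is squared at
   each step, so that after J steps it is at most 1 / (2 D). *)
Lemma f_above_last p k : (0 < size p)%N -> scan p = None -> (k < D)%N ->
  (f_above p k J * (D + D) <= size p)%N.
Proof.
move=> p0 sp kD.
have hg j : (j < J)%N -> good p k j = false by move=> jJ; apply: (scan_none sp).
have claim j : (j <= J)%N -> (f_above p k j * (D + D) <= size p)%N \/
    (f_above p k j * 2 ^ (2 ^ j) <= size p)%N.
  elim: j => [|j IH] jJ; first by right; rewrite expn0; apply: f_above_half.
  have ha := f_above_anti p k j.
  case: (IH (ltnW jJ)) => h1; first by left; move: h1 ha; clear; nia.
  have := hg j jJ; rewrite goodE => /negbT; rewrite negb_and -!ltnNge => /orP[h2|h2].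
    by left; lia.
  right; rewrite expnS mul2n -addnn expnD.
  move: h1 h2 ha p0; clear; move: (f_above _ _ _) (f_above _ _ _) (2 ^ _)%N (size p) => a b e m.
  move=> h1 h2 ha p0.
  have h3 : (m * a * (e * e) <= m * m)%N by nia.
  by rewrite -(leq_pmul2l p0) mulnA.
case: (claim J (leqnn J)) => // h; apply: leq_trans h.
by rewrite leq_mul2l J_ge orbT.
Qed.

Lemma outside_box p u : (0 < size p)%N -> scan p = None -> 0 <= u ->
  (size [seq i <- p | ~~ selected p u i] * 2 <= size p)%N.
Proof.
move=> p0 sp u0; rewrite size_filter.
(* Union bound: each of the D directions has at most a fraction 1 / (2 D) of the points beyond the
   last window, together at most half. *)
have h1 : (count (fun i => has (fun k => (threshold p k J < val i k)%R) (iota 0 D)) p * (D + D)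
    <= size (iota 0 D) * size p)%N.
  apply: count_has_le => k; rewrite mem_iota add0n /= => kD.
  by rewrite -f_aboveE f_above_last.
have h2 : (count (fun i => ~~ selected p u i) p <=
   count (fun i => has (fun k => (threshold p k J < val i k)%R) (iota 0 D)) p)%N.
  apply: sub_count => i /=; rewrite /selected sp /in_box -has_predC.
  apply: sub_has => k /=; rewrite -ltNge /threshold window_quarter => h.
  have q0 : 0 < quarter Delta by rewrite divr_gt0.
  by rewrite -ltrBrDl; apply: le_lt_trans h; rewrite mulrDr mulr1 lerDl mulr_ge0 // ltW.
rewrite size_iota in h1; move: h1 h2 D_gt0; clear; nia.
Qed.

(** Beyond the outer end of the window the ramp is 1, so every [u <= 1] selects the point; short of
    the inner end the sign test rejects it. *)
Lemma light_size p k j u : scan p = Some (k, j) -> 0 <= u <= 1 ->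
  (f_above p k j.+1 <= size [seq i <- p | selected p u i] <= f_above p k j)%N.
Proof.
move=> sp /andP[u0 u1]; rewrite size_filter !f_aboveE /selected sp.
apply/andP; split; apply: sub_count => i /=; rewrite /in_light; last first.
  by rewrite subr_gt0 => /andP[].
have w0 := window_gt0.
rewrite /threshold mulrSr addrA -/(threshold p k j) => h.
rewrite subr_gt0 (le_lt_trans _ h) ?lerDl ?(ltW w0) //=.
rewrite (_ : ramp _ _ _ _ _ _ _ = 1) ?mulr1 ?expr1n //.
by rewrite /ramp; rewrite min_l // ler_pdivlMr // mul1r; lra.
Qed.

Lemma splits_size p u : (0 < size p)%N -> 0 <= u <= 1 -> splits D J val Delta p u.
Proof.
move=> p0 u01; rewrite /splits.
have h : (size [seq i <- p | selected p u i] + size [seq i <- p | ~~ selected p u i] =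
  size p)%N by rewrite !size_filter count_predC.
case sp: (scan p) => [[k j]|]; last first.
  have /andP[u0 _] := u01; have := outside_box p0 sp u0; split=> //; lia.
have [kD jJ hg] := scan_some sp; have f0 := good_above hg p0.
have := light_size sp u01; have := f_above_half k j p0.
move: h p0 f0; clear; lia.
Qed.

End ModelFacts.

Lemma ln2_ge (R : realType) : 2^-1 <= ln 2 :> R.
Proof.
have h : - 1 < - 2^-1 :> R by lra.
have := le_ln1Dx h; rewrite (_ : 1 + - 2^-1 = 2^-1); last by field.
by rewrite lnV ?posrE //; lra.
Qed.

Lemma ln_sub_ge (R : realType) (a b : R) : 0 <= a -> a < b -> ln (b - a) <= ln b - a / b.
Proof.
move=> a0 ab; have b0 : 0 < b by lra.
have h : -1 < - (a / b) by rewrite ltrN2 ltr_pdivrMr // mul1r.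
have := le_ln1Dx h; rewrite (_ : 1 + - (a / b) = (b - a) / b); last by field; lra.
by rewrite ln_div ?posrE; lra.
Qed.

(** * Running time *)

Section Validity.
Variables (R : realType) (n D J : nat) (val : 'I_n -> nat -> R) (Delta : R).
Notation scan := (scan D J val Delta).
Notation selected := (selected D J val Delta).
Notation step := (step D J val Delta).
Notation median := (median val).
Implicit Type p : seq 'I_n.
Hypothesis Delta_gt0 : 0 < Delta.
Hypothesis D_gt0 : (0 < D)%N.
Hypothesis J_gt0 : (0 < J)%N.
Hypothesis J_ge : (D + D <= 2 ^ (2 ^ J))%N.
Hypothesis val_opp : forall k, (k < D)%N ->
  exists2 k', (k' < D)%N & forall i, val i k' = - val i k.

(** The third clause keeps all labels in use below [low c], the label of the next cluster, so a new
    cluster never merges with an old one. The last clause is the diameter bound for points that are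
    no longer pending. *)
Definition valid (c : config n) :=
  [/\ all (fun p => 0 < size p)%N (pending c), uniq (flatten (pending c)),
    forall i : 'I_n, i \notin flatten (pending c) -> (label c i < low c)%N &
    forall i i' : 'I_n, i \notin flatten (pending c) -> i' \notin flatten (pending c) ->
      label c i = label c i' -> forall k, (k < D)%N -> val i k - val i' k <= Delta].

Lemma valid_initial : (0 < n)%N -> valid (Config [:: enum 'I_n] (fun=> 0%N)).
Proof.
move=> n0; split=> /=; rewrite ?cats0 ?enum_uniq ?size_enum_ord ?n0 //.
  by move=> i; rewrite mem_enum.
by move=> i i'; rewrite mem_enum.
Qed.

Lemma valid_splits c p ps u : valid c -> pending c = p :: ps -> 0 <= u <= 1 ->
  splits D J val Delta p u.
Proof.
case=> h _ _ _ ec u01; rewrite ec /= in h; case/andP: h => p0 _.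
exact: splits_size.
Qed.

(** Direction k bounds i and the opposite direction bounds i'. The sum of the two medians is at most
    0 by [median_opp], and at most four quarters of Delta remain. *)
Lemma box_diameter p u i i' : (0 < size p)%N -> u <= 1 ->
  in_box D val Delta p u i -> in_box D val Delta p u i' ->
  forall k, (k < D)%N -> val i k - val i' k <= Delta.
Proof.
move=> p0 u1 /allP hi /allP hi' k kD; have [k' kD' hk'] := val_opp kD.
have h1 := hi k; have h2 := hi' k'.
rewrite mem_iota /= add0n kD in h1; rewrite mem_iota /= add0n kD' hk' in h2.
have h3 := median_opp p0 hk'.
have q0 : 0 <= quarter Delta by rewrite divr_ge0 // ltW.
have h4 : quarter Delta * (1 + u) <= quarter Delta * 2.
  by rewrite ler_wpM2l //; lra.
have h5 : quarter Delta * 4 = Delta by rewrite /quarter; field.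
by have := h1 isT; have := h2 isT; lra.
Qed.

Lemma pending_step c p ps u : pending c = p :: ps ->
  perm_eq (flatten (pending (step c u)))
    ((if scan p then [seq i <- p | selected p u i] else [::]) ++
     [seq i <- p | ~~ selected p u i] ++ flatten ps).
Proof.
move=> ec; rewrite /step ec /next_config ec /=.
case: (scan p) => [_|] //=.
by case: [seq _ <- _ | _].
Qed.

Lemma valid_step c p ps u : valid c -> pending c = p :: ps -> 0 <= u <= 1 ->
  valid (step c u).
Proof.
move=> vc ec u01; have sp := valid_splits vc ec u01.
have [h1 h2 h3 h4] := vc; rewrite ec /= in h1 h2 h3 h4.
have p0 : (0 < size p)%N by case/andP: h1.
case/andP: h1 => _ h1.
set A := [seq i <- p | selected p u i]; set B := [seq i <- p | ~~ selected p u i].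
have pAB : perm_eq p (A ++ B) by rewrite perm_sym perm_filterC.
have pAll : perm_eq (p ++ flatten ps) (A ++ B ++ flatten ps).
  by rewrite catA perm_cat2r.
have szn : (size (p ++ flatten ps) <= n)%N.
  by rewrite -(card_uniqP h2) -[X in (_ <= X)%N]card_ord max_card.
case: sp; rewrite -/A -/B => A0; case es: (scan p) => [kj|] B0.
  have en : step c u = Config (A :: B :: ps) (label c).
    by rewrite /step ec /= /next_config ec /= es.
  have mem i : (i \in flatten (pending (step c u))) = (i \in p ++ flatten ps).
    by rewrite en /= (perm_mem pAll).
  have elow : low (step c u) = low c.
    by rewrite en /low ec /= (perm_size pAll).
  split.
  - by rewrite en /= A0 B0.
  - by rewrite en /= -(perm_uniq pAll).
  - by move=> i; rewrite mem elow en /=; apply: h3.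
  - by move=> i i'; rewrite !mem en /=; apply: h4.
pose B' := if B is [::] then ps else B :: ps.
have en : step c u = Config B' (fun i => if i \in [seq nat_of_ord a | a <- A] then low c else label c i).
  by rewrite /step ec /= /next_config ec /= es.
have fB : flatten (pending (step c u)) = B ++ flatten ps.
  by rewrite en /= /B'; case: (B).
have elow : low (step c u) = (low c + size A)%N.
  rewrite /low fB ec /=; move: szn (perm_size pAll); rewrite !size_cat.
  by move: (size p) (size A) (size B) (size (flatten ps)) => a b e f; clear; lia.
have mem i : i \notin flatten (pending (step c u)) ->
    (i \in A) || (i \notin p ++ flatten ps).
  by rewrite fB (perm_mem pAll) (mem_cat i A) => /negbTE ->; rewrite orbF orbN.
have lab (i : 'I_n) : label (step c u) i = if i \in A then low c else label c i.
  by rewrite en /= mem_map //; apply: ord_inj.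
split.
- by rewrite en /B'; case: (B) => //= b B1; rewrite h1.
- by rewrite fB; move: h2; rewrite (perm_uniq pAll) cat_uniq => /and3P[].
- move=> i /mem; rewrite lab elow; case: ifP => [_ _|_ /= /h3]; lia.
- move=> i i' /mem hi /mem hi'; rewrite !lab.
  case: ifP hi => iA /= hi; case: ifP hi' => iA' /= hi'.
  + move=> _; move: iA iA'; rewrite !mem_filter /selected es => /andP[bi _] /andP[bi' _].
    by apply: box_diameter bi bi' => //; case/andP: u01.
  + by move=> e; have := h3 _ hi'; rewrite -e ltnn.
  + by move=> e; have := h3 _ hi; rewrite e ltnn.
  + exact: h4.
Qed.

(* The potential of the running time: a split of m points lowers it by m. *)
Definition weight (m : nat) : R := m%:R * (1 + (D + D)%:R * ln m%:R).
Definition total_weight (ps : seq (seq 'I_n)) : R := \sum_(p <- ps) weight (size p).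

Lemma weight_ge0 m : 0 <= weight m.
Proof.
case: m => [|m]; first by rewrite /weight mul0r.
by rewrite mulr_ge0 // addr_ge0 // mulr_ge0 // ln_ge0 // ler1n.
Qed.

(** Each of the b remaining points saves 2 D ln (m / b) >= 2 D ln 2 >= 1, and each of the m - b
    others gives up at least 2 D ln m >= 1. *)
Lemma weight_half b m : (b * 2 <= m)%N ->
  m%:R + weight b <= weight m.
Proof.
move=> bm; case: (posnP b) => [->|b0].
  rewrite /weight mul0r addr0 mulrDr mulr1 lerDl.
  by case: m {bm} => [|m]; rewrite ?mul0r // !mulr_ge0 // ln_ge0 // ler1n.
have m0 : (0 < m)%N by lia.
have h1 : ln b%:R <= ln m%:R - ln 2 :> R.
  rewrite lerBrDr -lnM ?posrE ?ltr0n // ler_ln ?posrE ?mulr_gt0 ?ltr0n //.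
  by rewrite -natrM ler_nat.
have h2 := ln2_ge R.
have hD : 2 <= (D + D)%:R :> R by rewrite ler_nat; lia.
have hm : (2 * b%:R <= m%:R :> R) by rewrite -natrM ler_nat mulnC.
have hb : 1 <= b%:R :> R by rewrite ler1n.
have lb : 0 <= ln b%:R :> R by rewrite ln_ge0.
have hN : 1 <= (D + D)%:R * (ln m%:R - ln b%:R) :> R.
  by apply: (@le_trans _ _ (2 * 2^-1)); [rewrite mulfV //| apply: ler_pM => //; lra].
rewrite /weight.
have h3 : b%:R * 1 <= b%:R * ((D + D)%:R * (ln m%:R - ln b%:R)) :> R.
  by rewrite ler_wpM2l // ler0n.
have h4 : b%:R * ((D + D)%:R * ln m%:R) <= m%:R * ((D + D)%:R * ln m%:R) :> R.
  rewrite ler_wpM2r // ?mulr_ge0 //; last by rewrite ler_nat; lia.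
  by apply: le_trans lb _; lra.
have h5 : (m%:R - b%:R) * (1 * 1) <= (m%:R - b%:R) * ((D + D)%:R * ln m%:R) :> R.
  rewrite ler_wpM2l //; first by lra.
  by rewrite mulr1; apply: le_trans hN _; rewrite ler_wpM2l //; lra.
by move: h3 h5; rewrite !mulrBr !mulrBl; lra.
Qed.

(** Each side lowers m ln m by a / 2: the light one because ln 2 >= 1/2, the heavy one because ln (1
    - a / m) <= - a / m and b >= m / 2. The factor 2 D in [weight] turns this drop of a >= f into at
    least m. *)
Lemma weight_cut a b m f : (a + b = m)%N -> (f <= a)%N -> (a * 2 <= m)%N ->
  (0 < f)%N -> (m <= (D + D) * f)%N -> m%:R + weight a + weight b <= weight m.
Proof.
move=> abm fa am f0 mf.
have a0 : (0 < a)%N by lia.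
have b0 : (0 < b)%N by lia.
have ha : ln a%:R <= ln m%:R - ln 2 :> R.
  rewrite lerBrDr -lnM ?posrE ?ltr0n // ler_ln ?posrE ?mulr_gt0 ?ltr0n //; last lia.
  by rewrite -natrM ler_nat.
have eb : b%:R = m%:R - a%:R :> R by rewrite -abm natrD; ring.
have am' : a%:R < m%:R :> R by rewrite ltr_nat; lia.
have hb : ln b%:R <= ln m%:R - a%:R / m%:R :> R by rewrite eb; apply: ln_sub_ge.
have h2 := ln2_ge R.
have m0 : 0 < m%:R :> R by rewrite ltr0n; lia.
have hb2 : m%:R / 2 <= b%:R :> R.
  by rewrite ler_pdivrMr // -natrM ler_nat; lia.
have hN : m%:R <= (D + D)%:R * a%:R :> R.
  by rewrite -natrM ler_nat; apply: leq_trans mf _; rewrite leq_mul2l fa orbT.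
set N := (D + D)%:R in hN *.
have N0 : 0 <= N by rewrite ler0n.
have e1 : a%:R / 2 <= b%:R * (a%:R / m%:R) :> R.
  have -> : b%:R * (a%:R / m%:R) = (b%:R / m%:R) * a%:R :> R by rewrite mulrA mulrAC.
  rewrite mulrC ler_wpM2r ?ler0n // ler_pdivlMr //; lra.
have e2 : b%:R * ln b%:R <= b%:R * ln m%:R - a%:R / 2 :> R.
  apply: le_trans (_ : b%:R * (ln m%:R - a%:R / m%:R) <= _).
    by rewrite ler_wpM2l // ler0n.
  by rewrite mulrBr; lra.
have e3 : a%:R * ln a%:R <= a%:R * ln m%:R - a%:R / 2 :> R.
  apply: le_trans (_ : a%:R * (ln m%:R - 2^-1) <= _).
    by rewrite ler_wpM2l ?ler0n //; lra.
  by rewrite mulrBr.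
have e4 : N * (a%:R * ln a%:R + b%:R * ln b%:R) <= N * (m%:R * ln m%:R - a%:R).
  by rewrite ler_wpM2l //; move: e2 e3; rewrite eb; lra.
rewrite /weight -/N.
have em : m%:R = a%:R + b%:R :> R by rewrite eb; ring.
move: e4; move: (ln _) (ln _) (ln _) N hN N0 => la lb lm N hN N0.
by rewrite em; nra.
Qed.

Lemma total_weight_step c p ps u : valid c -> pending c = p :: ps -> 0 <= u <= 1 ->
  (size p)%:R + total_weight (pending (step c u)) <= total_weight (pending c).
Proof.
move=> vc ec u01; have [A0 B0] := valid_splits vc ec u01.
have [h1 _ _ _] := vc; rewrite ec /= in h1; case/andP: h1 => p0 _.
rewrite /step ec /= /next_config ec.
set A := [seq i <- p | selected p u i] in A0 *.
set B := [seq i <- p | ~~ selected p u i] in B0 *.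
have szAB : (size A + size B = size p)%N by rewrite !size_filter count_predC.
case es: (scan p) B0 => [[k j]|] B0.
  have [kD jJ hg] := scan_some es; have f0 := good_above hg p0.
  have /andP[f1 f2] := light_size Delta_gt0 D_gt0 J_gt0 J_ge es u01.
  rewrite /total_weight /= !big_cons !addrA lerD2r.
  apply: weight_cut f1 _ f0 _ => //.
    apply: leq_trans (f_above_half val Delta_gt0 D_gt0 J_gt0 J_ge k j p0).
    by rewrite leq_mul2r f2 orbT.
  by move: hg; rewrite goodE => /andP[].
have hB := outside_box Delta_gt0 D_gt0 J_gt0 J_ge p0 es (proj1 (andP u01)).
have hw := weight_half hB.
rewrite /total_weight /= big_cons -/B; rewrite -/B in hw.
case eB: (B) hw => [|b B1] /= hw.
  rewrite lerD2r; apply: le_trans hw; rewrite lerDl; exact: weight_ge0.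
by rewrite big_cons addrA lerD2r.
Qed.

(** 3020 is the 3000 of [step_cost] plus the constant 20 per round of the main loop, which is
    absorbed because a pending segment has at least one point. *)
Lemma run_cost_le lg fuel c (us : nat -> R) pos : valid c -> unit_tape us ->
  (run_cost D J lg val Delta fuel c us pos)%:R <=
  (3020 * (D.+1 * (lg + J + 1)))%:R * total_weight (pending c) + 20 :> R.
Proof.
move=> + hu; set K := (3020 * _)%N.
have hw ps : 0 <= total_weight ps by apply: sumr_ge0 => q _; apply: weight_ge0.
have hK ps : 0 <= K%:R * total_weight ps by rewrite mulr_ge0.
elim: fuel c pos => [|fuel IH] c pos vc /=; first by rewrite lerDr.
case ec: (pending c) => [|p ps]; first by rewrite lerDr.
have hs := total_weight_step vc ec (hu pos); rewrite ec in hs.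
have {}IH := IH _ pos.+1 (valid_step vc ec (hu pos)).
have [h1 _ _ _] := vc; rewrite ec /= in h1; case/andP: h1 => p0 _.
have hc : (step_cost D J lg (size p) + 20 <= K * size p)%N.
  rewrite /step_cost /K; move: p0; clear; nia.
rewrite natrD; move: hc; rewrite -(ler_nat R) natrM => hc.
have := ler_wpM2l (ler0n R K) hs; rewrite mulrDr.
by lra.
Qed.

End Validity.

Lemma measure_finType_partition d (T : measurableType d) (R : realType)
    (mu : {measure set T -> \bar R}) (L : finType) (F : L -> set T) :
  (forall l, measurable (F l)) -> trivIset setT F ->
  mu (\bigcup_l F l)%classic = (\sum_(l : L) mu (F l))%E.
Proof.
move=> mF tF.
have eT : [set: L]%classic = [set` enum L]%classic.
  by apply/seteqP; split=> l //= _; rewrite mem_enum.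
rewrite eT in tF *; rewrite measure_fin_bigcup //.
by rewrite -fsbig_seq ?enum_uniq // big_enum.
Qed.

(** * Random choices *)

Definition prob01 (R : realType) (B : set R) : R := fine (uniform_prob (@ltr01 R) B).

Section Chain.
Variables (R : realType) (St : Type) (L T : finType).
Variables (choice : St -> R -> L) (nxt : St -> L -> St) (stop : St -> bool) (out : St -> T).
Hypothesis choice_measurable : forall c l, measurable [set v | choice c v = l]%classic.

(** An adaptive process that looks at each fresh number only through a label in the finite type [L].
    Its law is therefore a finite tree of branch probabilities. *)
Fixpoint chain fuel c (us : nat -> R) pos : St :=
  if fuel is fuel'.+1 then
    if stop c then c else chain fuel' (nxt c (choice c (us pos))) us pos.+1
  else c.

Definition branch_prob c l : R := prob01 [set v | choice c v = l]%classic.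

Fixpoint law fuel c (Q : T) : R :=
  if fuel is fuel'.+1 then
    if stop c then (out c == Q)%:R
    else \sum_(l : L) branch_prob c l * law fuel' (nxt c l) Q
  else (out c == Q)%:R.

Section Independence.
Variables (disp : measure_display) (Omega : measurableType disp) (P : probability Omega R)
  (U : nat -> {RV P >-> R}).
Hypothesis U_iid : iid_uniform U.

Let cylinder pos (B : nat -> set R) : set Omega :=
  [set w | forall m, (m < pos)%N -> B m (U m w)]%classic.

Lemma cylinder_prob pos (B : nat -> set R) :
  (forall m, (m < pos)%N -> measurable (B m)) ->
  measurable (cylinder pos B) /\
  P (cylinder pos B) = (\prod_(m < pos) prob01 (B m))%:E.
Proof.
move=> mB; have [_ hd hi] := U_iid; split.
  have -> : cylinder pos B = (\bigcap_(m < pos) (U m @^-1` B m))%classic by [].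
  apply: fin_bigcap_measurable; first exact: finite_II.
  by move=> m mp; apply: measurable_funPTI; apply: mB.
have := hi (iota 0 pos) B (iota_uniq _ _).
have eE : [set w | forall m, m \in iota 0 pos -> B m (U m w)]%classic = cylinder pos B.
  by apply/seteqP; split=> w /= h m; have := h m; rewrite mem_iota add0n.
rewrite eE => ->; last by move=> m; rewrite mem_iota add0n; apply: mB.
rewrite -prodEFin -(big_mkord xpredT (fun m => (prob01 (B m))%:E)) /index_iota subn0.
rewrite big_seq [RHS]big_seq; apply: eq_bigr => m; rewrite mem_iota add0n /= => mp.
rewrite /prob01 fineK; last by apply: fin_num_measure; apply: mB.
by rewrite -(hd m) //; apply: mB.
Qed.

(** The cylinder records the constraints that earlier choices put on the numbers already read.
    Without it the induction could not use independence, since the current state depends on those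
    numbers. *)
Lemma chain_cylinder_prob fuel c pos (B : nat -> set R) Q :
  (forall m, (m < pos)%N -> measurable (B m)) ->
  let E := (cylinder pos B `&`
    [set w | out (chain fuel c (fun m => U m w) pos) = Q])%classic in
  measurable E /\ P E = ((\prod_(m < pos) prob01 (B m)) * law fuel c Q)%:E.
Proof.
have leaf c' pos' B' : (forall m, (m < pos')%N -> measurable (B' m)) ->
    let E := (cylinder pos' B' `&` [set w | out c' = Q])%classic in
    measurable E /\ P E = ((\prod_(m < pos') prob01 (B' m)) * (out c' == Q)%:R)%:E.
  move=> mB' /=; have [h1 h2] := cylinder_prob mB'.
  case: eqP => hQ.
    have -> : [set w : Omega | out c' = Q]%classic = setT by apply/seteqP; split.
    by rewrite setIT mulr1.
  have -> : [set w : Omega | out c' = Q]%classic = set0 by apply/seteqP; split.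
  by rewrite setI0 mulr0 measure0.
elim: fuel c pos B => [|fuel IH] c pos B mB /=; first exact: leaf.
case: ifP => _; first exact: leaf.
(* Fixing the label at position [pos] gives a cylinder with one more coordinate; over all labels
   these partition the event. *)
pose B' l m := if m == pos then [set v | choice c v = l]%classic else B m.
have mB' l m : (m < pos.+1)%N -> measurable (B' l m).
  rewrite ltnS leq_eqVlt /B'; case: eqP => //= _ h; exact: mB.
pose F l := (cylinder pos.+1 (B' l) `&`
    [set w | out (chain fuel (nxt c l) (fun m => U m w) pos.+1) = Q])%classic.
have hF l := IH (nxt c l) pos.+1 (B' l) (mB' l).
have cylE l w : cylinder pos.+1 (B' l) w <-> cylinder pos B w /\ choice c (U pos w) = l.
  split=> [h|[h1 h2] m].
    split; last by have := h pos (ltnSn _); rewrite /B' eqxx.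
    by move=> m mp; have := h m (ltnW mp); rewrite /B' ltn_eqF.
  by rewrite ltnS leq_eqVlt /B'; case: eqP => [-> //|_ /=]; apply: h1.
have -> : (cylinder pos B `&`
    [set w | out (chain fuel (nxt c (choice c (U pos w))) (fun m => U m w) pos.+1) = Q])%classic
    = (\bigcup_l F l)%classic.
  apply/seteqP; split=> w /=.
    by case=> h1 h2; exists (choice c (U pos w)) => //; split=> //; apply/cylE.
  by case=> l _ [/cylE [h1 <-] h2]; split.
have tF : trivIset setT F.
  apply/trivIsetP => l l' _ _ /eqP nl; apply/seteqP; split=> w //=.
  by case=> -[/cylE [_ h1] _] [/cylE [_ h2] _]; apply: nl; rewrite -h1 -h2.
split; first by apply: fin_bigcup_measurable => // l _; case: (hF l).
rewrite measure_finType_partition //; last by move=> l; case: (hF l).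
rewrite mulr_sumr -sumEFin; apply: eq_bigr => l _.
apply: etrans (proj2 (hF l)) _; congr EFin; rewrite big_ord_recr /= mulrA; congr (_ * _ * _).
  by apply: eq_bigr => m _; rewrite /B' ltn_eqF.
by rewrite /B' eqxx.
Qed.

Lemma chain_prob fuel c Q :
  let E := [set w | out (chain fuel c (fun m => U m w) 0) = Q]%classic in
  measurable E /\ P E = (law fuel c Q)%:E.
Proof.
have [] := @chain_cylinder_prob fuel c 0 (fun=> setT) Q; first by [].
have -> : cylinder 0 (fun=> setT) = setT by apply/seteqP; split.
by rewrite setTI big_ord0 mul1r.
Qed.

End Independence.

Lemma prob01_ge0 B : 0 <= prob01 B :> R.
Proof. by apply: fine_ge0; apply: measure_ge0. Qed.

Lemma sum_branch_prob_inter c (B : set R) : measurable B ->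
  \sum_(l : L) prob01 ([set v | choice c v = l] `&` B)%classic = prob01 B.
Proof.
move=> mB; apply: EFin_inj; rewrite -sumEFin.
have mI l : measurable ([set v | choice c v = l] `&` B)%classic by apply: measurableI.
have hfin A : measurable A -> (prob01 A)%:E = uniform_prob (@ltr01 R) A.
  by move=> mA; rewrite /prob01 fineK //; apply: fin_num_measure.
rewrite hfin //; under eq_bigr do rewrite hfin //.
rewrite -measure_finType_partition //; last first.
  apply/trivIsetP => l l' _ _ /eqP nl; apply/seteqP; split=> w //=.
  by case=> -[h1 _] [h2 _]; apply: nl; rewrite -h1 -h2.
congr (uniform_prob _); apply/seteqP; split=> v /=; first by case=> l _ [].
by move=> hv; exists (choice c v).
Qed.

Lemma prob01_setT : prob01 setT = 1 :> R.
Proof. by rewrite /prob01 probability_setT. Qed.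

Lemma sum_branch_prob c : \sum_(l : L) branch_prob c l = 1.
Proof.
rewrite -prob01_setT -(sum_branch_prob_inter c) //.
by apply: eq_bigr => l _; rewrite setIT.
Qed.

Lemma law_ge0 fuel c Q : 0 <= law fuel c Q.
Proof.
elim: fuel c => [|fuel IH] c /=; first exact: ler0n.
case: ifP => _; first exact: ler0n.
by apply: sumr_ge0 => l _; rewrite mulr_ge0 // prob01_ge0.
Qed.

Lemma law_sum1 fuel c : \sum_Q law fuel c Q = 1.
Proof.
have leaf c' : \sum_(Q : T) (out c' == Q)%:R = 1 :> R.
  rewrite (bigD1 (out c')) //= eqxx big1 ?addr0 // => Q.
  by rewrite eq_sym => /negbTE ->.
elim: fuel c => [|fuel IH] c /=; first exact: leaf.
case: (stop c); first exact: leaf.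
rewrite exchange_big /= -(sum_branch_prob c); apply: eq_bigr => l _.
by rewrite -mulr_sumr IH mulr1.
Qed.

End Chain.

Lemma log_ratio_spec m f : (0 < f)%N ->
  (m <= 2 ^ log_ratio m f * f)%N /\
  (forall i, (i < log_ratio m f)%N -> (2 ^ i * f < m)%N).
Proof.
move=> f0; have ex : exists i, (m <= 2 ^ i * f)%N.
  by exists m; have := ltn_expl m (isT : 1 < 2)%N; nia.
case: (ex_minnP ex) => b hb hmin.
have hlt i : (i < b)%N -> (2 ^ i * f < m)%N.
  by move=> ib; rewrite ltnNge; apply/negP => /hmin; rewrite leqNgt ib.
by rewrite (log_ratioE f0 hlt hb).
Qed.

(** * Padding *)

Section Numeric.
Variable R : realType.

Definition clip (z : R) : R := Num.max 0 (Num.min 1 z).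

Lemma clip_ge0 z : 0 <= clip z.
Proof. by rewrite /clip le_max lexx. Qed.

Lemma clip_le1 z : clip z <= 1.
Proof. by rewrite /clip ge_max ler01 ge_min lexx. Qed.

Lemma clip_le y z : y <= z -> clip y <= clip z.
Proof.
by move=> yz; rewrite /clip ge_max !le_max lexx /= le_min !ge_min lexx yz !orbT.
Qed.

Lemma clip_sub y z e : z <= y + e -> 0 <= e -> clip z - clip y <= e.
Proof.
move=> yz e0; rewrite lerBlDr {1}/clip ge_max addr_ge0 ?clip_ge0 //=.
apply: le_trans (_ : e + Num.min 1 y <= _); last by rewrite lerD2l le_max lexx orbT.
case: (leP 1 y) => h1; first by rewrite ge_min lerDr e0.
by rewrite ge_min addrC yz orbT.
Qed.

(** A mean value bound: on [s, t] the slope of the power is largest at t. *)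
Lemma expr_sub_le (s t e : R) r : 0 <= s -> s <= t -> t - s <= e ->
  t ^+ r.+1 - s ^+ r.+1 <= r.+1%:R * e * t ^+ r.
Proof.
move=> s0 st te; elim: r => [|r IH]; first by rewrite expr0 !expr1 !mul1r mulr1.
have t0 : 0 <= t by apply: le_trans st.
rewrite (_ : t ^+ r.+2 - s ^+ r.+2 = t * (t ^+ r.+1 - s ^+ r.+1) + (t - s) * s ^+ r.+1);
  last by rewrite !(exprS _ r.+1); ring.
have h1 : t * (t ^+ r.+1 - s ^+ r.+1) <= t * (r.+1%:R * e * t ^+ r) by rewrite ler_wpM2l.
have h2 : (t - s) * s ^+ r.+1 <= e * t ^+ r.+1.
  apply: ler_pM => //; [by rewrite subr_ge0|exact: exprn_ge0|].
  by apply: lerXn2r; rewrite ?nnegrE.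
rewrite -[r.+2]addn1 natrD; move: h1 h2; rewrite (exprS t r).
by move: (t ^+ r) => T; nra.
Qed.

(* Lower bound for the probability that a ball inside a set of m points survives. *)
Definition decay (a : R) (m : nat) : R := expR (- (a * (1 + ln m%:R))).

Lemma decay_anti a m m' : 0 <= a -> (0 < m)%N -> (m <= m')%N -> decay a m' <= decay a m.
Proof.
move=> a0 m0 mm'; rewrite /decay ler_expR lerN2 ler_wpM2l // lerD2l.
by rewrite ler_ln ?posrE ?ltr0n // ?ler_nat //; apply: leq_trans mm'.
Qed.

(** By exp y >= 1 + y, a drop of e in the logarithm is worth a factor 1 + a e; this makes the
    inequalities below linear in the gains. *)
Lemma decay_gain a m m' e : 0 <= a -> ln m'%:R <= ln m%:R - e :> R ->
  decay a m * (1 + a * e) <= decay a m'.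
Proof.
move=> a0 h; apply: le_trans (_ : decay a m * expR (a * e) <= _).
  by rewrite ler_wpM2l ?expR_ge0 // expR_ge1Dx.
rewrite /decay -expRD ler_expR; have := ler_wpM2l a0 h.
by rewrite !mulrDr mulr1 mulrN; lra.
Qed.

(* Where the power of the ramp is still large it decreases by a factor
   1 - O(gamma) and the light side gains ln (m / f); where it is small the
   heavy side, which loses f' points, pays. *)
Lemma cut_bound (m f f' : nat) (jg s t : R) :
  let b := log_ratio m f' in let a := 48 * jg in
  (0 < f')%N -> (f' <= f)%N -> (f * 2 <= m)%N -> (f * f <= m * f')%N ->
  0 <= jg -> (2 * b)%:R * jg <= 4^-1 ->
  0 <= s -> s <= t -> t <= 1 -> t - s <= jg ->
  decay a m <= s ^+ (2 * b) * decay a f + (1 - t ^+ (2 * b)) * decay a (m - f').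
Proof.
move=> b a f'0 f'f fm ff jg0 hr s0 st t1 ts.
have m0 : (0 < m)%N by lia.
have f'm : (f' < m)%N by lia.
have [hb1 hb2] := log_ratio_spec m f'0; rewrite -/b in hb1 hb2.
have b0 : (0 < b)%N.
  by rewrite lt0n; apply/eqP => e; move: hb1; rewrite e expn0 mul1n leqNgt f'm.
have ea : a = 48 * jg by [].
have a0 : 0 <= a by rewrite ea mulr_ge0.
pose L : R := ln m%:R - ln f%:R.
pose z : R := f'%:R / m%:R.
have mR : 0 < m%:R :> R by rewrite ltr0n.
have fR : 0 < f%:R :> R by rewrite ltr0n; apply: leq_trans f'f.
have f'R : 0 < f'%:R :> R by rewrite ltr0n.
have z0 : 0 <= z by rewrite divr_ge0 // ltW.
have l2 := ln2_ge R.
have L2 : ln 2 <= L.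
  rewrite /L lerBrDr -lnM ?posrE // ler_ln ?posrE ?mulr_gt0 //.
  by rewrite -natrM ler_nat mulnC.
(* The only use of the condition f * f <= m * f': the exponent, which is set by f', becomes
   comparable with the gain of the light side, which is set by f. *)
have hL : ln m%:R - ln f'%:R <= 2 * L.
  have : ln (f%:R * f%:R) <= ln (m%:R * f'%:R) :> R.
    by rewrite ler_ln ?posrE ?mulr_gt0 // -!natrM ler_nat.
  by rewrite !lnM ?posrE // /L; lra.
have hb : b.-1%:R * ln 2 <= 2 * L.
  apply: le_trans hL; rewrite lerBrDr.
  have : ln (2 ^+ b.-1 * f'%:R) <= ln m%:R :> R.
    rewrite ler_ln ?posrE ?mulr_gt0 ?exprn_gt0 // -natrX -natrM ler_nat ltnW //.
    by apply: hb2; rewrite prednK.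
  by rewrite lnM ?posrE ?exprn_gt0 // lnXn // -mulr_natl; lra.
(* From b - 1 <= 4 L and 1 <= 2 L, both by ln 2 >= 1/2. *)
have hr12 : (2 * b)%:R <= 12 * L.
  have eb : b%:R = b.-1%:R + 1 :> R by rewrite natr1 prednK.
  rewrite natrM eb; have b1 : 0 <= b.-1%:R :> R by [].
  have : b.-1%:R * 2^-1 <= 2 * L by apply: le_trans hb; rewrite ler_wpM2l.
  by lra.
(* This is why the exponent is 2 b and not b: in the lower half of the ramp the slope is at most r 2
   ^ (1 - r) = 2 r 4 ^ (- b), and half of the decay in 4 ^ (- b) is spent on the factor r. *)
have hz : (2 * b)%:R * 4^-1 ^+ b <= z.
  have h1 : (2 * b <= 2 ^ b)%N.
    case: (b) b0 => // c _; rewrite expnS leq_pmul2l //; exact: ltn_expl.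
  have h2 : (2 ^ b)%:R * 4^-1 ^+ b = 2^-1 ^+ b :> R.
    by rewrite natrX -exprMn; congr (_ ^+ _); field.
  have p2 : 0 < 2 ^+ b :> R by rewrite exprn_gt0.
  apply: le_trans (_ : (2 ^ b)%:R * 4^-1 ^+ b <= _).
    by rewrite ler_wpM2r ?ler_nat // exprn_ge0.
  rewrite h2 exprVn /z ler_pdivlMr // ler_pdivrMl // -natrX -natrM ler_nat //.
set r := (2 * b)%N in hr hr12 hz *.
have r0 : (0 < r)%N by rewrite /r muln_gt0.
have er : r = r.-1.+1 by rewrite prednK.
set h1 := s ^+ r; set h2 := t ^+ r.
have t0 : 0 <= t by apply: le_trans st.
have hd : h2 - h1 <= r%:R * jg * t ^+ r.-1.
  by rewrite /h1 /h2 {1 2}er; apply: le_trans (expr_sub_le _ s0 st ts) _; rewrite -er.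
have h10 : 0 <= h1 by rewrite exprn_ge0.
have h21 : h2 <= 1 by rewrite exprn_ile1.
have rjg : 0 <= r%:R * jg by rewrite mulr_ge0.
(* h2 - h1 bounds the probability that the ball is cut. It has to be covered by the gains L of the
   light and z of the heavy side, weighted by their probabilities. *)
suff key : h2 - h1 <= a * (h1 * L + (1 - h2) * z).
  have g1 : decay a m * (1 + a * L) <= decay a f.
    by apply: decay_gain => //; rewrite /L; lra.
  have g2 : decay a m * (1 + a * z) <= decay a (m - f').
    apply: decay_gain => //; rewrite natrB; last exact: ltnW.
    by apply: ln_sub_ge; [exact: ltW|rewrite ltr_nat].
  apply: le_trans (_ : h1 * (decay a m * (1 + a * L)) + (1 - h2) * (decay a m * (1 + a * z)) <= _).
    have d0 : 0 <= decay a m by exact: expR_ge0.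
    have := ler_wpM2l d0 key; rewrite -subr_ge0 => hh; rewrite -subr_ge0.
    by apply: le_trans hh _; nra.
  by apply: lerD; apply: ler_wpM2l => //; rewrite subr_ge0.
case: (leP 2^-1 t) => ht.
  have hd2 : h2 - h1 <= 2 * (r%:R * jg) * h2.
    apply: le_trans hd _; rewrite /h2 {4}er exprS.
    have := ler_wpM2r (mulr_ge0 rjg (exprn_ge0 r.-1 t0)) ht.
    by move: (t ^+ r.-1) (r%:R * jg) => T X; nra.
  have h20 : 0 <= h2 by rewrite exprn_ge0.
  (* Since r jg <= 1/4, the previous bound is at most h2 / 2. Then h2 - h1 <= 4 r jg h1, and 4 * 12
     is the constant 48 in a. *)
  have hh : h2 <= 2 * h1 by nra.
  have hd3 : h2 - h1 <= 4 * (r%:R * jg) * h1 by nra.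
  apply: le_trans hd3 _; rewrite ea.
  have p1 : r%:R * (jg * h1) <= 12 * L * (jg * h1) by rewrite ler_wpM2r // mulr_ge0.
  have p2 : 0 <= jg * ((1 - h2) * z) by rewrite !mulr_ge0 // subr_ge0.
  by nra.
have tp : t ^+ r.-1 <= 2^-1 ^+ r.-1.
  by apply: lerXn2r; rewrite ?nnegrE ?invr_ge0 // ltW.
have e4 : 2^-1 ^+ r.-1 = 2 * 4^-1 ^+ b :> R.
  rewrite (_ : 4^-1 = 2^-1 ^+ 2 :> R); last by field.
  by rewrite -exprM -/r {2}er exprS mulrA mulfV ?mul1r.
have hd2 : h2 - h1 <= 2 * (jg * z).
  apply: le_trans hd _; apply: le_trans (ler_wpM2l rjg tp) _; rewrite e4.
  by have := ler_wpM2l jg0 hz; lra.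
have h2h : h2 <= 2^-1.
  rewrite /h2 er exprS; apply: le_trans (_ : 2^-1 * 1 <= _); last by rewrite mulr1.
  by apply: ler_pM; rewrite ?exprn_ge0 ?exprn_ile1 // ltW.
apply: le_trans hd2 _; rewrite ea.
have p1 : 0 <= jg * (h1 * L) by rewrite !mulr_ge0 //; lra.
have p2 : 0 <= jg * z * (2^-1 - h2) by rewrite !mulr_ge0 // subr_ge0.
have p3 : 0 <= jg * z by rewrite mulr_ge0.
by nra.
Qed.

(** Below h1 the ball stays outside the box, with at most half of the points; above h2 it is inside
    and done. Either outcome gains a factor 1 + a / 2 >= 1 + 16 gamma, and (1 - 8 gamma) (1 + 16
    gamma) >= 1 for gamma <= 1/16. *)
Lemma box_bound (m b : nat) (a gamma h1 h2 : R) :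
  (0 < m)%N -> 0 <= gamma <= 16^-1 -> 32 * gamma <= a -> 0 <= h1 -> h1 <= h2 -> h2 <= 1 ->
  h2 - h1 <= 8 * gamma -> ((0 < h1) -> (0 < b)%N) -> (b * 2 <= m)%N ->
  decay a m <= h1 * decay a b + (1 - h2).
Proof.
move=> m0 /andP[g0 g1] ag h10 h12 h21 hh hb bm.
have a0 : 0 <= a by apply: le_trans ag; rewrite mulr_ge0.
have l2 := ln2_ge R.
have d0 : 0 <= decay a m by exact: expR_ge0.
have e2 : decay a m * (1 + a * 2^-1) <= 1.
  have lm : 0 <= ln m%:R :> R by rewrite ln_ge0 // ler1n.
  apply: le_trans (_ : decay a m * expR (a * (1 + ln m%:R)) <= _).
    rewrite ler_wpM2l //; apply: le_trans (expR_ge1Dx _).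
    by rewrite lerD2l ler_wpM2l //; lra.
  by rewrite /decay -expRD addNr expR0.
have e1 : h1 * (decay a m * (1 + a * 2^-1)) <= h1 * decay a b.
  move: h10; rewrite le_eqVlt => /orP[/eqP <-|h10]; first by rewrite !mul0r.
  have b0 := hb h10; rewrite ler_wpM2l ?(ltW h10) //.
  apply: decay_gain => //; apply: le_trans (_ : _ <= ln m%:R - ln 2) _; last by lra.
  rewrite lerBrDr -lnM ?posrE ?ltr0n // ler_ln ?posrE ?mulr_gt0 ?ltr0n //.
  by rewrite -natrM ler_nat.
have e3 : (1 - h2) * (decay a m * (1 + a * 2^-1)) <= (1 - h2) * 1.
  by rewrite ler_wpM2l // subr_ge0.
have e4 : decay a m * 1 <= decay a m * ((h1 + (1 - h2)) * (1 + a * 2^-1)).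
  rewrite ler_wpM2l //; have hc : 1 - 8 * gamma <= h1 + (1 - h2) by lra.
  apply: le_trans (_ : (1 - 8 * gamma) * (1 + 16 * gamma) <= _); first by nra.
  by apply: ler_pM => //; lra.
rewrite mulr1 in e4; apply: le_trans e4 _; lra.
Qed.

End Numeric.

Lemma prob01_interval (R : realType) (a b : R) (ca cb : bool) : 0 <= a -> a <= b -> b <= 1 ->
  prob01 [set` Interval (BSide ca a) (BSide cb b)]%classic = b - a.
Proof.
move=> a0 ab b1; rewrite /prob01 /uniform_prob.
rewrite (_ : (\int[lebesgue_measure]_(x in _) _)%E =
  (\int[lebesgue_measure]_(x in [set` Interval (BSide ca a) (BSide cb b)]) 1%:E)%E).
  rewrite integral_cst //= mul1e lebesgue_measure_itv /= lte_fin.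
  case: ltP => // h; rewrite /= (_ : b = a) ?subrr //.
  by apply/eqP; rewrite eq_le h ab.
apply: eq_integral => x; rewrite inE /= itv_boundlr => /andP[h1 h2].
have hx : 0 <= x <= 1.
  by case: ca cb h1 h2 => -[]; rewrite ?bnd_simp => h1 h2; apply/andP; split; lra.
by rewrite /uniform_pdf hx subr0 invr1.
Qed.

Section Branching.
Variables (R : realType) (St : Type) (L : finType) (choice : St -> R -> L).
Hypothesis choice_measurable : forall c l, measurable [set v | choice c v = l]%classic.

(** The numbers between h1 and h2, for which the ball may be cut, contribute at least 0. *)
Lemma branching_ge c (g : L -> R) (h1 h2 g1 g2 : R) :
  (forall l, 0 <= g l) -> 0 <= h1 -> h1 <= h2 -> h2 <= 1 ->
  (forall v, 0 <= v < h1 -> g1 <= g (choice c v)) ->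
  (forall v, h2 < v <= 1 -> g2 <= g (choice c v)) ->
  h1 * g1 + (1 - h2) * g2 <= \sum_(l : L) branch_prob choice c l * g l.
Proof.
move=> g0 h10 h12 h21 hg1 hg2.
pose A1 : set R := `[0, h1[%classic; pose A2 : set R := `]h2, 1]%classic.
have mA1 : measurable A1 by exact: measurable_itv.
have mA2 : measurable A2 by exact: measurable_itv.
have p1 : prob01 A1 = h1 by rewrite prob01_interval ?subr0 //; lra.
have p2 : prob01 A2 = 1 - h2 by rewrite prob01_interval //; lra.
rewrite -p1 -p2 -(sum_branch_prob_inter choice_measurable c mA1).
rewrite -(sum_branch_prob_inter choice_measurable c mA2) !mulr_suml -big_split /=.
apply: ler_sum => l _.
set B := [set v | choice c v = l]%classic.
have mB : measurable B by exact: choice_measurable.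
have hle (A : set R) ga : (forall v, A v -> ga <= g (choice c v)) ->
    prob01 (B `&` A)%classic * ga <= prob01 (B `&` A)%classic * g l.
  move=> hA; have [->|/set0P [v [/= <- Av]]] := eqVneq (B `&` A)%classic set0.
    by rewrite /prob01 measure0 !mul0r.
  by rewrite ler_wpM2l ?prob01_ge0 // hA.
apply: le_trans (lerD (hle A1 g1 _) (hle A2 g2 _)) _.
- by move=> v; rewrite /A1 /= in_itv /=; exact: hg1.
- by move=> v; rewrite /A2 /= in_itv /=; exact: hg2.
rewrite -mulrDl ler_wpM2r //.
have mI1 : measurable (B `&` A1)%classic by apply: measurableI.
have mI2 : measurable (B `&` A2)%classic by apply: measurableI.
rewrite /branch_prob -/B /prob01 -lee_fin EFinD !fineK; try exact: fin_num_measure.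
rewrite -measureU //; first last.
  apply/seteqP; split=> v //= [[_]]; rewrite /A1 /A2 /= !in_itv /= => /andP[_ k1] [_].
  by move=> /andP[k2 _]; lra.
apply: le_measure; rewrite ?inE //; first exact: measurableU.
by move=> v [[]|[]].
Qed.

End Branching.

Lemma size_le_flatten (T : Type) (ps : seq (seq T)) :
  all (fun p => 0 < size p)%N ps -> (size ps <= size (flatten ps))%N.
Proof. by elim: ps => //= p ps IH /andP[p0 /IH]; rewrite size_cat; lia. Qed.

Lemma argmax_lt (R : realType) (F : nat -> R) D : (0 < D)%N ->
  exists2 k0, (k0 < D)%N & forall k, (k < D)%N -> F k <= F k0.
Proof.
case: D => // D _; elim: D => [|D [k0 k0D hk]]; first by exists 0%N => // -[].
case: (leP (F k0) (F D.+1)) => h; [exists D.+1 => // | exists k0; first exact: ltnW];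
  move=> k; rewrite ltnS leq_eqVlt => /orP[/eqP -> //|/hk] //; last exact: ltW.
by move/le_trans; apply.
Qed.

(** * The random process of configurations *)

Section RandomModel.
Variables (R : realType) (n D J : nat) (val : 'I_n -> nat -> R) (Delta : R).
Notation scan := (scan D J val Delta).
Notation selected := (selected D J val Delta).
Notation step := (step D J val Delta).
Notation next := (next_config D J val Delta).
Notation median := (median val).
Notation threshold := (threshold J val Delta).
Notation f_above := (f_above J val Delta).
Notation valid := (valid D val Delta).
Implicit Type p : seq 'I_n.
Hypothesis Delta_gt0 : 0 < Delta.
Hypothesis D_gt0 : (0 < D)%N.
Hypothesis J_gt0 : (0 < J)%N.
Hypothesis J_ge : (D + D <= 2 ^ (2 ^ J))%N.
Hypothesis val_opp : forall k, (k < D)%N ->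
  exists2 k', (k' < D)%N & forall i, val i k' = - val i k.

(** The label of a step for [chain]. It applies the rule of the current segment to all points, which
    gives a finite type independent of the configuration. *)
Definition chosen (c : config n) (v : R) : {set 'I_n} :=
  [set i | selected (head [::] (pending c)) v i].
Definition next_set (c : config n) (S : {set 'I_n}) : config n := next c (fun i => i \in S).
Definition finished (c : config n) : bool := nilp (pending c).
Definition clusters (c : config n) : {set {set 'I_n}} :=
  finset.preim_partition (fun i : 'I_n => label c i) [set: 'I_n].

Lemma next_setE c v : next_set c (chosen c v) = step c v.
Proof.
rewrite /next_set /step /next_config; case ec: (pending c) => [|p ps] //=.
have e i : (i \in chosen c v) = selected p v i by rewrite inE ec.
by rewrite !(eq_filter e) (eq_filter (fun i => congr1 negb (e i))).
Qed.

Lemma chain_run fuel c us pos :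
  chain chosen next_set finished fuel c us pos = run D J val Delta fuel c us pos.
Proof.
elim: fuel c pos => //= fuel IH c pos; rewrite /finished.
by case ec: (pending c) => [|p ps] //=; rewrite next_setE IH.
Qed.

Lemma selected_measurable p i : measurable [set v | selected p v i]%classic.
Proof.
rewrite /selected; case: (scan p) => [[k j]|].
  rewrite /in_light; case: (0 < _); last by rewrite set_false; exact: measurable0.
  rewrite /=; set h := _ ^+ _.
  rewrite (_ : [set v | v <= h]%classic = `]-oo, h]%classic); last first.
    by apply/seteqP; split=> v /=; rewrite in_itv.
  exact: measurable_itv.
have q0 : 0 < quarter Delta by rewrite divr_gt0.
rewrite /in_box; elim: (iota 0 D) => [|k ks IH] /=; first by rewrite set_true; exact: measurableT.
set z := val i k - median p k in IH *.
rewrite (_ : mkset _ = (`[z / quarter Delta - 1, +oo[ `&`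
  [set v | all (fun k => val i k - median p k <= quarter Delta * (1 + v)) ks])%classic).
  by apply: measurableI => //; exact: measurable_itv.
have e v : (z / quarter Delta - 1 <= v) = (z <= quarter Delta * (1 + v)).
  by rewrite lerBlDl ler_pdivrMr // mulrC.
by apply/seteqP; split=> v /=; rewrite in_itv /= andbT e => /andP.
Qed.

Lemma chosen_measurable c l : measurable [set v | chosen c v = l]%classic.
Proof.
set p := head [::] (pending c).
have -> : [set v | chosen c v = l]%classic =
  (\bigcap_(i in [set: 'I_n]) [set v | selected p v i = (i \in l)])%classic.
  apply/seteqP; split=> v /=; first by move=> <- i _ /=; rewrite inE.
  by move=> h; apply/setP => i; rewrite inE; apply: h.
apply: fin_bigcap_measurable; first exact: finite_finset.
move=> i _; case: (i \in l); first exact: selected_measurable.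
rewrite (_ : mkset _ = ~` [set v | selected p v i])%classic.
  by apply: measurableC; exact: selected_measurable.
by apply/seteqP; split=> v /=; [move=> ->|move/negP/negbTE].
Qed.

Definition good_prob fuel c (E : pred {set {set 'I_n}}) : R :=
  \sum_(Q | E Q) law chosen next_set finished clusters fuel c Q.

Lemma good_probE fuel c E : good_prob fuel c E =
  if fuel is fuel'.+1 then
    if finished c then (E (clusters c))%:R
    else \sum_l branch_prob chosen c l * good_prob fuel' (next_set c l) E
  else (E (clusters c))%:R.
Proof.
have leaf : \sum_(Q | E Q) (clusters c == Q)%:R = (E (clusters c))%:R :> R.
  rewrite big_mkcond (bigD1 (clusters c)) //= eqxx big1 ?addr0; first by case: (E _).
  by move=> Q; rewrite eq_sym => /negbTE ->; case: ifP.
rewrite /good_prob; case: fuel => [|fuel] //=; case: (finished c) => //.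
rewrite exchange_big /=; apply: eq_bigr => l _.
by rewrite mulr_sumr.
Qed.

Lemma good_prob_ge0 fuel c E : 0 <= good_prob fuel c E.
Proof. by apply: sumr_ge0 => Q _; apply: law_ge0. Qed.

Lemma law_bounded fuel c Q : valid c -> law chosen next_set finished clusters fuel c Q != 0 ->
  (potential c <= fuel)%N ->
  exists2 c', valid c' & pending c' = [::] /\ Q = clusters c'.
Proof.
elim: fuel c => [|fuel IH] c vc /=.
  case: (clusters c =P Q) => [<- _|]; last by rewrite eqxx.
  rewrite leqn0 => /eqP hp; exists c => //; split=> //.
  have [h1 _ _ _] := vc; move: hp h1; rewrite /potential.
  case: (pending c) => //= p ps; rewrite size_cat.
  by move=> hp /andP[p0 /size_le_flatten]; lia.
rewrite /finished; case ec: (pending c) => [|p ps] /=.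
  case: (clusters c =P Q) => [<- _ _|]; last by rewrite eqxx.
  by exists c.
move=> hs hpot.
have [l hl] : exists l, branch_prob chosen c l * law chosen next_set finished clusters fuel
    (next_set c l) Q != 0.
  apply/existsP; move: hs; apply: contraR; rewrite negb_exists => /forallP h.
  by rewrite big1 // => l _; apply/eqP; have := h l; rewrite negbK.
move: hl; rewrite mulf_eq0 negb_or => /andP[hb hl].
(* A branch of nonzero probability is taken by some v in [0, 1], since the density vanishes
   elsewhere; [valid_step] holds for such v only. *)
have [v [v01 ev]] : exists v, 0 <= v <= 1 /\ chosen c v = l.
  apply: contrapT => hn; move/negP: hb; apply; apply/eqP.
  have mB : measurable [set v | chosen c v = l]%classic := chosen_measurable c l.
  have e : ([set v | chosen c v = l] `&` `[0%R, 1%R])%classic = set0.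
    by apply/seteqP; split=> v //= [h]; rewrite in_itv => h2; apply: hn; exists v.
  by rewrite /branch_prob /prob01 /uniform_prob integral_uniform_pdf e integral_set0.
rewrite -ev next_setE in hl.
apply: IH hl _; first exact: valid_step ec v01.
have sp := valid_splits Delta_gt0 D_gt0 J_gt0 J_ge vc ec v01.
rewrite -ltnS; apply: leq_trans hpot; apply: (potential_step ec sp).
by have [h1 _ _ _] := vc; move: h1; rewrite ec /= => /andP[_ /size_le_flatten].
Qed.

Section Padding.
Variables (gamma : R) (x : 'I_n) (ball : {set 'I_n}).
Hypothesis gamma_ge0 : 0 <= gamma.
Hypothesis gamma_le : gamma <= 16^-1.
Hypothesis gamma_log : forall m f, (m <= n)%N -> (0 < f)%N ->
  (2 * log_ratio m f)%:R * (8 * J%:R * gamma) <= 4^-1 :> R.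
Hypothesis ball_ub : forall y k, y \in ball -> (k < D)%N -> val y k <= val x k + gamma * Delta.
Hypothesis ball_lb : forall y k, y \in ball -> (k < D)%N -> val x k <= val y k + gamma * Delta.
Hypothesis ball_x : x \in ball.

(** 8 J gamma is the width 2 gamma Delta of the ball in units of a window Delta / (4 J); 48 is the
    factor of [cut_bound]. *)
Let rate : R := 48 * (8 * J%:R * gamma).
Let padded : pred {set {set 'I_n}} := [pred Q | ball \subset finset.pblock Q x].

Lemma rate_ge : 32 * gamma <= rate.
Proof.
have J1 : 1 <= J%:R :> R by rewrite ler1n.
have h := ler_wpM2l gamma_ge0 J1; rewrite mulr1 in h.
have e : rate = 12 * (32 * (gamma * J%:R)) by rewrite /rate; ring.
rewrite e; move: (gamma * J%:R) h => X h; have g0 := gamma_ge0.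
lra.
Qed.

Lemma rate_ge0 : 0 <= rate.
Proof. by apply: le_trans rate_ge; rewrite mulr_ge0. Qed.

Lemma clusters_padded c : (forall y, y \in ball -> label c y = label c x) -> padded (clusters c).
Proof.
move=> h; rewrite /padded /=; apply/fintype.subsetP => y yb.
rewrite /clusters /finset.preim_partition finset.pblock_equivalence_partition ?inE //.
  by rewrite /= h // eqxx.
by split=> // /eqP ->.
Qed.

Lemma pending_nil c : valid c -> (potential c <= 0)%N -> pending c = [::].
Proof.
case=> h1 _ _ _; rewrite leqn0 => /eqP; move: h1; rewrite /potential.
case: (pending c) => //= p ps; rewrite size_cat => /andP[p0 /size_le_flatten]; lia.
Qed.

Lemma potential_valid_step fuel c p ps v : valid c -> pending c = p :: ps -> 0 <= v <= 1 ->
  (potential c <= fuel.+1)%N -> (potential (step c v) <= fuel)%N.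
Proof.
move=> vc ec v01 hpot; have sp := valid_splits Delta_gt0 D_gt0 J_gt0 J_ge vc ec v01.
rewrite -ltnS; apply: leq_trans hpot; apply: (potential_step ec sp).
by have [h1 _ _ _] := vc; move: h1; rewrite ec /= => /andP[_ /size_le_flatten].
Qed.

Lemma step_done c v i : i \notin flatten (pending c) ->
  i \notin flatten (pending (step c v)) /\ label (step c v) i = label c i.
Proof.
case ec: (pending c) => [|p ps] hi; first by rewrite (_ : step c v = c) ?ec // /step /next_config ec.
have /= := hi; rewrite mem_cat negb_or => /andP[hp hps]; split.
  rewrite (perm_mem (pending_step D J val Delta v ec)) !mem_cat !negb_or hps andbT.
  by case: ifP => _; rewrite ?mem_filter (negbTE hp) ?andbF.
rewrite /step ec /= /next_config ec; case: (scan p) => [_|] //=.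
by rewrite mem_map ?mem_filter ?(negbTE hp) ?andbF //; apply: ord_inj.
Qed.

Lemma padded_done fuel c : valid c -> (potential c <= fuel)%N ->
  (forall y, y \in ball -> y \notin flatten (pending c) /\ label c y = label c x) ->
  1 <= good_prob fuel c padded.
Proof.
elim: fuel c => [|fuel IH] c vc hpot hb; rewrite good_probE.
  by rewrite clusters_padded // => y /hb[].
rewrite /finished; case ec: (pending c) => [|p ps] /=.
  by rewrite clusters_padded // => y /hb[].
(* With h1 = h2 = 0 the second range is all of ]0, 1], so this treats a step that cannot hurt the
   ball. *)
have := branching_ge chosen_measurable (c := c) (g := fun l => good_prob fuel (next_set c l) padded)
  (g1 := 1) (g2 := 1) (fun l => good_prob_ge0 _ _ _) (lexx 0) (lexx 0) ler01.
rewrite mul0r add0r subr0 mul1r; apply=> [v /andP[v0]|v /andP[/ltW v0 v1]]; first by rewrite ltNge v0.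
have v01 : 0 <= v <= 1 by rewrite v0.
rewrite next_setE; apply: IH.
- exact: valid_step ec v01.
- exact: potential_valid_step ec v01 hpot.
- move=> y yb; have [h1 h2] := hb y yb; have [h3 h4] := hb x ball_x.
  have [k1 ->] := step_done v h1; have [_ ->] := step_done v h3.
  by split.
Qed.

(** Induction over the steps left. A step on another segment keeps p pending; a step on p itself is
    [cut_bound] or [box_bound], with the induction hypothesis for the part that contains the
    ball. *)
Lemma padded_pending fuel c p : valid c -> (potential c <= fuel)%N -> p \in pending c ->
  {subset ball <= p} -> decay rate (size p) <= good_prob fuel c padded.
Proof.
elim: fuel c p => [|fuel IH] c p vc hpot hp bp; first by rewrite (pending_nil vc hpot) in hp.
rewrite good_probE /finished; case ec: (pending c) hp => [|q ps] //= hp.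
have [hall huniq hlt hdiam] := vc.
have p0 : (0 < size p)%N by move: hall; rewrite ec => /allP; apply.
have pn : (size p <= n)%N.
  have up : uniq p.
    move: huniq; rewrite ec => hu.
    elim: (q :: ps) hp hu => // r rs IHr; rewrite inE /= cat_uniq => /orP[/eqP ->|/IHr h] /and3P[h1 _ h3] //.
    exact: h.
  by rewrite -(card_uniqP up) -[X in (_ <= X)%N]card_ord max_card.
pose g l := good_prob fuel (next_set c l) padded.
have g0 l : 0 <= g l := good_prob_ge0 _ _ _.
have r0 := rate_ge0.
have key h1 h2 g1 g2 := branching_ge chosen_measurable (c := c) (h1 := h1) (h2 := h2)
  (g1 := g1) (g2 := g2) g0.
have vs v : 0 <= v <= 1 -> valid (step c v) by move=> v01; apply: valid_step ec v01.
have ps' v : 0 <= v <= 1 -> (potential (step c v) <= fuel)%N.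
  by move=> v01; apply: potential_valid_step ec v01 hpot.
move: hp; rewrite inE => /orP[/eqP pq|pps]; last first.
  have := key 0 0 (decay rate (size p)) (decay rate (size p)) (lexx 0) (lexx 0) ler01.
  rewrite mul0r add0r subr0 mul1r; apply=> [v /andP[v0]|v /andP[/ltW v0 v1]]; first by rewrite ltNge v0.
  have v01 : 0 <= v <= 1 by rewrite v0.
  rewrite /g next_setE; apply: IH => //; first exact: vs.
    exact: ps'.
  rewrite /step ec /next_config ec /=; case: (scan q) => [_|] /=; first by rewrite !inE pps !orbT.
  by case: [seq _ <- _ | _] => [|? ?]; rewrite ?inE ?pps ?orbT.
subst q.
have ebox : step c = fun v => next c (selected p v) by rewrite /step ec.
case es: (scan p) => [[k j]|].
- have [kD jJ hg] := scan_some es; have f0 := good_above hg p0.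
  have fa := f_above_anti val Delta_gt0 D_gt0 J_gt0 J_ge p k j.
  have fh := f_above_half val Delta_gt0 D_gt0 J_gt0 J_ge k j p0.
  have w0 := window_gt0 Delta_gt0 D_gt0 J_gt0 J_ge.
  have := hg; rewrite goodE => /andP[_ hsq].
  pose T := threshold p k j; pose w := window J Delta.
  (* s and t bound the ramp from below and above on the ball, so [u < s ^+ r] puts all of it on the
     light side and [u > t ^+ r] all of it on the heavy side. *)
  pose s := clip ((val x k - gamma * Delta - T) / w).
  pose t := clip ((val x k + gamma * Delta - T) / w).
  have gD : 0 <= gamma * Delta by rewrite mulr_ge0 // ltW.
  have st : s <= t by apply: clip_le; rewrite ler_pM2r ?invr_gt0 //; lra.
  have ts : t - s <= 8 * J%:R * gamma.
    apply: clip_sub; last by rewrite !mulr_ge0.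
    have J0 : J%:R != 0 :> R by rewrite pnatr_eq0 -lt0n.
    have D0 : Delta != 0 by rewrite gt_eqF.
    rewrite le_eqVlt; apply/orP; left; apply/eqP.
    rewrite /w /window (_ : (J + J + J + J)%:R = 4 * J%:R :> R); last by rewrite !natrD; ring.
    by field; rewrite J0 D0.
  set b := log_ratio (size p) (f_above p k j.+1).
  apply: le_trans (cut_bound f0 fa fh hsq _ (gamma_log pn f0) (clip_ge0 _) st (clip_le1 _) ts) _.
    by rewrite !mulr_ge0.
  rewrite -/b; apply: key.
  + by rewrite exprn_ge0 // clip_ge0.
  + by apply: lerXn2r => //; rewrite nnegrE clip_ge0.
  + by rewrite exprn_ile1 ?clip_ge0 ?clip_le1.
  + move=> v /andP[v0 vs1].
    have v01 : 0 <= v <= 1.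
      by rewrite v0 /= (le_trans (ltW vs1)) // exprn_ile1 ?clip_ge0 ?clip_le1.
    have bsel : {subset ball <= [seq i <- p | selected p v i]}.
      move=> y yb; rewrite mem_filter bp // andbT /selected es /in_light -/T.
      (* With exponent 0 the power would be 1 even for s = 0. A positive exponent makes s > 0, so
         that the clip at 0 is inactive and the sign test in [in_light] succeeds. *)
      have b0 : (0 < 2 * b)%N.
        rewrite muln_gt0 /= lt0n; apply/eqP => eb.
        have [hle _] := log_ratio_spec (size p) f0; move: hle; rewrite -/b eb expn0 mul1n.
        by move: fa fh p0; clear; lia.
      have s0 : 0 < s.
        rewrite lt_neqAle clip_ge0 andbT eq_sym; apply/eqP => e0.
        have : v < s ^+ (2 * b) by exact: vs1.
        by rewrite e0 expr0n gtn_eqF // ltNge v0.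
      have hz : 0 < (val x k - gamma * Delta - T) / w.
        rewrite ltNge; apply/negP => hn; move: s0; rewrite /s /clip ltNge ge_max lexx /=.
        by rewrite ge_min hn orbT.
      have hz' : 0 < val x k - gamma * Delta - T by move: hz; rewrite pmulr_lgt0 // invr_gt0.
      have hy := ball_lb yb kD.
      rewrite (_ : 0 < val y k - T) /=; last by lra.
      rewrite -expr2 -exprM -/b; apply: le_trans (ltW vs1) _.
      apply: lerXn2r; rewrite ?nnegrE ?clip_ge0 //.
        by rewrite /ramp le_min ler01 /= divr_ge0 // ?(ltW w0) // -/T; lra.
      rewrite /s /clip /ramp -/T -/w ge_max; apply/andP; split.
        by rewrite le_min ler01 /= divr_ge0 // ?(ltW w0) //; lra.
      rewrite le_min !ge_min lexx /=; apply/orP; right.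
      by rewrite ler_pM2r ?invr_gt0 //; lra.
    have /andP[_ fA] := light_size Delta_gt0 D_gt0 J_gt0 J_ge es v01.
    rewrite /g next_setE; apply: le_trans (IH _ [seq i <- p | selected p v i] _ _ _ _) => //.
    * apply: decay_anti => //.
      by rewrite size_filter -has_count; apply/hasP; exists x; [exact: bp|have := bsel x ball_x; rewrite mem_filter => /andP[]].
    * exact: vs.
    * exact: ps'.
    * by rewrite ebox /next_config ec es /= inE eqxx.
  + move=> v /andP[vt v1].
    have v0 : 0 <= v by apply: le_trans (ltW vt); rewrite exprn_ge0 // clip_ge0.
    have v01 : 0 <= v <= 1 by rewrite v0.
    have bsel : {subset ball <= [seq i <- p | ~~ selected p v i]}.
      move=> y yb; rewrite mem_filter bp // andbT /selected es /in_light -/T negb_and.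
      rewrite -leNgt -ltNge -/b; case: (leP (val y k - T) 0) => //= hy0.
      apply: le_lt_trans vt; rewrite -expr2 -exprM.
      have hr0 : 0 <= ramp J val Delta p k j y.
        by rewrite /ramp le_min ler01 /= divr_ge0 // ?(ltW w0) // ltW.
      apply: lerXn2r; rewrite ?nnegrE ?clip_ge0 //.
      rewrite /t /clip le_max /ramp -/T -/w; apply/orP; right.
      rewrite le_min !ge_min lexx /=; apply/orP; right.
      by rewrite ler_pM2r ?invr_gt0 //; have := ball_ub yb kD; lra.
    have /andP[fA _] := light_size Delta_gt0 D_gt0 J_gt0 J_ge es v01.
    have szAB : (size [seq i <- p | selected p v i] + size [seq i <- p | ~~ selected p v i] = size p)%N.
      by rewrite !size_filter count_predC.
    rewrite /g next_setE; apply: le_trans (IH _ [seq i <- p | ~~ selected p v i] _ _ _ _) => //.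
    * apply: decay_anti => //; last by move: szAB fA; clear; lia.
      rewrite size_filter -has_count; apply/hasP; exists x; [exact: bp|].
      by have := bsel x ball_x; rewrite mem_filter => /andP[].
    * exact: vs.
    * exact: ps'.
    * by rewrite ebox /next_config ec es /= !inE eqxx orbT.
(* One direction decides: where x exceeds the median most. A box too small there misses the whole
   ball, and a box that clears x by gamma Delta there contains the ball in every direction. *)
- have [k0 k0D kmax] := argmax_lt (fun k => val x k - median p k) D_gt0.
  set phi := val x k0 - median p k0 in kmax.
  pose q := quarter Delta; have q0 : 0 < q by rewrite divr_gt0.
  pose h1 := clip ((phi - gamma * Delta) / q - 1).
  pose h2 := clip ((phi + gamma * Delta) / q - 1).
  have gD : 0 <= gamma * Delta by rewrite mulr_ge0 // ltW.
  have h12 : h1 <= h2 by apply: clip_le; rewrite lerD2r ler_pM2r ?invr_gt0 //; lra.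
  have hd : h2 - h1 <= 8 * gamma.
    apply: clip_sub; last by rewrite mulr_ge0.
    have D0 : Delta != 0 by rewrite gt_eqF.
    by rewrite le_eqVlt; apply/orP; left; apply/eqP; rewrite /q /quarter; field.
  have out v : 0 <= v < h1 -> {subset ball <= [seq i <- p | ~~ selected p v i]}.
    move=> /andP[v0]; rewrite /h1 /clip lt_max ltNge v0 /= lt_min => /andP[_ hv] y yb.
    rewrite mem_filter bp // andbT /selected es /in_box -has_predC.
    apply/hasP; exists k0; first by rewrite mem_iota.
    rewrite /= -ltNge -/q; have := ball_lb yb k0D.
    have : q * (1 + v) < phi - gamma * Delta.
      by rewrite mulrC -ltr_pdivlMr // -ltrBrDl.
    by rewrite /phi; lra.
  have in_ v : h2 < v <= 1 -> {subset ball <= [seq i <- p | selected p v i]}.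
    move=> /andP[hv v1] y yb; rewrite mem_filter bp // andbT /selected es.
    apply/allP => k; rewrite mem_iota add0n /= => kD.
    have hz : (phi + gamma * Delta) / q - 1 < v.
      by move: hv; rewrite /h2 /clip gt_max gt_min => /andP[_ /orP[|//]]; rewrite ltNge v1.
    have : phi + gamma * Delta < q * (1 + v).
      by rewrite [q * _]mulrC -ltr_pdivrMr // -ltrBlDl.
    by have := ball_ub yb kD; have := kmax k kD; rewrite -/q; lra.
  have pos v : 0 <= v < h1 -> (0 < size [seq i <- p | ~~ selected p v i])%N.
    move=> hv; rewrite size_filter -has_count; apply/hasP; exists x; first exact: bp.
    by have := out v hv x ball_x; rewrite mem_filter => /andP[].
  have half v : 0 <= v -> (size [seq i <- p | ~~ selected p v i] <= (size p)./2)%N.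
    move=> v0; have := outside_box Delta_gt0 D_gt0 J_gt0 J_ge p0 es v0.
    by move: (size _); clear; lia.
  have hb : 0 < h1 -> (0 < (size p)./2)%N.
    move=> h; have v0 : 0 <= (0 : R) < h1 by rewrite lexx.
    by apply: leq_trans (pos _ v0) (half _ (lexx 0)).
  (* The number of points outside the box depends on the random radius, hence the uniform bound
     (size p)./2 as b. *)
  apply: le_trans (box_bound p0 _ rate_ge (clip_ge0 _) h12 (clip_le1 _) hd hb _) _.
  + by rewrite gamma_ge0.
  + by clear; lia.
  rewrite -[X in _ + X]mulr1; apply: key.
  + exact: clip_ge0.
  + exact: h12.
  + exact: clip_le1.
  + move=> v hv; have /andP[v0 vh] := hv.
    have v01 : 0 <= v <= 1 by rewrite v0 (le_trans (ltW vh)) // clip_le1.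
    rewrite /g next_setE.
    apply: le_trans (IH _ [seq i <- p | ~~ selected p v i] _ _ _ (out v hv)).
    * by apply: decay_anti => //; [exact: pos|exact: half].
    * exact: vs.
    * exact: ps'.
    * rewrite ebox /next_config ec es /=; move: (pos v hv).
      by case: [seq _ <- _ | _] => [//|z l] _; rewrite inE eqxx.
  + move=> v hv; have /andP[hv1 v1] := hv.
    have v01 : 0 <= v <= 1 by rewrite v1 (le_trans (clip_ge0 _) (ltW hv1)).
    rewrite /g next_setE; apply: padded_done; [exact: vs|exact: ps'|].
    have lab y : y \in ball -> label (step c v) y = low c.
      move=> yb; rewrite ebox /next_config ec es /= mem_map; last exact: ord_inj.
      by rewrite (in_ v hv).
    move=> y yb; rewrite !lab //; split=> //.
    rewrite (perm_mem (pending_step D J val Delta v ec)) es /= mem_cat negb_or.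
    have := in_ v hv y yb; rewrite !mem_filter => /andP[-> yp] /=.
    move: huniq; rewrite ec /= cat_uniq => /and3P[_ /hasPn hn _].
    by apply/negP => /hn; rewrite /= yp.
Qed.

End Padding.

End RandomModel.

(** * The input and the final bounds *)

Section Input.
Variables (R : realType) (n d : nat) (x : 'I_n -> 'rV[R]_d) (Delta : R).
Notation val := (direction x Delta).

Lemma directionE (i : 'I_n) (c : 'I_d) k : k./2 = c ->
  val i k = if odd k then - x i 0 c else x i 0 c.
Proof.
move=> kc; have cd := ltn_ord c.
have e1 : ((d + d) * i + k)./2 = (i * d + c)%N.
  rewrite -[in LHS](odd_double_half k) kc.
  rewrite (_ : _ + _ = odd k + (i * d + c).*2)%N ?half_bit_double // -!addnn; nia.
have e2 : odd ((d + d) * i + k) = odd k by rewrite oddD oddM addnn odd_double.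
rewrite /direction /signed_coord e1 e2 /input /=.
have e3 : ((i * d + c) %/ d = i)%N by rewrite divnMDl ?divn_small ?addn0; lia.
have e4 : ((i * d + c) %% d = c)%N by rewrite modnMDl modn_small.
by rewrite e3 e4 (valK i) (valK c).
Qed.

Lemma direction_opp k : (k < d + d)%N ->
  exists2 k', (k' < d + d)%N & forall i, val i k' = - val i k.
Proof.
move=> kd; have kc : (k./2 < d)%N by lia.
have [k' [kd' hk ok]] : exists k', [/\ (k' < d + d)%N, k'./2 = k./2 & odd k' = ~~ odd k].
  have ek := odd_double_half k; case ok: (odd k) ek => ek.
    by exists (k./2).*2; rewrite doubleK odd_double; split=> //; move: kd; lia.
  exists (k./2).*2.+1; rewrite /= uphalf_double odd_double; split=> //.
  by move: kc; rewrite -addnn; lia.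
exists k' => // i; rewrite (directionE i (c := Ordinal kc) hk).
rewrite (directionE i (c := Ordinal kc) erefl) ok.
by case: (odd k); rewrite /= ?opprK.
Qed.

Lemma linf_dist_le (i j : 'I_n) r : (0 < d)%N ->
  (linf_dist x i j <= r) <-> (forall k, (k < d + d)%N -> val i k - val j k <= r).
Proof.
move=> d0; rewrite /linf_dist; split=> [h k kd|h].
  have kc : (k./2 < d)%N by lia.
  have hc : `|x i 0 (Ordinal kc) - x j 0 (Ordinal kc)| <= r.
    apply: le_trans h; rewrite -[`|x i - x j|]/(mx_norm _) mx_normrE.
    by apply: le_trans (le_bigmax _ _ (ord0, Ordinal kc)); rewrite !mxE.
  rewrite !(directionE _ (c := Ordinal kc)) //.
  by have := ler_norml (x i 0 (Ordinal kc) - x j 0 (Ordinal kc)) r; rewrite hc => /esym/andP[]; case: ifP; lra.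
have key (c : 'I_d) : `|x i 0 c - x j 0 c| <= r.
  have c0 : (c.*2 < d + d)%N by have := ltn_ord c; rewrite -addnn; lia.
  have c1 : (c.*2.+1 < d + d)%N by have := ltn_ord c; rewrite -addnn; lia.
  have := h _ c0; have := h _ c1.
  rewrite !(directionE _ (c := c)); try by rewrite /= ?uphalf_double ?doubleK.
  rewrite /= odd_double /= => h1 h2.
  by rewrite ler_norml; apply/andP; split; lra.
rewrite -[`|x i - x j|]/(mx_norm _) mx_normrE; apply: bigmax_le.
  by apply: le_trans (key (Ordinal d0)).
by move=> [a b] _; rewrite !mxE /= ord1; exact: key.
Qed.

End Input.

Section Bounds.
Variable R : realType.

Lemma ln_le_sub1 (z : R) : 0 < z -> ln z <= z - 1.
Proof. by move=> z0; rewrite -{1}(subrKC 1 z); apply: le_ln1Dx; lra. Qed.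

Lemma log1_ge1 (z : R) : 1 <= log1 z.
Proof. by rewrite /log1 le_max lexx. Qed.

Lemma ln_le_log1 (z : R) : ln z <= log1 z.
Proof. by rewrite /log1 le_max lexx orbT. Qed.

Lemma log1_le (y z : R) : 0 < y -> y <= z -> log1 y <= log1 z.
Proof.
move=> y0 yz; rewrite /log1 ge_max le_max lexx /= le_max ler_ln ?posrE ?yz ?orbT //.
exact: lt_le_trans yz.
Qed.

Lemma expn_lt_ln (b m : nat) : (2 ^ b < m)%N -> b%:R <= 2 * ln m%:R :> R.
Proof.
move=> h; have l2 := ln2_ge R.
have : ln (2 ^+ b) <= ln m%:R :> R.
  rewrite ler_ln ?posrE ?exprn_gt0 ?ltr0n //; last by apply: leq_ltn_trans h.
  by rewrite -natrX ler_nat ltnW.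
have b0 : 0 <= b%:R :> R by [].
rewrite lnXn // -[X in X <= _]mulr_natl => hb.
by have := le_trans (ler_wpM2l b0 l2) hb; lra.
Qed.

Lemma log_ratio_le m f n : (m <= n)%N -> (0 < f)%N ->
  (2 * log_ratio m f)%:R <= 6 * log1 n%:R :> R.
Proof.
move=> mn f0; have [_ hlt] := log_ratio_spec m f0.
have h1 := log1_ge1 n%:R; have h2 := ln_le_log1 n%:R.
case eb: (log_ratio m f) hlt => [|b] hlt; first by rewrite muln0; lra.
have := hlt b (ltnSn b) => hb.
have : b%:R <= 2 * ln n%:R :> R.
  by apply: expn_lt_ln; apply: leq_trans mn; apply: leq_ltn_trans hb; rewrite leq_pmulr.
by rewrite natrM -natr1; lra.
Qed.

(** Minimality bounds 2 ^ (2 ^ (J - 1)) by 4 d, and two logarithms give the iterated one; J = 0 is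
    separate. *)
Lemma doubling_steps_le (J d : nat) : (0 < d)%N ->
  (forall j, (j < J)%N -> (2 ^ (2 ^ j) < 4 * d)%N) ->
  J%:R <= 10 * log1 (log1 d%:R) :> R.
Proof.
move=> d0; case: J => [|J] hJ.
  by rewrite mulr_ge0 //; apply: le_trans (log1_ge1 _).
have h1 := expn_lt_ln (hJ J (ltnSn J)).
have l4 : ln 4%:R <= 3 :> R by apply: le_trans (ln_le_sub1 _) _; rewrite ?ltr0n //; lra.
have g1 := log1_ge1 d%:R; have g2 := ln_le_log1 d%:R.
have h2 : (2 ^ J)%:R <= 8 * log1 d%:R :> R.
  apply: le_trans h1 _; rewrite natrM lnM ?posrE ?ltr0n //; lra.
have e1 : J%:R <= 2 * ln (8 * log1 d%:R) :> R.
  have l2 := ln2_ge R.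
  have : ln (2 ^+ J) <= ln (8 * log1 d%:R) :> R.
    by rewrite ler_ln ?posrE ?exprn_gt0 ?mulr_gt0 // -?natrX //; lra.
  have b0 : 0 <= J%:R :> R by [].
  rewrite lnXn // -[X in X <= _]mulr_natl => hb.
  by have := le_trans (ler_wpM2l b0 l2) hb; lra.
have l8 : ln 8 <= 3 :> R.
  rewrite (_ : 8 = 2 ^+ 3 :> R); last by ring.
  have h3 : ln 2 <= 2 - 1 :> R by apply: ln_le_sub1.
  by rewrite lnXn // -[X in X <= _]mulr_natl; lra.
have g3 := ln_le_log1 (log1 d%:R : R); have g4 := log1_ge1 (log1 d%:R : R).
have g5 : ln (8 * log1 d%:R) = ln 8 + ln (log1 d%:R) :> R by rewrite lnM ?posrE //; lra.
by rewrite -[J.+1%:R]natr1; lra.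
Qed.

Lemma log1_log1_le (y z : R) : 1 <= y -> y <= z -> log1 (log1 y) <= log1 z.
Proof.
move=> y1 yz; have h := log1_ge1 y.
have h2 := ln_le_sub1 (lt_le_trans ltr01 h).
have h3 : log1 y <= log1 z by apply: log1_le => //; lra.
by rewrite [log1 (log1 y)]/log1 ge_max log1_ge1 /=; lra.
Qed.

(** One logarithmic factor comes from [weight], that is, from the number of splits per point, the
    other from lg + J + 1, the sorting and the windows. 210 = 3 * 14 * 5 multiplies the bounds of
    the three factors. *)
Lemma time_bound (c n d J lg : nat) (t : R) : (0 < n)%N -> (0 < d)%N ->
  J%:R <= 10 * log1 (log1 d%:R) :> R -> lg%:R <= 1 + 2 * ln n%:R :> R ->
  t <= (100 * (n * d.+1) + 100 * J + 201)%:R +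
    ((c * ((d + d).+1 * (lg + J + 1)))%:R * weight R (d + d) n + 20) ->
  t <= soft_O (1500 + 210 * c%:R) 2 (n * d ^ 2)%:R.
Proof.
move=> n0 d0 hJ hlg ht; rewrite /soft_O; set F := (n * d ^ 2)%:R : R.
set l := log1 F.
have nR : 1 <= n%:R :> R by rewrite ler1n.
have dR : 1 <= d%:R :> R by rewrite ler1n.
have eF : F = n%:R * d%:R ^+ 2 by rewrite /F natrM natrX.
have dd : d%:R <= d%:R ^+ 2 :> R by rewrite expr2 ler_peMr //; lra.
have ndF : n%:R * d%:R <= F by rewrite eF ler_wpM2l.
have nF : n%:R <= F by apply: le_trans ndF; rewrite ler_peMr //; lra.
have dF : d%:R <= F.
  by rewrite eF; apply: le_trans dd _; rewrite ler_peMl //; apply: exprn_ge0; lra.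
have F1 : 1 <= F by lra.
have l1 : 1 <= l := log1_ge1 F.
have lnn : ln n%:R <= l by apply: le_trans (ln_le_log1 _) _; apply: log1_le; lra.
have lnn0 : 0 <= ln n%:R :> R by rewrite ln_ge0.
have lnd : log1 (log1 d%:R) <= l by apply: log1_log1_le.
have Jl : J%:R <= 10 * l by lra.
have Ql : (lg + J + 1)%:R <= 14 * l by rewrite !natrD; lra.
have Dd : ((d + d).+1)%:R <= 3 * d%:R :> R by rewrite -natr1 natrD; lra.
have W : weight R (d + d) n <= 5 * (n%:R * d%:R * l).
  rewrite /weight !natrD.
  have h : d%:R * ln n%:R <= d%:R * l by rewrite ler_wpM2l.
  have h' : 1 <= d%:R * l by nra.
  apply: le_trans (_ : n%:R * (5 * (d%:R * l)) <= _); last by rewrite mulrCA !mulrA.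
  rewrite ler_wpM2l //; move: h h'; rewrite !mulrDl.
  by move: (d%:R * ln _) (d%:R * l) => X Y; lra.
have W0 := weight_ge0 R (d + d) n.
have main : (c * ((d + d).+1 * (lg + J + 1)))%:R * weight R (d + d) n <= 210 * c%:R * (F * l ^+ 2).
  rewrite !natrM; set u := ((d + d).+1)%:R in Dd *; set v := (lg + J + 1)%:R in Ql *.
  have uv : u * v <= 3 * d%:R * (14 * l) by apply: ler_pM.
  have uvw : u * v * weight R (d + d) n <= 3 * d%:R * (14 * l) * (5 * (n%:R * d%:R * l)).
    by apply: ler_pM => //; rewrite mulr_ge0.
  have := ler_wpM2l (ler0n R c) uvw; rewrite eF => h.
  apply: le_trans (_ : c%:R * (3 * d%:R * (14 * l) * (5 * (n%:R * d%:R * l))) <= _).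
    by apply: le_trans h; rewrite !mulrA.
  by rewrite le_eqVlt; apply/orP; left; apply/eqP; ring.
have Fl : F <= F * l ^+ 2.
  by rewrite ler_peMr ?exprn_ege1 //; lra.
have ll : l <= F * l ^+ 2.
  have : l <= l ^+ 2 by rewrite expr2 ler_peMr //; lra.
  move=> h; apply: le_trans h _; rewrite ler_peMl //; apply: exprn_ge0; lra.
have rest : (100 * (n * d.+1) + 100 * J + 201)%:R + 20 <= 1500 * (F * l ^+ 2) :> R.
  have e : (n * d.+1)%:R <= 2 * F by rewrite natrM -natr1; nra.
  rewrite (natrD _ (_ + _) 201) (natrD _ (100 * _)) (natrM _ 100 (n * d.+1)) (natrM _ 100 J).
  move: e Jl Fl ll F1.
  by move: (n * d.+1)%:R J%:R (F * l ^+ 2) => A B X e Jl Fl ll F1; lra.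
move: main rest ht; rewrite -!mulrA mulrDl; lra.
Qed.

End Bounds.

(** * The distribution of the output *)

Section Decomposition.
Variables (R : realType) (n d J : nat) (x : 'I_n -> 'rV[R]_d) (Delta : R).
Notation D := (d + d)%N.
Notation val := (direction x Delta).
Hypothesis n_gt0 : (0 < n)%N.
Hypothesis d_gt0 : (0 < d)%N.
Hypothesis Delta_gt0 : 0 < Delta.
Hypothesis J_ge : (4 * d <= 2 ^ (2 ^ J))%N.
Hypothesis J_min : forall j, (j < J)%N -> (2 ^ (2 ^ j) < 4 * d)%N.

Let D_gt0 : (0 < D)%N. Proof. by rewrite addn_gt0 d_gt0. Qed.

Let J_gt0 : (0 < J)%N.
Proof. by case: J J_ge => // h; move: h d_gt0; rewrite expn0 expn1; lia. Qed.

Let DD_le : (D + D <= 2 ^ (2 ^ J))%N.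
Proof. by apply: leq_trans J_ge; lia. Qed.

Let val_opp k : (k < D)%N -> exists2 k', (k' < D)%N & forall i, val i k' = - val i k.
Proof. exact: direction_opp. Qed.

Let fuel := (n * 2)%N.
Let c0 := initial_config n.
Let valid_c0 : valid D val Delta c0 := valid_initial D val Delta n_gt0.

Let potential_c0 : (potential c0 <= fuel)%N.
Proof. by rewrite /potential /= cats0 size_enum_ord leq_subr. Qed.

Notation final us := (run D J val Delta fuel c0 us 0).

Lemma decomposition_progP (u : nat -> R) : unit_tape u ->
  exists t s', [/\ exec u decomposition_prog (input x Delta) t s',
    (t <= 100 * (n * d.+1) + 100 * J + 201 +
       run_cost D J (up_log 2 n) val Delta fuel c0 u 0)%N &
    output n s' = clusters (final u)].
Proof.
move=> hu; suff [t [s' [e [h1 h2]]]] : ok u decomposition_prog (input x Delta) (fun t s' =>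
    (t <= 100 * (n * d.+1) + 100 * J + 201 +
       run_cost D J (up_log 2 n) val Delta fuel c0 u 0)%N /\
    output n s' = clusters (final u)) by exists t, s'.
apply: ok_seq; apply: (init_progP u n_gt0 J_ge J_min) => t1 s1 ht1 rs1 ep1.
have inv_splits c p ps uu (vc : valid D val Delta c) (ec : pending c = p :: ps) :=
  @valid_splits R n D J val Delta Delta_gt0 D_gt0 J_gt0 DD_le c p ps uu vc ec.
have inv_step c p ps uu (vc : valid D val Delta c) (ec : pending c = p :: ps) :=
  @valid_step R n D J val Delta Delta_gt0 D_gt0 J_gt0 DD_le val_opp c p ps uu vc ec.
have n_lg : (n <= 2 ^ up_log 2 n)%N by apply: up_logP.
apply: (main_loopP n_lg inv_splits inv_step hu rs1 valid_c0 potential_c0) => t2 s2.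
rewrite ep1 => ht2 _ el; split.
  by move: ht1 ht2; clear; move: (run_cost _ _ _ _ _ _ _ _ _); lia.
by rewrite /output /clusters el.
Qed.

Lemma clusters_bounded c : valid D val Delta c -> pending c = [::] ->
  bounded_partition (linf_dist x) Delta (clusters c).
Proof.
move=> [_ _ _ hdiam] ec; have pP := preim_partitionP (fun i : 'I_n => label c i) [set: 'I_n].
split=> // C CQ a b aC bC; apply/linf_dist_le => // k kD.
apply: hdiam; rewrite ?ec //.
have /and3P[_ tI _] := pP.
have := bC; rewrite -(finset.def_pblock tI CQ aC) /finset.preim_partition.
rewrite finset.pblock_equivalence_partition ?inE //; first by move/eqP.
by split=> // /eqP ->.
Qed.

Definition decomposition_law : {ffun {set {set 'I_n}} -> R} :=
  [ffun Q => law (chosen D J val Delta) (next_set D J val Delta) (@finished n)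
     (@clusters n) fuel c0 Q].

(** beta times gamma is the exponent of [decay] for all n points. delta makes the ramp exponent, at
    most 6 log n, times 8 J gamma at most 1/4, as [cut_bound] requires: 6 * 8 * 4 = 192. The bound
    gamma <= 1/16 follows. *)
Lemma decomposition_law_padded :
  padded_decomposition (linf_dist x) (48 * (8 * J%:R) * (1 + ln n%:R))
    (192 * (J%:R * log1 n%:R))^-1 Delta decomposition_law.
Proof.
split.
- split=> [Q|]; first by rewrite ffunE law_ge0.
  by under eq_bigr do rewrite ffunE; apply: law_sum1; exact: chosen_measurable.
- move=> Q; rewrite ffunE => hQ.
  have [c' vc' [ec' ->]] :=
    law_bounded Delta_gt0 D_gt0 J_gt0 DD_le val_opp valid_c0 hQ potential_c0.
  exact: clusters_bounded.
move=> i gamma /andP[g0 g1].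
have JR : 1 <= J%:R :> R by rewrite ler1n.
have lR := log1_ge1 n%:R : 1 <= _ :> R.
have JlR : 1 <= J%:R * log1 n%:R :> R by apply: mulr_ege1.
have g2 : gamma * (192 * (J%:R * log1 n%:R)) <= 1.
  by rewrite -ler_pdivlMr ?div1r //; lra.
have hlog m f : (m <= n)%N -> (0 < f)%N ->
    (2 * log_ratio m f)%:R * (8 * J%:R * gamma) <= 4^-1 :> R.
  move=> mn f0; apply: le_trans (_ : 6 * log1 n%:R * (8 * J%:R * gamma) <= _).
    by rewrite ler_wpM2r ?mulr_ge0 // log_ratio_le.
  rewrite (_ : _ * _ = 48 * (gamma * (J%:R * log1 n%:R))); last by ring.
  by move: g2; rewrite mulrCA; move: (gamma * _) => X; lra.
have g16 : gamma <= 16^-1.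
  have : gamma * 192 <= gamma * (192 * (J%:R * log1 n%:R)).
    by rewrite ler_wpM2l // ler_peMr.
  by lra.
have hball y k : y \in cball (linf_dist x) i (gamma * Delta) -> (k < D)%N ->
    val i k - val y k <= gamma * Delta.
  by rewrite inE => /linf_dist_le; apply.
have hub y k : y \in cball (linf_dist x) i (gamma * Delta) -> (k < D)%N ->
    val y k <= val i k + gamma * Delta.
  move=> hy kD; have [k' kD' hk'] := val_opp kD.
  by have := hball y k' hy kD'; rewrite !hk'; lra.
have hlb y k : y \in cball (linf_dist x) i (gamma * Delta) -> (k < D)%N ->
    val i k <= val y k + gamma * Delta.
  by move=> hy kD; have := hball y k hy kD; lra.
have hi : i \in cball (linf_dist x) i (gamma * Delta).
  by rewrite inE /linf_dist subrr normr0 mulr_ge0 // ltW.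
have := padded_pending Delta_gt0 D_gt0 J_gt0 DD_le val_opp g0 g16 hlog hub hlb hi
  (p := enum 'I_n) valid_c0 potential_c0 (mem_head _ _) (fun y _ => mem_enum _ y).
rewrite size_enum_ord /decay /good_prob /prob_of => h.
have -> : 48 * (8 * J%:R) * (1 + ln n%:R) * gamma = 48 * (8 * J%:R * gamma) * (1 + ln n%:R).
  by ring.
by apply: le_trans h _; under [X in _ <= X]eq_bigr do rewrite ffunE.
Qed.

(** Every tape in the unit interval leads to a halting run, so the event of output Q is the
    corresponding event of the abstract chain and inherits its measurability. *)
Lemma decomposition_output (disp : measure_display) (Omega : measurableType disp)
    (P : probability Omega R) (U : nat -> {RV P >-> R}) : iid_uniform U ->
  output_distribution U decomposition_prog (input x Delta) decomposition_law.
Proof.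
move=> hU Q; rewrite ffunE; have [hunit _ _] := hU.
have := chain_prob (next_set D J val Delta) (@finished n) (@clusters n)
  (chosen_measurable D J val Delta_gt0) hU fuel c0 Q.
rewrite (_ : mkset _ =
  [set w | halts_with decomposition_prog (fun m => U m w) (input x Delta) Q]%classic) //.
apply/seteqP; split=> w /=; have [t [s' [e _ eo]]] := decomposition_progP (hunit w).
  by rewrite chain_run -eo => eQ; exists t, s'.
by case=> t1 [s1 [e1 <-]]; rewrite chain_run -eo (exec_det e1 e).
Qed.

End Decomposition.

Theorem theorem1p3 (R : realType) :
  exists (A : program) (C : R) (k : nat),
  0 < C /\
  forall (n d : nat) (x : 'I_n -> 'rV[R]_d) (Delta : R),
    (0 < n)%N -> (0 < d)%N -> injective x -> 0 < Delta ->
    (forall u : nat -> R, unit_tape u ->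
       halts_within A u (input x Delta) (soft_O C k (n * d ^ 2)%:R)) /\
    exists beta delta : R,
      [/\ 0 < beta, 0 < delta,
          Num.max beta delta^-1 <= C * (log1 n%:R * log1 (log1 d%:R)) &
          forall (disp : measure_display) (Omega : measurableType disp)
                 (P : probability Omega R) (U : nat -> {RV P >-> R}),
            iid_uniform U ->
            exists D : {ffun {set {set 'I_n}} -> R},
              padded_decomposition (linf_dist x) beta delta Delta D /\
              output_distribution U A (input x Delta) D].
Proof.
(* A variable in place of the large numeral keeps the arithmetic symbolic. *)
have [c ec] : exists c : nat, c = 3020%N by exists 3020%N.
have cR : 0 <= c%:R :> R by [].
(* One constant for both claims: time needs 1500 + 210 c, beta needs 48 * 8 * 2 * 10 = 7680 and 1 /
   delta needs 192 * 10. *)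
exists decomposition_prog, (100 * 100 + 210 * c%:R), 2%N; split; first by lra.
move=> n d x Delta n0 d0 _ D0.
have exJ : exists J, (4 * d <= 2 ^ (2 ^ J))%N.
  exists (4 * d)%N; apply: ltnW; apply: leq_ltn_trans (ltn_expl _ (isT : 1 < 2)%N).
  by apply: ltnW; apply: ltn_expl.
have [J J_ge J_min'] := ex_minnP exJ.
have J_min j : (j < J)%N -> (2 ^ (2 ^ j) < 4 * d)%N.
  by move=> jJ; rewrite ltnNge; apply/negP => /J_min'; rewrite leqNgt jJ.
have J0 : (0 < J)%N.
  by case: (J) J_ge => // h; move: h d0; rewrite expn0 expn1; lia.
have hJ := doubling_steps_le R d0 J_min.
have Dpos : (0 < d + d)%N by rewrite addn_gt0 d0.
have DD_le : (d + d + (d + d) <= 2 ^ (2 ^ J))%N by apply: leq_trans J_ge; lia.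
have lnR : 0 <= ln n%:R :> R by rewrite ln_ge0 // ler1n.
have l1 := log1_ge1 n%:R : 1 <= _ :> R.
have l2 := log1_ge1 (log1 d%:R) : 1 <= _ :> R.
have l3 := ln_le_log1 n%:R : _ <= _ :> R.
have JR : 1 <= J%:R :> R by rewrite ler1n.
split.
  move=> u hu; have [t [s' [e ht _]]] := decomposition_progP x n0 d0 D0 J_ge J_min hu.
  exists t, s'; split=> //.
  have hlg : (up_log 2 n)%:R <= 1 + 2 * ln n%:R :> R.
    case: (ltnP 1 n) => n1; last first.
      have -> : n = 1%N by lia.
      by rewrite (_ : up_log 2 1 = 0%N) // ln1 mulr0 addr0 ler01.
    have /andP[h1 _] := up_log_bounds (isT : 1 < 2)%N n1.
    have := expn_lt_ln R h1; case: (up_log 2 n) => [|l] /=; first by lra.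
    by rewrite -[l.+1%:R]natr1; lra.
  have hrun := run_cost_le D0 Dpos J0 DD_le (@direction_opp _ _ _ x Delta) (up_log 2 n)
    (n * 2) 0 (valid_initial _ _ _ n0) hu.
  rewrite -ec /total_weight /= big_seq1 size_enum_ord in hrun.
  move: ht; rewrite -(ler_nat R) natrD => ht.
  apply: le_trans (time_bound (c := c) n0 d0 hJ hlg (le_trans ht _)) _.
    by rewrite lerD2l; exact: hrun.
  rewrite /soft_O ler_wpM2r ?exprn_ge0 ?ler_wpM2r //; last by lra.
  by apply: le_trans (log1_ge1 _).
have JL : J%:R * log1 n%:R <= 10 * (log1 n%:R * log1 (log1 d%:R)) :> R.
  by rewrite mulrC mulrCA ler_wpM2l //; lra.
have JL0 : 1 <= J%:R * log1 n%:R :> R by apply: mulr_ege1.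
exists (48 * (8 * J%:R) * (1 + ln n%:R)), (192 * (J%:R * log1 n%:R))^-1; split.
- by rewrite !mulr_gt0 //; lra.
- by rewrite invr_gt0; lra.
- set X := log1 n%:R * log1 (log1 d%:R) in JL *.
  have cX : 0 <= c%:R * X by rewrite mulr_ge0 // /X mulr_ge0 //; lra.
  rewrite invrK ge_max; apply/andP; split; last by rewrite mulrDl; lra.
  have h1 : J%:R * (1 + ln n%:R) <= 2 * (J%:R * log1 n%:R) :> R.
    by rewrite mulrCA ler_wpM2l //; lra.
  by rewrite -!mulrA mulrDl; lra.
move=> disp Omega P U hU; exists (decomposition_law J x Delta); split.
  exact: decomposition_law_padded.
exact: decomposition_output.
Qed.
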